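(* Let $\lambda>0$. Suppose that $n$ is an integer with $1\le n\le q$ such that $F_i(x,y)\equiv0$ and $G_i(x,y)\equiv 0$ for all $i<n$, and that $h\ge0$ is an integer such that $\partial_xF_k(x,y)\equiv-\partial_yG_k(x,y)$ for all $k<n+h$. Put $$\gamma_{n+h}(\lambda)=\partial_xF_{n+h}(\sqrt\lambda,0)+\partial_yG_{n+h}(\sqrt\lambda,0).$$ Let $x_\ast(t),y_\ast(t)$ be the solution of the perturbed system $$\frac{dx}{dt}=\partial_y H(x,y;\lambda)+F(x,y,t),\qquad \frac{dy}{dt}=-\partial_x H(x,y;\lambda)+G(x,y,t)$$ with asymptotics $$x_\ast(t)=\sigma+\sum_{k=1}^{\infty}t^{-\frac kq}x_k,\qquad y_\ast(t)=\sum_{k=1}^{\infty}t^{-\frac kq}y_k,\qquad t\to\infty,$$ where $\sigma=\sqrt\lambda$ and $x_k,y_k$ are real constants. Then: (i) if $\gamma_{n+h}(\lambda)<0$, the solution $x_\ast(t),y_\ast(t)$ is stable; (ii) if $\gamma_{n+h}(\lambda)>0$, the solution $x_\ast(t),y_\ast(t)$ is unstable.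
   Context: Standing setting. The functions $H(x,y;\lambda)$, $F(x,y,t)$, $G(x,y,t)$ are smooth for all $(x,y)\in\mathbb R^2$, $t>0$, $\lambda\in\mathbb R$. The Hamiltonian of the limiting system is $H(x,y;\lambda)=\frac{y^2}{2}+V(x;\lambda)$ with $\partial_xV(x;\lambda)=(x^2-\lambda)w(x)$, where, for some $d_0>0$, $w(x)>0$ for all $(x,\lambda)\in\{|x|<\sqrt\lambda+d_0,\ \lambda\ge 0\}\cup\{|x|<d_0,\ \lambda<0\}$. The perturbations satisfy $F(x,y,t)\to0$ and $G(x,y,t)\to0$ as $t\to\infty$ for $(x,y)$ in any compact subset of $\mathbb R^2$, and have power-law asymptotics $$F(x,y,t)=\sum_{k=1}^\infty t^{-\frac kq}F_k(x,y),\qquad G(x,y,t)=\sum_{k=1}^\infty t^{-\frac kq}G_k(x,y),\qquad t\to\infty,$$ where $q$ is a positive integer and $F_k,G_k$ are smooth functions on $\mathbb R^2$. Infinite series followed by ''$t\to\infty$'' are understood as asymptotic expansions. The coefficients $x_k,y_k$ of the solution's expansion are those obtained by substituting the series into the system and equating the coefficients of equal powers of $t$. Stability and instability of a solution are understood in the sense of Lyapunov, as $t\to\infty$.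
   Formalization: Part (ii) is proved under the added condition n+h ≤ q, without which it is false; the asymptotic expansions of F and G are taken uniformly on compact sets and assumed differentiable term by term once in x and in y. *)

(* Defs.v *)
From Stdlib Require Import Reals.
From Coquelicot Require Import Coquelicot.

Open Scope R_scope.

Definition d1 (f : R -> R -> R -> R) : R -> R -> R -> R :=
  fun x y s => Derive (fun u => f u y s) x.
Definition d2 (f : R -> R -> R -> R) : R -> R -> R -> R :=
  fun x y s => Derive (fun u => f x u s) y.
Definition d3 (f : R -> R -> R -> R) : R -> R -> R -> R :=
  fun x y s => Derive (fun u => f x y u) s.

(* Only meaningful when D is open. *)
Fixpoint C_on (m : nat) (D : R -> R -> R -> Prop) (f : R -> R -> R -> R) : Prop :=
  (forall x y s, D x y s ->
     continuous (fun p : R * R * R => f (fst (fst p)) (snd (fst p)) (snd p))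
                (x, y, s)) /\
  match m with
  | O => True
  | S m' =>
      (forall x y s, D x y s ->
         ex_derive (fun u => f u y s) x /\
         ex_derive (fun u => f x u s) y /\
         ex_derive (fun u => f x y u) s) /\
      C_on m' D (d1 f) /\ C_on m' D (d2 f) /\ C_on m' D (d3 f)
  end.

Definition smooth_on (D : R -> R -> R -> Prop) (f : R -> R -> R -> R) : Prop :=
  forall m, C_on m D f.

Definition smooth3 (f : R -> R -> R -> R) : Prop :=
  smooth_on (fun _ _ _ => True) f.

Definition smooth_pos_time (f : R -> R -> R -> R) : Prop :=
  smooth_on (fun _ _ t => 0 < t) f.

Definition smooth2 (f : R -> R -> R) : Prop := smooth3 (fun x y _ => f x y).

Definition dx (f : R -> R -> R) (x y : R) : R := Derive (fun u => f u y) x.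
Definition dy (f : R -> R -> R) (x y : R) : R := Derive (fun v => f x v) y.

Definition Ham (V : R -> R -> R) (x y lambda : R) : R := y ^ 2 / 2 + V x lambda.

Definition rhs_x (V : R -> R -> R) (lambda : R) (F : R -> R -> R -> R)
    (x y t : R) : R :=
  d2 (Ham V) x y lambda + F x y t.
Definition rhs_y (V : R -> R -> R) (lambda : R) (G : R -> R -> R -> R)
    (x y t : R) : R :=
  - d1 (Ham V) x y lambda + G x y t.

(* t^(-k/q), for t > 0. *)
Definition tpow (q k : nat) (t : R) : R := Rpower t (- (INR k / INR q)).

Definition vanishes_at_infinity (F : R -> R -> R -> R) : Prop :=
  forall M eps : R, 0 < eps ->
  exists T : R, 0 < T /\
  forall t x y : R, T < t -> Rabs x <= M -> Rabs y <= M -> Rabs (F x y t) < eps.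

(* F ~ sum_(k >= 1) t^(-k/q) F_k in the sense of Poincare, uniformly on compact
   sets: for every N, the N-th remainder is o(t^(-N/q)). The value Fk 0 is not
   used. *)
Definition expansion_unif (q : nat) (F : R -> R -> R -> R)
    (Fk : nat -> R -> R -> R) : Prop :=
  forall (N : nat) (M eps : R), 0 < eps ->
  exists T : R, 0 < T /\
  forall t x y : R, T < t -> Rabs x <= M -> Rabs y <= M ->
    Rabs (F x y t - sum_n_m (fun k => tpow q k t * Fk k x y) 1 N)
      <= eps * tpow q N t.

(* The expansion may be differentiated once in x and in y. This is needed for
   the F_k to determine the linearised system: otherwise a term such as
   - exp (- t) * sin (exp (5 * t) * y) would have a zero expansion. *)
Definition power_law (q : nat) (F : R -> R -> R -> R)
    (Fk : nat -> R -> R -> R) : Prop :=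
  expansion_unif q F Fk /\
  expansion_unif q (d1 F) (fun k => dx (Fk k)) /\
  expansion_unif q (d2 F) (fun k => dy (Fk k)).

(* u(t) ~ c0 + sum_(k >= 1) t^(-k/q) c_k; the value c 0 is not used. *)
Definition expansion (q : nat) (u : R -> R) (c0 : R) (c : nat -> R) : Prop :=
  forall N : nat,
  is_lim (fun t => (u t - (c0 + sum_n_m (fun k => tpow q k t * c k) 1 N))
                     / tpow q N t) p_infty 0.

(* The derivative at t = t0 is two-sided; this costs nothing, since only the
   values on [t0, +oo) matter and a one-sided solution extends linearly to the
   left of t0. *)
Definition solution_from (f g : R -> R -> R -> R) (t0 : R) (x y : R -> R) : Prop :=
  forall t, t0 <= t ->
    is_derive x t (f (x t) (y t) t) /\ is_derive y t (g (x t) (y t) t).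

Definition dist2 (a b a' b' : R) : R := sqrt ((a - a') ^ 2 + (b - b') ^ 2).

(* Lyapunov stability of the solution (xs, ys) given on [t0, +oo): from every
   initial time, the solutions starting close enough exist for all later times
   and stay close. For the vector fields considered here solutions are unique,
   so "exists" describes the solution with the given initial data. *)
Definition stable (f g : R -> R -> R -> R) (t0 : R) (xs ys : R -> R) : Prop :=
  forall eps tau : R, 0 < eps -> t0 <= tau ->
  exists delta : R, 0 < delta /\
  forall a b : R, dist2 a b (xs tau) (ys tau) < delta ->
  exists x y : R -> R,
    solution_from f g tau x y /\ x tau = a /\ y tau = b /\
    forall t, tau <= t -> dist2 (x t) (y t) (xs t) (ys t) < eps.

Definition unstable (f g : R -> R -> R -> R) (t0 : R) (xs ys : R -> R) : Prop :=
  ~ stable f g t0 xs ys.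

Definition gamma_coef (Fk Gk : nat -> R -> R -> R) (m : nat) (lambda : R) : R :=
  dx (Fk m) (sqrt lambda) 0 + dy (Gk m) (sqrt lambda) 0.

(* Main.v *)
From Stdlib Require Import Reals Lra Lia List ClassicalEpsilon.
From Coquelicot Require Import Coquelicot.
Require Import Defs.
Open Scope R_scope.

(** Write [m] for [n + h], [e_k] for [t^(-k/q)], and [(u, v)] for the deviation of a
    solution from [(xs, ys)].  Put [P_0 = y], [Q_0 = - dV/dx], [P_k = F_k] and
    [Q_k = G_k] for [k >= 1].  Up to an error [o(e_m) (|u| + |v|)], the deviation obeys
      [u' = sum_(k <= m) e_k dP_k],   [v' = sum_(k <= m) e_k dQ_k],
    where [dP_k] and [dQ_k] are the increments of [P_k] and [Q_k] from a base point
    [(X, Y)] to [(X + u, Y + v)], and [(X, Y)] is the expansion of [(xs, ys)] cut after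
    the order [m].

    For [k < m] the field [(P_k, Q_k)] is divergence free, hence has a stream function
    [H_k] ([stream_function]).  The second order Taylor remainder of [H_k] at the base
    point has the gradient [(- dQ_k, dP_k)] in [(u, v)], so the sum over [k < m] of [e_k]
    times these remainders would be conserved if the terms with [k < m] were alone and
    time stood still in the coefficients.  Time moves them at the rate [t^(-1-1/q)],
    which is integrable; this is why the remainders are taken at [(X, Y)], a polynomial
    in [t^(-1/q)], and not at [(xs, ys)].  It matters that the conserved sum is fully
    nonlinear: no term of order [e_k |(u, v)|^3] with [k < m] could be absorbed by the
    terms of order [e_m].

    The terms of order [e_m] change this sum at the rate of a quadratic form in [(u, v)],
    which need not be definite, although its average over the fast rotation is.  Adding
    [e_m] times a suitable quadratic form, the corrector, replaces it by its average.
    With [omega2 = 2 sigma w(sigma)] the resulting energy [K] satisfies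
      [K = (omega2 u^2 + v^2) / 2 + small],
      [K' = e_m (gamma / 2) (omega2 u^2 + v^2) + small]
    ([energy_leading], [energy_derive]), where small means a small multiple of the main
    term plus [O(t^(-1-1/q)) (|u| + |v|)^2].

    If [gamma < 0], then [K' <= C t^(-1-1/q) K], so [K] grows at most by a constant factor
    and the deviation stays small ([lyapunov_confines]).  If [gamma > 0] and
    [m <= q], then [e_m >= 1/t], hence [K' >= c K / t], and [K] is unbounded as the
    integral of [1/t] diverges ([lyapunov_expels]).

    Stability also asserts that nearby solutions exist for all later times.  They are
    obtained by Picard iteration for a field in which the deviation is clamped to a box,
    which makes it bounded and globally Lipschitz ([clamped_solution]); for small initial
    deviations the estimates then show that the clamping never acts. *)

(** * Two-variable calculus *)

Lemma abs_increment_le (f df : R -> R) (a b A : R) :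
  (forall s, Rmin a b <= s <= Rmax a b -> is_derive f s (df s)) ->
  (forall s, Rmin a b <= s <= Rmax a b -> Rabs (df s) <= A) ->
  Rabs (f b - f a) <= A * Rabs (b - a).
Proof.
  intros Hd HA.
  destruct (MVT_gen f a b df) as [c [Hc ->]].
  - intros s Hs; apply Hd; lra.
  - intros s Hs; apply derivable_continuous_pt.
    exists (df s); apply is_derive_Reals, Hd, Hs.
  - rewrite Rabs_mult.
    apply Rmult_le_compat_r; [apply Rabs_pos | apply HA, Hc].
Qed.

Lemma between_box (a b s M : R) :
  Rabs a <= M -> Rabs b <= M -> Rmin a b <= s <= Rmax a b -> Rabs s <= M.
Proof.
  intros Ha Hb Hs.
  apply Rabs_le_between in Ha; apply Rabs_le_between in Hb.
  apply Rabs_le_between.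
  revert Hs; unfold Rmin, Rmax; destruct (Rle_dec a b); lra.
Qed.

Lemma between_dist (a b s c : R) :
  Rmin a b <= s <= Rmax a b -> Rabs (s - c) <= Rabs (a - c) + Rabs (b - a).
Proof.
  unfold Rmin, Rmax; intros Hs.
  destruct (Rle_dec a b); unfold Rabs;
    repeat destruct Rcase_abs; lra.
Qed.

Definition has_gradient (phi p1 p2 : R -> R -> R) : Prop :=
  (forall x y, is_derive (fun s => phi s y) x (p1 x y)) /\
  (forall x y, is_derive (fun s => phi x s) y (p2 x y)).

Lemma has_gradient_shift (phi p1 p2 : R -> R -> R) (a b : R) :
  has_gradient phi p1 p2 ->
  has_gradient (fun s w => phi (a + s) (b + w))
    (fun s w => p1 (a + s) (b + w)) (fun s w => p2 (a + s) (b + w)).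
Proof.
  intros [D1 D2].
  assert (T : forall c r : R, is_derive (fun z => c + z) r 1)
    by (intros; auto_derive; trivial).
  split; intros s w; rewrite <- (Rmult_1_l (_ (a + s) (b + w))).
  - apply (is_derive_comp (fun z => phi z (b + w)) (fun r => a + r)); [apply D1 | apply T].
  - apply (is_derive_comp (fun z => phi (a + s) z) (fun r => b + r)); [apply D2 | apply T].
Qed.

Lemma has_gradient_minus (phi p1 p2 psi r1 r2 : R -> R -> R) :
  has_gradient phi p1 p2 -> has_gradient psi r1 r2 ->
  has_gradient (fun s w => phi s w - psi s w)
    (fun s w => p1 s w - r1 s w) (fun s w => p2 s w - r2 s w).
Proof.
  intros [D1 D2] [E1 E2]; split; intros s w.
  - apply (is_derive_minus (fun r => phi r w) (fun r => psi r w)); auto.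
  - apply (is_derive_minus (fun r => phi s r) (fun r => psi s r)); auto.
Qed.

Lemma has_gradient_affine (a b c : R) :
  has_gradient (fun s w => a * s + b * w + c) (fun _ _ => a) (fun _ _ => b).
Proof. split; intros s w; auto_derive; trivial; ring. Qed.

(** The path follows a horizontal and then a vertical side of the rectangle, so the
    bound on the gradient is needed on that rectangle only. *)
Lemma abs_increment_2d_le (phi p1 p2 : R -> R -> R) (x0 y0 x1 y1 A : R) :
  has_gradient phi p1 p2 ->
  (forall s w, Rmin x0 x1 <= s <= Rmax x0 x1 -> Rmin y0 y1 <= w <= Rmax y0 y1 ->
     Rabs (p1 s w) <= A /\ Rabs (p2 s w) <= A) ->
  Rabs (phi x1 y1 - phi x0 y0) <= A * (Rabs (x1 - x0) + Rabs (y1 - y0)).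
Proof.
  intros [H1 H2] HA.
  pose proof (Rmin_l y0 y1); pose proof (Rmax_l y0 y1).
  pose proof (Rmin_r x0 x1); pose proof (Rmax_r x0 x1).
  replace (phi x1 y1 - phi x0 y0)
    with ((phi x1 y0 - phi x0 y0) + (phi x1 y1 - phi x1 y0)) by ring.
  eapply Rle_trans; [apply Rabs_triang |].
  rewrite Rmult_plus_distr_l.
  apply Rplus_le_compat.
  - apply (abs_increment_le (fun s => phi s y0) (fun s => p1 s y0)).
    + intros s _; apply H1.
    + intros s Hs; apply (HA s y0); lra.
  - apply (abs_increment_le (fun s => phi x1 s) (fun s => p2 x1 s)).
    + intros s _; apply H2.
    + intros s Hs; apply (HA x1 s); lra.
Qed.

Definition lip_on_boxes (p : R -> R -> R) : Prop :=
  forall M, exists C, 0 <= C /\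
  forall x y x' y', Rabs x <= M -> Rabs y <= M -> Rabs x' <= M -> Rabs y' <= M ->
    Rabs (p x y - p x' y') <= C * (Rabs (x - x') + Rabs (y - y')).

Lemma lip_on_boxes_bounded (p : R -> R -> R) (M : R) :
  lip_on_boxes p ->
  exists C, 0 <= C /\ forall x y, Rabs x <= M -> Rabs y <= M -> Rabs (p x y) <= C.
Proof.
  intros Hp; destruct (Hp M) as [C [HC H]].
  exists (Rabs (p 0 0) + C * (Rabs M + Rabs M)); split.
  { pose proof (Rabs_pos (p 0 0)); pose proof (Rabs_pos M); nra. }
  intros x y Hx Hy.
  pose proof (Rabs_pos x); pose proof (Rabs_pos y); pose proof (Rle_abs M).
  assert (Hz : Rabs 0 <= M) by (rewrite Rabs_R0; lra).
  pose proof (H x y 0 0 Hx Hy Hz Hz) as Hxy.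
  rewrite !Rminus_0_r in Hxy.
  replace (p x y) with (p 0 0 + (p x y - p 0 0)) by ring.
  eapply Rle_trans; [apply Rabs_triang |].
  apply Rplus_le_compat_l; eapply Rle_trans; [apply Hxy |].
  apply Rmult_le_compat_l; lra.
Qed.

Lemma lip_on_boxes_opp (p : R -> R -> R) :
  lip_on_boxes p -> lip_on_boxes (fun x y => - p x y).
Proof.
  intros Hp M; destruct (Hp M) as [C [HC H]]; exists C; split; [exact HC |].
  intros x y x' y' H1 H2 H3 H4.
  replace (- p x y - - p x' y') with (- (p x y - p x' y')) by ring.
  rewrite Rabs_Ropp; auto.
Qed.

(** Enough regularity for all the estimates below, and a stream function has it as soon
    as its field does. *)
Definition C11 (phi p1 p2 : R -> R -> R) : Prop :=
  has_gradient phi p1 p2 /\ lip_on_boxes p1 /\ lip_on_boxes p2.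

Lemma C11_lip (phi p1 p2 : R -> R -> R) : C11 phi p1 p2 -> lip_on_boxes phi.
Proof.
  intros [Hg [H1 H2]] M.
  destruct (lip_on_boxes_bounded p1 M H1) as [C1 [HC1 B1]].
  destruct (lip_on_boxes_bounded p2 M H2) as [C2 [HC2 B2]].
  exists (C1 + C2); split; [lra |].
  intros x y x' y' Hx Hy Hx' Hy'.
  apply (abs_increment_2d_le phi p1 p2); [exact Hg |].
  intros s w Hs Hw.
  assert (Rabs s <= M) by (eapply between_box; [exact Hx' | exact Hx | lra]).
  assert (Rabs w <= M) by (eapply between_box; [exact Hy' | exact Hy | lra]).
  split; eapply Rle_trans; [now apply B1 | lra | now apply B2 | lra].
Qed.

Lemma abs_plus_box (x u M : R) : Rabs x <= M -> Rabs u <= 1 -> Rabs (x + u) <= M + 1.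
Proof. intros; pose proof (Rabs_triang x u); lra. Qed.

(** The reference point [(x0, y0)] of the linear part may differ from the base point:
    the linear parts will be taken at the limit [(sigma, 0)] of a moving base point. *)
Lemma C11_taylor (phi p1 p2 : R -> R -> R) (M : R) :
  C11 phi p1 p2 ->
  exists C, 0 <= C /\
  forall x y x0 y0 u v,
    Rabs x <= M -> Rabs y <= M -> Rabs x0 <= M -> Rabs y0 <= M ->
    Rabs u <= 1 -> Rabs v <= 1 ->
    Rabs (phi (x + u) (y + v) - phi x y - p1 x0 y0 * u - p2 x0 y0 * v)
      <= C * (Rabs (x - x0) + Rabs (y - y0) + (Rabs u + Rabs v)) * (Rabs u + Rabs v).
Proof.
  intros [Hphi [H1 H2]].
  destruct (H1 (M + 1)) as [C1 [HC1 L1]].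
  destruct (H2 (M + 1)) as [C2 [HC2 L2]].
  exists (C1 + C2); split; [lra |].
  intros x y x0 y0 u v Hx Hy Hx0 Hy0 Hu Hv.
  set (A := (C1 + C2) * (Rabs (x - x0) + Rabs (y - y0) + (Rabs u + Rabs v))).
  pose (psi := fun s w => phi s w - (p1 x0 y0 * s + p2 x0 y0 * w + 0)).
  pose proof (has_gradient_minus _ _ _ _ _ _ Hphi
    (has_gradient_affine (p1 x0 y0) (p2 x0 y0) 0)) as Hpsi.
  replace (phi (x + u) (y + v) - phi x y - p1 x0 y0 * u - p2 x0 y0 * v)
    with (psi (x + u) (y + v) - psi x y) by (unfold psi; ring).
  replace (A * (Rabs u + Rabs v))
    with (A * (Rabs (x + u - x) + Rabs (y + v - y)))
    by (do 3 f_equal; ring).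
  apply (abs_increment_2d_le _ _ _ _ _ _ _ _ Hpsi).
  intros s w Hs Hw.
  pose proof (between_dist _ _ _ x0 Hs) as Ds.
  pose proof (between_dist _ _ _ y0 Hw) as Dw.
  replace (x + u - x) with u in Ds by ring.
  replace (y + v - y) with v in Dw by ring.
  pose proof (abs_plus_box _ _ _ Hx Hu); pose proof (abs_plus_box _ _ _ Hy Hv).
  assert (Rabs s <= M + 1) by (eapply between_box; [| | exact Hs]; lra).
  assert (Rabs w <= M + 1) by (eapply between_box; [| | exact Hw]; lra).
  pose proof (Rabs_pos (s - x0)); pose proof (Rabs_pos (w - y0)).
  split; unfold A; eapply Rle_trans;
    [apply L1; lra | nra | apply L2; lra | nra].
Qed.

(** Used to replace the base point [(xs, ys)] of an increment by [(X, Y)]: the error is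
    of the order of the distance of the two points, and still linear in [(u, v)]. *)
Lemma C11_increment_shift (phi p1 p2 : R -> R -> R) (M : R) :
  C11 phi p1 p2 ->
  exists C, 0 <= C /\
  forall x y x' y' u v,
    Rabs x <= M -> Rabs y <= M -> Rabs x' <= M -> Rabs y' <= M ->
    Rabs u <= 1 -> Rabs v <= 1 ->
    Rabs ((phi (x + u) (y + v) - phi x y) - (phi (x' + u) (y' + v) - phi x' y'))
      <= C * (Rabs (x - x') + Rabs (y - y')) * (Rabs u + Rabs v).
Proof.
  intros [Hphi [H1 H2]].
  destruct (H1 (M + 1)) as [C1 [HC1 L1]].
  destruct (H2 (M + 1)) as [C2 [HC2 L2]].
  exists (C1 + C2); split; [lra |].
  intros x y x' y' u v Hx Hy Hx' Hy' Hu Hv.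
  pose (psi := fun s w => phi (u + s) (v + w) - phi s w).
  pose proof (has_gradient_minus _ _ _ _ _ _
    (has_gradient_shift _ _ _ u v Hphi) Hphi) as Hpsi.
  replace (phi (x + u) (y + v) - phi x y - (phi (x' + u) (y' + v) - phi x' y'))
    with (psi x y - psi x' y')
    by (unfold psi; rewrite !(Rplus_comm u), !(Rplus_comm v); reflexivity).
  replace ((C1 + C2) * (Rabs (x - x') + Rabs (y - y')) * (Rabs u + Rabs v))
    with ((C1 + C2) * (Rabs u + Rabs v) * (Rabs (x - x') + Rabs (y - y'))) by ring.
  apply (abs_increment_2d_le _ _ _ _ _ _ _ _ Hpsi).
  intros s w Hs Hw.
  assert (Bs : Rabs s <= M) by (eapply between_box; [| | exact Hs]; lra).
  assert (Bw : Rabs w <= M) by (eapply between_box; [| | exact Hw]; lra).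
  pose proof (abs_plus_box _ _ _ Bs Hu); pose proof (abs_plus_box _ _ _ Bw Hv).
  rewrite (Rplus_comm u), (Rplus_comm v).
  pose proof (L1 (s + u) (w + v) s w) as E1.
  pose proof (L2 (s + u) (w + v) s w) as E2.
  replace (s + u - s) with u in E1, E2 by ring.
  replace (w + v - w) with v in E1, E2 by ring.
  pose proof (Rabs_pos u); pose proof (Rabs_pos v).
  split; eapply Rle_trans; [apply E1; lra | nra | apply E2; lra | nra].
Qed.

(** The chain rule follows from the quadratic Taylor bound, which gives the total
    differentiability of [phi]. *)
Lemma C11_comp (phi p1 p2 : R -> R -> R) (f g : R -> R) (t df dg : R) :
  C11 phi p1 p2 -> is_derive f t df -> is_derive g t dg ->
  is_derive (fun s => phi (f s) (g s)) t
    (p1 (f t) (g t) * df + p2 (f t) (g t) * dg).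
Proof.
  intros HC Hf Hg.
  apply is_derive_Reals, derivable_pt_lim_comp_2d; try now apply is_derive_Reals.
  set (x := f t); set (y := g t).
  destruct (C11_taylor _ _ _ (Rabs x + Rabs y) HC) as [C [HC0 HT]].
  intros eps.
  assert (Hd : 0 < Rmin 1 (eps / (4 * C + 1))).
  { apply Rmin_pos; [lra |]. apply Rdiv_lt_0_compat; [apply cond_pos | lra]. }
  exists (mkposreal _ Hd); simpl; intros u v Hu Hv.
  pose proof (Rmin_l 1 (eps / (4 * C + 1))).
  pose proof (Rmin_r 1 (eps / (4 * C + 1))).
  pose proof (Rabs_pos x); pose proof (Rabs_pos y).
  specialize (HT x y x y (u - x) (v - y)).
  replace (x + (u - x)) with u in HT by ring.
  replace (y + (v - y)) with v in HT by ring.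
  rewrite (Rminus_diag x), (Rminus_diag y), Rabs_R0 in HT.
  replace (phi u v - phi x y - (p1 x y * (u - x) + p2 x y * (v - y)))
    with (phi u v - phi x y - p1 x y * (u - x) - p2 x y * (v - y)) by ring.
  eapply Rle_trans; [apply HT; lra |].
  set (r := Rmax (Rabs (u - x)) (Rabs (v - y))).
  pose proof (Rmax_l (Rabs (u - x)) (Rabs (v - y))) as Hl.
  pose proof (Rmax_r (Rabs (u - x)) (Rabs (v - y))) as Hr'.
  assert (Hr : r < eps / (4 * C + 1)) by (unfold r; apply Rmax_lub_lt; lra).
  fold r in Hl, Hr'.
  pose proof (Rabs_pos (u - x)); pose proof (Rabs_pos (v - y)).
  assert (E : (4 * C + 1) * r <= eps).
  { apply Rlt_le, Rmult_lt_reg_r with (/ (4 * C + 1)).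
    - apply Rinv_0_lt_compat; lra.
    - replace ((4 * C + 1) * r * / (4 * C + 1)) with r by (field; lra). exact Hr. }
  apply Rle_trans with (C * (2 * r) * (2 * r)).
  - assert (0 <= C * (Rabs (u - x) + Rabs (v - y)) <= C * (2 * r)) by nra.
    apply Rmult_le_compat; lra.
  - assert (0 <= r) by lra. nra.
Qed.

(** * Bounds on compact sets and stream functions *)

Definition joint_continuous (f : R -> R -> R -> R) (x y s : R) : Prop :=
  continuous (fun p : R * R * R => f (fst (fst p)) (snd (fst p)) (snd p)) (x, y, s).

Lemma list_bound {A : Type} (g : A -> R) (l : list A) :
  exists B, forall z, In z l -> g z <= B.
Proof.
  induction l as [| z l [B HB]].
  - exists 0; intros z [].
  - exists (Rmax (g z) B); intros z' [<- | Hz']; [apply Rmax_l |].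
    apply Rle_trans with B; [now apply HB | apply Rmax_r].
Qed.

(** A finite subcover of the box by neighbourhoods on which [f] varies by less than [1]. *)
Lemma joint_continuous_bounded (f : R -> R -> R -> R) (M a b : R) :
  (forall x y s, Rabs x <= M -> Rabs y <= M -> a <= s <= b ->
     joint_continuous f x y s) ->
  exists B, forall x y s, Rabs x <= M -> Rabs y <= M -> a <= s <= b ->
     Rabs (f x y s) <= B.
Proof.
  intros Hc.
  pose (near := fun (t : R * (R * (R * unit))) (d : posreal) =>
    let '(x, (y, (s, _))) := t in
    forall x' y' s', Rabs (x' - x) < d -> Rabs (y' - y) < d -> Rabs (s' - s) < d ->
      Rabs (f x' y' s' - f x y s) < 1).
  (* [compactness_list] wants a radius at every point, also outside the box, where the
     value of [epsilon] is arbitrary. *)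
  pose (delta := fun t => epsilon (inhabits (mkposreal 1 Rlt_0_1)) (near t)).
  apply NNPP; intros Hno.
  apply (compactness_list 3 (- M, (- M, (a, tt))) (M, (M, (b, tt))) delta).
  intros [l Hl]; apply Hno; clear Hno.
  destruct (list_bound (fun t : R * (R * (R * unit)) =>
    let '(x, (y, (s, _))) := t in Rabs (f x y s) + 1) l) as [B HB].
  exists B; intros x y s Hx Hy Hs.
  apply Rabs_le_between in Hx; apply Rabs_le_between in Hy.
  destruct (Hl (x, (y, (s, tt)))) as [[x0 [y0 [s0 []]]] [Hin [Hbd Hcl]]].
  { simpl; lra. }
  simpl in Hbd; destruct Hbd as [Hx0 [Hy0 [Hs0 _]]].
  destruct Hcl as [Cx [Cy [Cs _]]].
  assert (Hnear : near (x0, (y0, (s0, tt))) (delta (x0, (y0, (s0, tt))))).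
  { unfold delta; apply epsilon_spec.
    assert (H := Hc x0 y0 s0 (proj2 (Rabs_le_between _ _) Hx0)
                   (proj2 (Rabs_le_between _ _) Hy0) Hs0).
    destruct (proj1 (filterlim_locally _ _) H (mkposreal 1 Rlt_0_1)) as [d Hd].
    exists d; simpl; intros x' y' s' H1 H2 H3.
    apply (Hd (x', y', s')); repeat split; simpl; assumption. }
  specialize (HB _ Hin); simpl in HB.
  specialize (Hnear x y s Cx Cy Cs).
  replace (f x y s) with (f x0 y0 s0 + (f x y s - f x0 y0 s0)) by ring.
  eapply Rle_trans; [apply Rabs_triang |]; lra.
Qed.

Lemma smooth3_joint_continuous (f : R -> R -> R -> R) (x y s : R) :
  smooth3 f -> joint_continuous f x y s.
Proof. intros H; exact (proj1 (H 0%nat) x y s I). Qed.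

Lemma smooth3_d1 (f : R -> R -> R -> R) : smooth3 f -> smooth3 (d1 f).
Proof. intros H m; apply (H (S m)). Qed.

Lemma smooth3_d2 (f : R -> R -> R -> R) : smooth3 f -> smooth3 (d2 f).
Proof. intros H m; apply (H (S m)). Qed.

Lemma smooth3_slice_gradient (f : R -> R -> R -> R) (s : R) :
  smooth3 f ->
  has_gradient (fun x y => f x y s) (fun x y => d1 f x y s) (fun x y => d2 f x y s).
Proof.
  intros H; destruct (H 1%nat) as [_ [D _]].
  split; intros x y; apply Derive_correct, (D x y s I).
Qed.

Lemma smooth3_slice_lip (f : R -> R -> R -> R) (s : R) :
  smooth3 f -> lip_on_boxes (fun x y => f x y s).
Proof.
  intros H M.
  assert (bnd : forall g, smooth3 g -> exists B, 0 <= B /\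
    forall x y, Rabs x <= M -> Rabs y <= M -> Rabs (g x y s) <= B).
  { intros g Hg; destruct (joint_continuous_bounded g M s s) as [B HB].
    - intros; now apply smooth3_joint_continuous.
    - exists (Rabs B); split; [apply Rabs_pos |]; intros x y Hx Hy.
      eapply Rle_trans; [apply HB; lra | apply Rle_abs]. }
  destruct (bnd (d1 f) (smooth3_d1 f H)) as [B1 [HB1 L1]].
  destruct (bnd (d2 f) (smooth3_d2 f H)) as [B2 [HB2 L2]].
  exists (B1 + B2); split; [lra |]; intros x y x' y' Hx Hy Hx' Hy'.
  apply (abs_increment_2d_le _ _ _ _ _ _ _ _ (smooth3_slice_gradient f s H)).
  intros r w Hr Hw.
  assert (Br : Rabs r <= M) by (eapply between_box; [| | exact Hr]; lra).
  assert (Bw : Rabs w <= M) by (eapply between_box; [| | exact Hw]; lra).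
  specialize (L1 r w Br Bw); specialize (L2 r w Br Bw); split; lra.
Qed.

Lemma smooth3_slice_C11 (f : R -> R -> R -> R) (s : R) :
  smooth3 f ->
  C11 (fun x y => f x y s) (fun x y => d1 f x y s) (fun x y => d2 f x y s).
Proof.
  intros H; split; [now apply smooth3_slice_gradient |].
  split; apply smooth3_slice_lip; [now apply smooth3_d1 | now apply smooth3_d2].
Qed.

Lemma smooth2_C11 (phi : R -> R -> R) : smooth2 phi -> C11 phi (dx phi) (dy phi).
Proof. exact (smooth3_slice_C11 (fun x y _ => phi x y) 0). Qed.

Lemma smooth2_gradient (phi : R -> R -> R) :
  smooth2 phi -> has_gradient phi (dx phi) (dy phi).
Proof. intros H; apply (smooth2_C11 phi H). Qed.

Lemma smooth2_dx (phi : R -> R -> R) : smooth2 phi -> smooth2 (dx phi).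
Proof. exact (smooth3_d1 (fun x y _ => phi x y)). Qed.

Lemma smooth2_continuity_2d (phi : R -> R -> R) (x y : R) :
  smooth2 phi -> continuity_2d_pt phi x y.
Proof.
  intros H; apply continuity_2d_pt_filterlim.
  apply (filterlim_comp _ _ _ (fun z : R * R => (z, 0))
    (fun p : R * R * R => phi (fst (fst p)) (snd (fst p)))
    _ (locally ((x, y), 0)) _).
  - intros P [d Hd]; exists d; intros z Hz; apply Hd; split; [exact Hz | apply ball_center].
  - exact (proj1 (H 0%nat) x y 0 I).
Qed.

Lemma continuity_2d_slice2 (phi : R -> R -> R) (x y : R) :
  continuity_2d_pt phi x y -> continuous (fun w => phi x w) y.
Proof.
  intros H; apply continuity_2d_pt_filterlim in H.
  apply (continuous_comp_2 (fun _ => x) (fun w => w) phi);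
    [apply continuous_const | apply continuous_id | exact H].
Qed.

Lemma continuity_2d_slice1 (phi : R -> R -> R) (x y : R) :
  continuity_2d_pt phi x y -> continuous (fun w => phi w y) x.
Proof.
  intros H; apply continuity_2d_pt_filterlim in H.
  apply (continuous_comp_2 (fun w => w) (fun _ => y) phi);
    [apply continuous_id | apply continuous_const | exact H].
Qed.

(** [H] integrates [P] along verticals and [- Q] along the [x]-axis; the divergence
    condition turns [dx H] back into an integral of [dy Q]. *)
Lemma stream_function (P Q : R -> R -> R) :
  smooth2 P -> smooth2 Q -> (forall x y, dx P x y = - dy Q x y) ->
  exists H, has_gradient H (fun x y => - Q x y) P.
Proof.
  intros HP HQ Hdiv.
  assert (cP : forall x y, continuous (fun w => P x w) y)
    by (intros; apply continuity_2d_slice2, smooth2_continuity_2d, HP).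
  assert (cQ : forall x y, continuous (fun w => Q w y) x)
    by (intros; apply continuity_2d_slice1, smooth2_continuity_2d, HQ).
  exists (fun x y => RInt (fun w => P x w) 0 y - RInt (fun s => Q s 0) 0 x).
  split; intros x y.
  - replace (- Q x y)
      with (RInt (fun w => Derive (fun s => P s w) x) 0 y - Q x 0).
    + apply (is_derive_minus (fun s => RInt (fun w => P s w) 0 y)
               (fun s => RInt (fun r => Q r 0) 0 s)).
      * apply is_derive_RInt_param.
        -- apply filter_forall; intros s w _.
           exists (dx P s w); apply (smooth2_gradient P HP).
        -- intros w _; apply (smooth2_continuity_2d (dx P)), smooth2_dx, HP.
        -- apply filter_forall; intros s.
           apply (ex_RInt_continuous (V := R_CompleteNormedModule)); intros w _; apply cP.
      * apply (is_derive_RInt (fun r => Q r 0) _ 0); [| apply cQ].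
        apply filter_forall; intros s.
        apply (RInt_correct (V := R_CompleteNormedModule)),
          (ex_RInt_continuous (V := R_CompleteNormedModule)).
        intros w _; apply cQ.
    + assert (E : is_RInt (fun w => dx P x w) 0 y (- Q x y - - Q x 0)).
      { apply (is_RInt_derive (fun w => - Q x w) (fun w => dx P x w)).
        - intros w _; rewrite Hdiv.
          apply (is_derive_opp (fun r => Q x r)), (smooth2_gradient Q HQ).
        - intros w _; apply continuity_2d_slice2, smooth2_continuity_2d.
          apply smooth2_dx, HP. }
      apply (is_RInt_unique (V := R_CompleteNormedModule)) in E; unfold dx in E; rewrite E; ring.
  - replace (P x y) with (P x y - 0) by ring.
    apply (is_derive_minus (fun s => RInt (fun w => P x w) 0 s)
             (fun s => RInt (fun r => Q r 0) 0 x)).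
    + apply (is_derive_RInt (fun w => P x w) _ 0); [| apply cP].
      apply filter_forall; intros s.
      apply (RInt_correct (V := R_CompleteNormedModule)),
          (ex_RInt_continuous (V := R_CompleteNormedModule)).
      intros w _; apply cP.
    + apply (is_derive_const (RInt (fun r => Q r 0) 0 x)).
Qed.

(** * Powers of time and Taylor remainders *)

Lemma tpow_0 (q : nat) (t : R) : 0 < t -> tpow q 0 t = 1.
Proof.
  intros Ht; unfold tpow; simpl INR.
  unfold Rdiv; rewrite Rmult_0_l, Ropp_0; now apply Rpower_O.
Qed.

Lemma tpow_pos (q k : nat) (t : R) : 0 < tpow q k t.
Proof. apply exp_pos. Qed.

Lemma tpow_le (q j k : nat) (t : R) :
  (0 < q)%nat -> (j <= k)%nat -> 1 <= t -> tpow q k t <= tpow q j t.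
Proof.
  intros Hq Hjk Ht; unfold tpow.
  apply Rle_Rpower; [exact Ht |].
  apply Ropp_le_contravar, Rmult_le_compat_r.
  - apply Rlt_le, Rinv_0_lt_compat, lt_0_INR, Hq.
  - now apply le_INR.
Qed.

Lemma tpow_le_1 (q k : nat) (t : R) : (0 < q)%nat -> 1 <= t -> tpow q k t <= 1.
Proof.
  intros Hq Ht; rewrite <- (tpow_0 q t) by lra.
  apply tpow_le; [exact Hq | lia | exact Ht].
Qed.

Lemma tpow_add (q j k : nat) (t : R) :
  tpow q (j + k) t = tpow q j t * tpow q k t.
Proof.
  unfold tpow; rewrite <- Rpower_plus, plus_INR; f_equal; unfold Rdiv; ring.
Qed.

Lemma tpow_q (q : nat) (t : R) : (0 < q)%nat -> 0 < t -> tpow q q t = / t.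
Proof.
  intros Hq Ht; unfold tpow, Rdiv.
  rewrite Rinv_r by (apply not_0_INR; lia).
  rewrite Rpower_Ropp, Rpower_1; auto.
Qed.

(** The derivative is expressed with [tpow] again: [t^(-1)] is [tpow q q t]. *)
Lemma is_derive_tpow (q k : nat) (t : R) :
  (0 < q)%nat -> 0 < t ->
  is_derive (tpow q k) t (- (INR k / INR q) * tpow q (k + q) t).
Proof.
  intros Hq Ht.
  replace (- (INR k / INR q) * tpow q (k + q) t)
    with (- (INR k / INR q) * Rpower t (- (INR k / INR q) - 1)).
  - apply is_derive_Reals, derivable_pt_lim_power, Ht.
  - unfold tpow; do 2 f_equal; rewrite plus_INR; field.
    apply not_0_INR; lia.
Qed.

(** [tpow q (S q) t] is the integrable rate [t^(-1-1/q)].  The case [k = 0], where the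
    power is constant, holds because of the factor [INR k]. *)
Lemma tpow_derive_bound (q k : nat) (t : R) :
  (0 < q)%nat -> 1 <= t ->
  Rabs (- (INR k / INR q) * tpow q (k + q) t) <= INR k * tpow q (S q) t.
Proof.
  intros Hq Ht.
  pose proof (tpow_pos q (k + q) t).
  assert (Hq1 : 1 <= INR q) by (apply (le_INR 1); lia).
  pose proof (pos_INR k).
  destruct k as [| k].
  - simpl INR; unfold Rdiv; rewrite Rmult_0_l, Ropp_0, !Rmult_0_l, Rabs_R0; lra.
  - assert (E : tpow q (S k + q) t <= tpow q (S q) t) by (apply tpow_le; lia || auto).
    assert (F : INR (S k) / INR q <= INR (S k)).
    { apply Rle_div_l; nra. }
    assert (0 <= INR (S k) / INR q) by (apply Rdiv_le_0_compat; lra).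
    rewrite Rabs_mult, Rabs_Ropp, !Rabs_pos_eq by lra.
    apply Rmult_le_compat; lra.
Qed.

Lemma tpow_small (q k : nat) (eps : R) :
  (0 < q)%nat -> (0 < k)%nat -> 0 < eps ->
  exists T, 1 <= T /\ forall t, T <= t -> tpow q k t <= eps.
Proof.
  intros Hq Hk He.
  assert (Hc : 0 < INR k / INR q) by (apply Rdiv_lt_0_compat; apply lt_0_INR; lia).
  exists (Rmax 1 (Rpower eps (- / (INR k / INR q)))); split; [apply Rmax_l |].
  intros t Ht.
  pose proof (Rmax_l 1 (Rpower eps (- / (INR k / INR q)))).
  pose proof (Rmax_r 1 (Rpower eps (- / (INR k / INR q)))).
  unfold tpow.
  replace eps with (/ (Rpower (Rpower eps (- / (INR k / INR q))) (INR k / INR q))).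
  - rewrite Rpower_Ropp; apply Rinv_le_contravar; [apply exp_pos |].
    apply Rle_Rpower_l; [lra |]; split; [apply exp_pos | lra].
  - rewrite Rpower_mult, <- Rpower_Ropp.
    replace (- (- / (INR k / INR q) * (INR k / INR q))) with 1.
    + now apply Rpower_1.
    + field; split; apply not_0_INR; lia.
Qed.

Lemma abs_mult_le (x y A B : R) :
  Rabs x <= A -> Rabs y <= B -> Rabs (x * y) <= A * B.
Proof.
  intros Hx Hy; rewrite Rabs_mult.
  apply Rmult_le_compat; auto using Rabs_pos.
Qed.

Definition incr (phi : R -> R -> R) (x y u v : R) : R := phi (x + u) (y + v) - phi x y.

(** As [has_gradient H (- Q) P], the two linear terms are minus the linear part of the
    increment of [H], so the remainder is of second order in [(u, v)]. *)
Definition taylor_rem (H P Q : R -> R -> R) (x y u v : R) : R :=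
  incr H x y u v + Q x y * u - P x y * v.

Lemma C11_incr_le (phi p1 p2 : R -> R -> R) (M : R) :
  C11 phi p1 p2 ->
  exists C, 0 <= C /\
  forall x y u v, Rabs x <= M -> Rabs y <= M -> Rabs u <= 1 -> Rabs v <= 1 ->
    Rabs (incr phi x y u v) <= C * (Rabs u + Rabs v).
Proof.
  intros HC; destruct (C11_lip _ _ _ HC (M + 1)) as [C [HC0 L]].
  exists C; split; [exact HC0 |]; intros x y u v Hx Hy Hu Hv.
  pose proof (abs_plus_box _ _ _ Hx Hu); pose proof (abs_plus_box _ _ _ Hy Hv).
  replace u with ((x + u) - x) at 2 by ring.
  replace v with ((y + v) - y) at 2 by ring.
  apply L; lra.
Qed.

Lemma C11_hamiltonian (H P Q P1 P2 Q1 Q2 : R -> R -> R) :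
  C11 P P1 P2 -> C11 Q Q1 Q2 -> has_gradient H (fun x y => - Q x y) P ->
  C11 H (fun x y => - Q x y) P.
Proof.
  intros HP HQ HH; split; [exact HH |]; split.
  - apply lip_on_boxes_opp; eapply C11_lip; exact HQ.
  - eapply C11_lip; exact HP.
Qed.

Lemma taylor_rem_le (H P Q : R -> R -> R) (M : R) :
  C11 H (fun x y => - Q x y) P ->
  exists C, 0 <= C /\
  forall x y u v, Rabs x <= M -> Rabs y <= M -> Rabs u <= 1 -> Rabs v <= 1 ->
    Rabs (taylor_rem H P Q x y u v) <= C * (Rabs u + Rabs v) ^ 2.
Proof.
  intros HC; destruct (C11_taylor _ _ _ M HC) as [C [HC0 L]].
  exists C; split; [exact HC0 |]; intros x y u v Hx Hy Hu Hv.
  specialize (L x y x y u v Hx Hy Hx Hy Hu Hv); simpl in L.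
  rewrite (Rminus_diag x), (Rminus_diag y), Rabs_R0 in L.
  replace (taylor_rem H P Q x y u v)
    with (H (x + u) (y + v) - H x y - - Q x y * u - P x y * v)
    by (unfold taylor_rem, incr; ring).
  eapply Rle_trans; [apply L | apply Req_le; ring].
Qed.

(** Moving [(u, v)] produces the Hamiltonian terms.  Moving the base point produces the
    first order Taylor remainders of [P] and [Q], which are quadratic in [(u, v)]; this
    is where the divergence condition enters, by identifying [P1] with [- Q2]. *)
Lemma taylor_rem_derive (H P Q P1 P2 Q1 Q2 : R -> R -> R) (M : R) :
  C11 P P1 P2 -> C11 Q Q1 Q2 -> has_gradient H (fun x y => - Q x y) P ->
  (forall x y, P1 x y = - Q2 x y) ->
  exists C, 0 <= C /\
  forall (X Y u v : R -> R) (t dX dY du dv : R),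
    is_derive X t dX -> is_derive Y t dY -> is_derive u t du -> is_derive v t dv ->
    Rabs (X t) <= M -> Rabs (Y t) <= M -> Rabs (u t) <= 1 -> Rabs (v t) <= 1 ->
    exists r, Rabs r <= C * (Rabs dX + Rabs dY) * (Rabs (u t) + Rabs (v t)) ^ 2 /\
    is_derive (fun s => taylor_rem H P Q (X s) (Y s) (u s) (v s)) t
      (incr P (X t) (Y t) (u t) (v t) * dv - incr Q (X t) (Y t) (u t) (v t) * du + r).
Proof.
  intros HP HQ HgH Hdiv.
  pose proof (C11_hamiltonian _ _ _ _ _ _ _ HP HQ HgH) as HH.
  destruct (C11_taylor _ _ _ M HP) as [CP [HCP LP]].
  destruct (C11_taylor _ _ _ M HQ) as [CQ [HCQ LQ]].
  exists (CP + CQ); split; [lra |].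
  intros X Y u v t dX dY du dv DX DY Du Dv HX HY Hu Hv.
  specialize (LP (X t) (Y t) (X t) (Y t) (u t) (v t) HX HY HX HY Hu Hv).
  specialize (LQ (X t) (Y t) (X t) (Y t) (u t) (v t) HX HY HX HY Hu Hv).
  rewrite (Rminus_diag (X t)), (Rminus_diag (Y t)), Rabs_R0 in LP, LQ.
  set (eP := P (X t + u t) (Y t + v t) - P (X t) (Y t)
             - P1 (X t) (Y t) * u t - P2 (X t) (Y t) * v t) in LP.
  set (eQ := Q (X t + u t) (Y t + v t) - Q (X t) (Y t)
             - Q1 (X t) (Y t) * u t - Q2 (X t) (Y t) * v t) in LQ.
  set (l := Rabs (u t) + Rabs (v t)) in *.
  assert (Hl : 0 <= l) by (unfold l; pose proof (Rabs_pos (u t)); pose proof (Rabs_pos (v t)); lra).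
  exists (eP * dY - eQ * dX); split.
  - assert (E1 : Rabs eP <= CP * l ^ 2) by (eapply Rle_trans; [apply LP | apply Req_le; ring]).
    assert (E2 : Rabs eQ <= CQ * l ^ 2) by (eapply Rle_trans; [apply LQ | apply Req_le; ring]).
    pose proof (abs_mult_le _ dY _ _ E1 (Rle_refl _)) as F1.
    pose proof (abs_mult_le _ dX _ _ E2 (Rle_refl _)) as F2.
    pose proof (Rabs_pos dX); pose proof (Rabs_pos dY).
    assert (0 <= CP * l ^ 2 * Rabs dX) by (repeat first [assumption | apply pow2_ge_0 | apply Rmult_le_pos]).
    assert (0 <= CQ * l ^ 2 * Rabs dY) by (repeat first [assumption | apply pow2_ge_0 | apply Rmult_le_pos]).
    unfold Rminus; eapply Rle_trans; [apply Rabs_triang |]; rewrite Rabs_Ropp; nra.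
  - pose proof (C11_comp _ _ _ _ _ _ _ _ HH
      (is_derive_plus X u t dX du DX Du) (is_derive_plus Y v t dY dv DY Dv)) as D1.
    pose proof (C11_comp _ _ _ _ _ _ _ _ HH DX DY) as D2.
    pose proof (is_derive_mult _ _ _ _ _ (C11_comp _ _ _ _ _ _ _ _ HQ DX DY) Du Rmult_comm) as D3.
    pose proof (is_derive_mult _ _ _ _ _ (C11_comp _ _ _ _ _ _ _ _ HP DX DY) Dv Rmult_comm) as D4.
    unfold taylor_rem, incr.
    evar_last.
    + apply (is_derive_minus
        (fun s => H (X s + u s) (Y s + v s) - H (X s) (Y s) + Q (X s) (Y s) * u s)
        (fun s => P (X s) (Y s) * v s)); [| exact D4].
      apply (is_derive_plus (fun s => H (X s + u s) (Y s + v s) - H (X s) (Y s))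
        (fun s => Q (X s) (Y s) * u s)); [| exact D3].
      apply (is_derive_minus (fun s => H (X s + u s) (Y s + v s))
        (fun s => H (X s) (Y s))); [exact D1 | exact D2].
    + unfold eP, eQ; rewrite Hdiv.
      cbv [minus plus opp mult]; simpl; ring.
Qed.

(** * The energy of a deviation *)

Definition norm1 (u v : R) : R := Rabs u + Rabs v.

Lemma norm1_ge_0 (u v : R) : 0 <= norm1 u v.
Proof. unfold norm1; pose proof (Rabs_pos u); pose proof (Rabs_pos v); lra. Qed.

Definition admissible (t u v : R) : Prop := 1 <= t /\ Rabs u <= 1 /\ Rabs v <= 1.

(** Only the term [k = 0] carries the power [1]; all the others are at most of the
    order [t^(-1/q)]. *)
Lemma tpow_sum_leading (q p : nat) (a : nat -> R -> R -> R -> R)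
    (main : R -> R -> R) (d : nat) :
  (0 < q)%nat ->
  (exists C, 0 <= C /\ forall t u v, admissible t u v ->
     Rabs (a O t u v - main u v) <= C * (tpow q 1 t + norm1 u v) * norm1 u v ^ d) ->
  (forall k, (1 <= k <= p)%nat -> exists C, 0 <= C /\ forall t u v, admissible t u v ->
     Rabs (a k t u v) <= C * norm1 u v ^ d) ->
  exists C, 0 <= C /\ forall t u v, admissible t u v ->
    Rabs (sum_n (fun k => tpow q k t * a k t u v) p - main u v)
      <= C * (tpow q 1 t + norm1 u v) * norm1 u v ^ d.
Proof.
  intros Hq [C0 [HC0 B0]]; induction p as [| p IH]; intros Ha.
  - exists C0; split; [exact HC0 |]; intros t u v Hadm.
    rewrite sum_O, tpow_0 by (destruct Hadm; lra).
    rewrite Rmult_1_l; auto.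
  - destruct IH as [C1 [HC1 B1]]; [intros k Hk; apply Ha; lia |].
    destruct (Ha (S p)) as [C2 [HC2 B2]]; [lia |].
    exists (C1 + C2); split; [lra |]; intros t u v Hadm.
    rewrite sum_Sn; cbv [plus]; simpl.
    specialize (B1 t u v Hadm); specialize (B2 t u v Hadm).
    pose proof (norm1_ge_0 u v) as Hl.
    assert (Hld : 0 <= norm1 u v ^ d) by (apply pow_le, Hl).
    assert (E : tpow q (S p) t <= tpow q 1 t)
      by (apply tpow_le; [exact Hq | lia | apply Hadm]).
    pose proof (tpow_pos q (S p) t).
    assert (F : Rabs (tpow q (S p) t * a (S p) t u v)
                <= (tpow q 1 t + norm1 u v) * (C2 * norm1 u v ^ d)).
    { apply abs_mult_le; [rewrite Rabs_pos_eq; lra | exact B2]. }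
    match goal with |- Rabs (?s + ?x - ?y) <= _ =>
      replace (s + x - y) with ((s - y) + x) by ring end.
    eapply Rle_trans; [apply Rabs_triang | nra].
Qed.

(** Collects the products of a small factor with a factor of order [l] that remain in
    the derivative of the energy; [delta] measures the smallness. *)
Lemma dissipation_algebra (A B : R) :
  0 <= A -> 0 <= B ->
  exists K, 0 <= K /\
  forall pa pb qa qb omega2 s1 s2 u v f1 g1 al be e delta l : R,
    Rabs pa <= A -> Rabs pb <= A -> Rabs qa <= A -> Rabs qb <= A ->
    Rabs omega2 <= A -> Rabs s1 <= A -> Rabs s2 <= A ->
    Rabs u + Rabs v <= l -> 0 <= e <= 1 -> e <= delta <= 4 ->
    Rabs f1 <= B * delta * l -> Rabs g1 <= B * delta * l ->
    Rabs al <= B * delta * l -> Rabs be <= B * delta * l ->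
    Rabs (f1 * (qa * u + qb * v) - g1 * (pa * u + pb * v)
          + (v + f1) * be - (- omega2 * u + g1) * al
          + s1 * ((f1 + e * (pa * u + pb * v + al)) * v
                  + u * (g1 + e * (qa * u + qb * v + be)))
          - 2 * s2 * (u * (f1 + e * (pa * u + pb * v + al))))
      <= K * delta * l ^ 2.
Proof.
  intros HA HB.
  exists (2 * A * B + (1 + 4 * B) * B + (A + 4 * B) * B + 4 * A * (A + 2 * B)).
  split; [assert (0 <= A * B) by (apply Rmult_le_pos; assumption); nra |].
  intros pa pb qa qb om s1 s2 u v f1 g1 al be e delta l
    Hpa Hpb Hqa Hqb Hom Hs1 Hs2 Hl He Hd Hf Hg Hal Hbe.
  pose proof (Rabs_pos u); pose proof (Rabs_pos v).
  assert (Hu : Rabs u <= l) by lra; assert (Hv : Rabs v <= l) by lra.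
  assert (Hl0 : 0 <= l) by lra.
  assert (lin : forall a b, Rabs a <= A -> Rabs b <= A -> Rabs (a * u + b * v) <= A * l).
  { intros a b Ha Hb.
    pose proof (abs_mult_le a u _ _ Ha (Rle_refl _)).
    pose proof (abs_mult_le b v _ _ Hb (Rle_refl _)).
    pose proof (Rabs_triang (a * u) (b * v)); nra. }
  pose proof (lin pa pb Hpa Hpb) as Lp; pose proof (lin qa qb Hqa Hqb) as Lq.
  assert (dl : 0 <= delta * l) by (apply Rmult_le_pos; lra).
  assert (dl4 : delta * l <= 4 * l) by (apply Rmult_le_compat_r; lra).
  assert (Hf0 : Rabs (v + f1) <= (1 + 4 * B) * l)
    by (pose proof (Rabs_triang v f1); nra).
  assert (Hg0 : Rabs (- om * u + g1) <= (A + 4 * B) * l).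
  { pose proof (Rabs_triang (- om * u) g1).
    assert (Rabs (- om * u) <= A * l)
      by (apply abs_mult_le; [rewrite Rabs_Ropp |]; assumption). nra. }
  assert (eta : forall f a z, Rabs f <= B * delta * l -> Rabs a <= B * delta * l ->
    Rabs z <= A * l -> Rabs (f + e * (z + a)) <= (A + 2 * B) * delta * l).
  { intros f a z F1 F2 F3.
    assert (G1 : Rabs (e * z) <= delta * (A * l))
      by (apply abs_mult_le; [rewrite Rabs_pos_eq; lra | exact F3]).
    assert (G2 : Rabs (e * a) <= 1 * (B * delta * l))
      by (apply abs_mult_le; [rewrite Rabs_pos_eq; lra | exact F2]).
    replace (f + e * (z + a)) with (f + (e * z + e * a)) by ring.
    pose proof (Rabs_triang f (e * z + e * a)); pose proof (Rabs_triang (e * z) (e * a)).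
    lra. }
  pose proof (eta f1 al _ Hf Hal Lp) as E1; pose proof (eta g1 be _ Hg Hbe Lq) as E2.
  set (eta1 := f1 + e * (pa * u + pb * v + al)) in *.
  set (eta2 := g1 + e * (qa * u + qb * v + be)) in *.
  pose proof (abs_mult_le _ _ _ _ Hf Lq) as T1.
  pose proof (abs_mult_le _ _ _ _ Hg Lp) as T2.
  pose proof (abs_mult_le _ _ _ _ Hf0 Hbe) as T3.
  pose proof (abs_mult_le _ _ _ _ Hg0 Hal) as T4.
  pose proof (abs_mult_le _ _ _ _ Hs1 (abs_mult_le _ _ _ _ E1 Hv)) as T5.
  pose proof (abs_mult_le _ _ _ _ Hs1 (abs_mult_le _ _ _ _ Hu E2)) as T6.
  pose proof (abs_mult_le _ _ _ _ Hs2 (abs_mult_le _ _ _ _ Hu E1)) as T7.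
  apply Rabs_le_between in T1; apply Rabs_le_between in T2; apply Rabs_le_between in T3.
  apply Rabs_le_between in T4; apply Rabs_le_between in T5; apply Rabs_le_between in T6.
  apply Rabs_le_between in T7; apply Rabs_le_between.
  match goal with |- - ?k <= _ <= _ => replace k with
    (B * delta * l * (A * l) + B * delta * l * (A * l)
     + (1 + 4 * B) * l * (B * delta * l) + (A + 4 * B) * l * (B * delta * l)
     + A * ((A + 2 * B) * delta * l * l) + A * (l * ((A + 2 * B) * delta * l))
     + 2 * (A * (l * ((A + 2 * B) * delta * l)))) by ring end.
  lra.
Qed.

Section Lyapunov_function.

Variables (q p : nat) (P Q H : nat -> R -> R -> R).
Variables (X Y dX dY : R -> R) (M sigma omega2 : R).
Hypothesis q_pos : (0 < q)%nat.
Hypothesis P_C11 : forall k, (k <= S p)%nat -> C11 (P k) (dx (P k)) (dy (P k)).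
Hypothesis Q_C11 : forall k, (k <= S p)%nat -> C11 (Q k) (dx (Q k)) (dy (Q k)).
Hypothesis div_free :
  forall k, (k <= p)%nat -> forall x y, dx (P k) x y = - dy (Q k) x y.
Hypothesis H_gradient :
  forall k, (k <= p)%nat -> has_gradient (H k) (fun x y => - Q k x y) (P k).
Hypothesis base_derive :
  forall t, 1 <= t -> is_derive X t (dX t) /\ is_derive Y t (dY t).
Hypothesis base_derive_le :
  forall t, 1 <= t ->
  Rabs (dX t) <= M * tpow q (S q) t /\ Rabs (dY t) <= M * tpow q (S q) t.
Hypothesis base_bounded :
  forall t, 1 <= t -> Rabs (X t) <= M /\ Rabs (Y t) <= M.
Hypothesis base_limit :
  forall t, 1 <= t ->
  Rabs (X t - sigma) <= M * tpow q 1 t /\ Rabs (Y t) <= M * tpow q 1 t.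
Hypothesis sigma_le : Rabs sigma <= M.
Hypothesis center_P : dx (P 0%nat) sigma 0 = 0 /\ dy (P 0%nat) sigma 0 = 1.
Hypothesis center_Q : dx (Q 0%nat) sigma 0 = - omega2 /\ dy (Q 0%nat) sigma 0 = 0.

Definition P_incr (k : nat) (t u v : R) : R := incr (P k) (X t) (Y t) u v.
Definition Q_incr (k : nat) (t u v : R) : R := incr (Q k) (X t) (Y t) u v.
Definition energy_term (k : nat) (t u v : R) : R :=
  taylor_rem (H k) (P k) (Q k) (X t) (Y t) u v.

Lemma M_nonneg : 0 <= M.
Proof. eapply Rle_trans; [apply (Rabs_pos sigma) | exact sigma_le]. Qed.

(** The linear part is taken at the limit point [(sigma, 0)] of the base curve, at the
    price of an error [O(t^(-1/q))]. *)
Lemma incr_linear (phi : R -> R -> R) :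
  C11 phi (dx phi) (dy phi) ->
  exists C, 0 <= C /\ forall t u v, admissible t u v ->
    Rabs (incr phi (X t) (Y t) u v - (dx phi sigma 0 * u + dy phi sigma 0 * v))
      <= C * (tpow q 1 t + norm1 u v) * norm1 u v.
Proof.
  intros HC; destruct (C11_taylor _ _ _ M HC) as [C [HC0 L]].
  pose proof M_nonneg as HM.
  exists (C * (2 * M + 1)); split; [apply Rmult_le_pos; lra |].
  intros t u v [Ht [Hu Hv]].
  destruct (base_bounded t Ht) as [BX BY]; destruct (base_limit t Ht) as [LX LY].
  assert (Z : Rabs 0 <= M) by (rewrite Rabs_R0; exact HM).
  specialize (L (X t) (Y t) sigma 0 u v BX BY sigma_le Z Hu Hv).
  rewrite Rminus_0_r in L.
  replace (incr phi (X t) (Y t) u v - (dx phi sigma 0 * u + dy phi sigma 0 * v))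
    with (phi (X t + u) (Y t + v) - phi (X t) (Y t) - dx phi sigma 0 * u
          - dy phi sigma 0 * v) by (unfold incr; ring).
  eapply Rle_trans; [exact L |].
  fold (norm1 u v); pose proof (norm1_ge_0 u v); pose proof (tpow_pos q 1 t).
  apply Rmult_le_compat_r; [assumption |].
  rewrite Rmult_assoc; apply Rmult_le_compat_l; [assumption |].
  nra.
Qed.

Lemma incr_le (phi : R -> R -> R) :
  C11 phi (dx phi) (dy phi) ->
  exists C, 0 <= C /\ forall t u v, admissible t u v ->
    Rabs (incr phi (X t) (Y t) u v) <= C * norm1 u v.
Proof.
  intros HC; destruct (C11_incr_le _ _ _ M HC) as [C [HC0 L]].
  exists C; split; [exact HC0 |]; intros t u v [Ht [Hu Hv]].
  destruct (base_bounded t Ht); now apply L.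
Qed.

Lemma sum_P_incr_leading :
  exists C, 0 <= C /\ forall t u v, admissible t u v ->
    Rabs (sum_n (fun k => tpow q k t * P_incr k t u v) p - v)
      <= C * (tpow q 1 t + norm1 u v) * norm1 u v.
Proof.
  destruct (tpow_sum_leading q p P_incr (fun _ v => v) 1 q_pos) as [C [HC L]].
  - destruct (incr_linear (P 0%nat)) as [C [HC L]]; [apply P_C11; lia |].
    exists C; split; [exact HC |]; intros t u v Ha.
    specialize (L t u v Ha); destruct center_P as [E1 E2]; rewrite E1, E2 in L.
    rewrite Rmult_0_l, Rplus_0_l, Rmult_1_l in L; rewrite pow_1; exact L.
  - intros k Hk; destruct (incr_le (P k)) as [C [HC L]]; [apply P_C11; lia |].
    exists C; split; [exact HC |]; intros t u v Ha; rewrite pow_1; now apply L.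
  - exists C; split; [exact HC |]; intros t u v Ha.
    specialize (L t u v Ha); rewrite pow_1 in L; exact L.
Qed.

Lemma sum_Q_incr_leading :
  exists C, 0 <= C /\ forall t u v, admissible t u v ->
    Rabs (sum_n (fun k => tpow q k t * Q_incr k t u v) p - - omega2 * u)
      <= C * (tpow q 1 t + norm1 u v) * norm1 u v.
Proof.
  destruct (tpow_sum_leading q p Q_incr (fun u _ => - omega2 * u) 1 q_pos) as [C [HC L]].
  - destruct (incr_linear (Q 0%nat)) as [C [HC L]]; [apply Q_C11; lia |].
    exists C; split; [exact HC |]; intros t u v Ha.
    specialize (L t u v Ha); destruct center_Q as [E1 E2]; rewrite E1, E2 in L.
    rewrite Rmult_0_l, Rplus_0_r in L; rewrite pow_1; exact L.
  - intros k Hk; destruct (incr_le (Q k)) as [C [HC L]]; [apply Q_C11; lia |].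
    exists C; split; [exact HC |]; intros t u v Ha; rewrite pow_1; now apply L.
  - exists C; split; [exact HC |]; intros t u v Ha.
    specialize (L t u v Ha); rewrite pow_1 in L; exact L.
Qed.

Lemma energy_term_C11 (k : nat) :
  (k <= p)%nat -> C11 (H k) (fun x y => - Q k x y) (P k).
Proof.
  intros Hk; eapply C11_hamiltonian;
    [apply P_C11; lia | apply Q_C11; lia | now apply H_gradient].
Qed.

Lemma energy_term_le (k : nat) :
  (k <= p)%nat ->
  exists C, 0 <= C /\ forall t u v, admissible t u v ->
    Rabs (energy_term k t u v) <= C * norm1 u v ^ 2.
Proof.
  intros Hk; destruct (taylor_rem_le _ _ _ M (energy_term_C11 k Hk)) as [C [HC L]].
  exists C; split; [exact HC |]; intros t u v [Ht [Hu Hv]].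
  destruct (base_bounded t Ht); now apply L.
Qed.

Lemma energy_term_gradient (k : nat) (t : R) :
  (k <= p)%nat ->
  has_gradient (fun u v => energy_term k t u v)
    (fun u v => - Q_incr k t u v) (fun u v => P_incr k t u v).
Proof.
  intros Hk.
  pose proof (has_gradient_minus _ _ _ _ _ _
    (has_gradient_shift _ _ _ (X t) (Y t) (H_gradient k Hk))
    (has_gradient_affine (- Q k (X t) (Y t)) (P k (X t) (Y t)) (H k (X t) (Y t))))
    as [D1 D2].
  unfold energy_term, taylor_rem, P_incr, Q_incr, incr; split; intros u v.
  - eapply is_derive_ext; [| evar_last; [apply (D1 u v) |]];
      [intros s |]; simpl; ring.
  - eapply is_derive_ext; [| evar_last; [apply (D2 u v) |]];
      [intros s |]; simpl; ring.
Qed.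

(** The gradient of the difference in the term [k = 0] is controlled by [incr_linear],
    and the difference vanishes at the origin. *)
Lemma sum_energy_term_leading :
  exists C, 0 <= C /\ forall t u v, admissible t u v ->
    Rabs (sum_n (fun k => tpow q k t * energy_term k t u v) p - (omega2 * u ^ 2 + v ^ 2) / 2)
      <= C * (tpow q 1 t + norm1 u v) * norm1 u v ^ 2.
Proof.
  apply (tpow_sum_leading q p energy_term (fun u v => (omega2 * u ^ 2 + v ^ 2) / 2) 2 q_pos).
  - destruct (incr_linear (P 0%nat)) as [CP [HCP LP]]; [apply P_C11; lia |].
    destruct (incr_linear (Q 0%nat)) as [CQ [HCQ LQ]]; [apply Q_C11; lia |].
    destruct center_P as [P1 P2]; rewrite P1, P2 in LP.
    destruct center_Q as [Q1 Q2]; rewrite Q1, Q2 in LQ.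
    exists (CP + CQ); split; [lra |]; intros t u v [Ht [Hu Hv]].
    assert (G : has_gradient (fun u v => (omega2 * u ^ 2 + v ^ 2) / 2)
                  (fun u _ => omega2 * u) (fun _ v => v))
      by (split; intros; auto_derive; trivial; field).
    pose proof (has_gradient_minus _ _ _ _ _ _
      (energy_term_gradient 0 t (Nat.le_0_l p)) G) as D.
    set (A := (CP + CQ) * (tpow q 1 t + norm1 u v) * norm1 u v).
    replace ((CP + CQ) * (tpow q 1 t + norm1 u v) * norm1 u v ^ 2)
      with (A * (Rabs (u - 0) + Rabs (v - 0)))
      by (unfold A, norm1; rewrite !Rminus_0_r; ring).
    replace (energy_term 0 t u v - (omega2 * u ^ 2 + v ^ 2) / 2)
      with ((energy_term 0 t u v - (omega2 * u ^ 2 + v ^ 2) / 2)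
            - (energy_term 0 t 0 0 - (omega2 * 0 ^ 2 + 0 ^ 2) / 2)).
    + apply (abs_increment_2d_le _ _ _ 0 0 u v A D).
      intros s w Hs Hw.
      assert (Bs : Rabs s <= Rabs u)
        by (eapply between_box; [| | exact Hs]; [rewrite Rabs_R0; apply Rabs_pos | lra]).
      assert (Bw : Rabs w <= Rabs v)
        by (eapply between_box; [| | exact Hw]; [rewrite Rabs_R0; apply Rabs_pos | lra]).
      assert (Hadm : admissible t s w) by (repeat split; lra).
      specialize (LP t s w Hadm); specialize (LQ t s w Hadm).
      fold (P_incr 0 t s w) in LP; fold (Q_incr 0 t s w) in LQ.
      assert (Hl : norm1 s w <= norm1 u v) by (unfold norm1; lra).
      pose proof (norm1_ge_0 s w); pose proof (tpow_pos q 1 t).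
      assert (B : (tpow q 1 t + norm1 s w) * norm1 s w <= (tpow q 1 t + norm1 u v) * norm1 u v)
        by nra.
      assert (0 <= (tpow q 1 t + norm1 s w) * norm1 s w) by nra.
      split; unfold A.
      * replace (- Q_incr 0 t s w - omega2 * s)
          with (- (Q_incr 0 t s w - (- omega2 * s + 0 * w))) by ring.
        rewrite Rabs_Ropp; eapply Rle_trans; [exact LQ | nra].
      * replace (P_incr 0 t s w - w) with (P_incr 0 t s w - (0 * s + 1 * w)) by ring.
        eapply Rle_trans; [exact LP | nra].
    + replace (energy_term 0 t 0 0) with 0; [field |].
      unfold energy_term, taylor_rem, incr; rewrite !Rplus_0_r; ring.
  - intros k Hk; apply energy_term_le; lia.
Qed.

(** If [(u, v)] followed the fields of index [k <= p] alone, the two sums would cancel,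
    and only the slow motion of the base point and of the powers of [t] would remain. *)
Lemma sum_energy_term_derive :
  exists C, 0 <= C /\
    forall (u v : R -> R) (t du dv : R),
    is_derive u t du -> is_derive v t dv -> admissible t (u t) (v t) ->
    exists r, Rabs r <= C * tpow q (S q) t * norm1 (u t) (v t) ^ 2 /\
    is_derive (fun s => sum_n (fun k => tpow q k s * energy_term k s (u s) (v s)) p) t
      (sum_n (fun k => tpow q k t * P_incr k t (u t) (v t)) p * dv
       - sum_n (fun k => tpow q k t * Q_incr k t (u t) (v t)) p * du + r).
Proof.
  assert (single : forall k, (k <= p)%nat -> exists C, 0 <= C /\
    forall (u v : R -> R) (t du dv : R),
    is_derive u t du -> is_derive v t dv -> admissible t (u t) (v t) ->
    exists r, Rabs r <= C * tpow q (S q) t * norm1 (u t) (v t) ^ 2 /\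
    is_derive (fun s => tpow q k s * energy_term k s (u s) (v s)) t
      (tpow q k t * P_incr k t (u t) (v t) * dv
       - tpow q k t * Q_incr k t (u t) (v t) * du + r)).
  { intros k Hk.
    destruct (taylor_rem_derive (H k) (P k) (Q k) _ _ _ _ M
      (P_C11 k ltac:(lia)) (Q_C11 k ltac:(lia)) (H_gradient k Hk) (div_free k Hk))
      as [C1 [HC1 L1]].
    destruct (energy_term_le k Hk) as [C2 [HC2 L2]].
    pose proof (pos_INR k); pose proof M_nonneg.
    exists (C1 * (2 * M) + INR k * C2); split; [nra |].
    intros u v t du dv Du Dv Hadm; destruct Hadm as [Ht [Hu Hv]].
    destruct (base_derive t Ht) as [DX DY]; destruct (base_bounded t Ht) as [BX BY].
    destruct (base_derive_le t Ht) as [LX LY].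
    destruct (L1 X Y u v t _ _ du dv DX DY Du Dv BX BY Hu Hv) as [r [Hr Dr]].
    specialize (L2 t (u t) (v t) (conj Ht (conj Hu Hv))).
    pose proof (tpow_derive_bound q k t q_pos Ht) as Ek.
    set (de := - (INR k / INR q) * tpow q (k + q) t) in *.
    exists (de * energy_term k t (u t) (v t) + tpow q k t * r); split.
    - fold (norm1 (u t) (v t)) in Hr.
      pose proof (tpow_pos q (S q) t); pose proof (tpow_pos q k t).
      pose proof (tpow_le_1 q k t q_pos Ht).
      pose proof (pow2_ge_0 (norm1 (u t) (v t))).
      assert (F1 := abs_mult_le _ _ _ _ Ek L2).
      assert (F0 : Rabs (tpow q k t) <= 1) by (rewrite Rabs_pos_eq; lra).
      assert (F2 := abs_mult_le _ _ _ _ F0 Hr).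
      assert (F3 : C1 * (Rabs (dX t) + Rabs (dY t)) * norm1 (u t) (v t) ^ 2
                <= C1 * (2 * M * tpow q (S q) t) * norm1 (u t) (v t) ^ 2).
      { apply Rmult_le_compat_r; [assumption |].
        apply Rmult_le_compat_l; [assumption | lra]. }
      eapply Rle_trans; [apply Rabs_triang |].
      rewrite Rmult_1_l in F2.
      replace ((C1 * (2 * M) + INR k * C2) * tpow q (S q) t * norm1 (u t) (v t) ^ 2)
        with (INR k * tpow q (S q) t * (C2 * norm1 (u t) (v t) ^ 2)
              + C1 * (2 * M * tpow q (S q) t) * norm1 (u t) (v t) ^ 2) by ring.
      lra.
    - evar_last.
      + apply (is_derive_mult (tpow q k) (fun s => energy_term k s (u s) (v s)));
          [apply is_derive_tpow; [exact q_pos | lra] | exact Dr | exact Rmult_comm].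
      + unfold P_incr, Q_incr, de; cbv [plus mult]; simpl; ring. }
  clear div_free.
  enough (all : forall j, (j <= p)%nat -> exists C, 0 <= C /\
    forall (u v : R -> R) (t du dv : R),
    is_derive u t du -> is_derive v t dv -> admissible t (u t) (v t) ->
    exists r, Rabs r <= C * tpow q (S q) t * norm1 (u t) (v t) ^ 2 /\
    is_derive (fun s => sum_n (fun k => tpow q k s * energy_term k s (u s) (v s)) j) t
      (sum_n (fun k => tpow q k t * P_incr k t (u t) (v t)) j * dv
       - sum_n (fun k => tpow q k t * Q_incr k t (u t) (v t)) j * du + r))
    by (apply all; lia).
  induction j as [| j IH]; intros Hj.
  - destruct (single 0%nat Hj) as [C [HC L]].
    exists C; split; [exact HC |]; intros u v t du dv Du Dv Hadm.
    destruct (L u v t du dv Du Dv Hadm) as [r [Hr Dr]].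
    exists r; split; [exact Hr |].
    rewrite !sum_O; eapply is_derive_ext; [| exact Dr].
    intros s; now rewrite sum_O.
  - destruct IH as [C1 [HC1 L1]]; [lia |].
    destruct (single (S j) Hj) as [C2 [HC2 L2]].
    exists (C1 + C2); split; [lra |]; intros u v t du dv Du Dv Hadm.
    destruct (L1 u v t du dv Du Dv Hadm) as [r1 [Hr1 D1]].
    destruct (L2 u v t du dv Du Dv Hadm) as [r2 [Hr2 D2]].
    exists (r1 + r2); split.
    + eapply Rle_trans; [apply Rabs_triang |].
      replace ((C1 + C2) * tpow q (S q) t * norm1 (u t) (v t) ^ 2)
        with (C1 * tpow q (S q) t * norm1 (u t) (v t) ^ 2
              + C2 * tpow q (S q) t * norm1 (u t) (v t) ^ 2) by ring; lra.
    + eapply is_derive_ext; [intros s; symmetry; apply sum_Sn |].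
      evar_last; [apply (is_derive_plus _ _ _ _ _ D1 D2) |].
      rewrite !sum_Sn; cbv [plus]; simpl; ring.
Qed.

Let pa := dx (P (S p)) sigma 0.
Let pb := dy (P (S p)) sigma 0.
Let qa := dx (Q (S p)) sigma 0.
Let qb := dy (Q (S p)) sigma 0.

(** Its derivative along [u' = v], [v' = - omega2 u], added to the power
    [omega2 u (pa u + pb v) + v (qa u + qb v)] of the linear field, gives
    [(pa + qb) / 2 (omega2 u^2 + v^2)], the divergence times the unperturbed energy. *)
Definition corrector (u v : R) : R :=
  (pa - qb) / 2 * (u * v) - (qa + omega2 * pb) / 2 * u ^ 2.

Definition energy (t u v : R) : R :=
  sum_n (fun k => tpow q k t * energy_term k t u v) p + tpow q (S p) t * corrector u v.

Lemma abs_le_norm1 (u v : R) : Rabs u <= norm1 u v /\ Rabs v <= norm1 u v.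
Proof. unfold norm1; pose proof (Rabs_pos u); pose proof (Rabs_pos v); lra. Qed.

Lemma corrector_le :
  exists C, 0 <= C /\ forall u v, Rabs (corrector u v) <= C * norm1 u v ^ 2.
Proof.
  exists (Rabs ((pa - qb) / 2) + Rabs ((qa + omega2 * pb) / 2)); split.
  { apply Rplus_le_le_0_compat; apply Rabs_pos. }
  intros u v; unfold corrector.
  destruct (abs_le_norm1 u v) as [Hu Hv].
  pose proof (abs_mult_le ((pa - qb) / 2) _ _ _ (Rle_refl _) (abs_mult_le _ _ _ _ Hu Hv)) as E1.
  pose proof (abs_mult_le ((qa + omega2 * pb) / 2) _ _ _ (Rle_refl _) (abs_mult_le _ _ _ _ Hu Hu)) as E2.
  replace (u ^ 2) with (u * u) by ring.
  unfold Rminus at 1; eapply Rle_trans; [apply Rabs_triang |]; rewrite Rabs_Ropp; nra.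
Qed.

Lemma energy_leading :
  exists C, 0 <= C /\ forall t u v, admissible t u v ->
    Rabs (energy t u v - (omega2 * u ^ 2 + v ^ 2) / 2)
      <= C * (tpow q 1 t + norm1 u v) * norm1 u v ^ 2.
Proof.
  destruct sum_energy_term_leading as [C1 [HC1 L1]].
  destruct corrector_le as [C2 [HC2 L2]].
  exists (C1 + C2); split; [lra |]; intros t u v Hadm.
  specialize (L1 t u v Hadm); specialize (L2 u v).
  assert (E : tpow q (S p) t <= tpow q 1 t)
    by (apply tpow_le; [exact q_pos | lia | apply Hadm]).
  pose proof (tpow_pos q (S p) t); pose proof (norm1_ge_0 u v).
  assert (0 <= norm1 u v ^ 2) by apply pow2_ge_0.
  assert (F : Rabs (tpow q (S p) t * corrector u v)
              <= (tpow q 1 t + norm1 u v) * (C2 * norm1 u v ^ 2))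
    by (apply abs_mult_le; [rewrite Rabs_pos_eq; lra | exact L2]).
  unfold energy.
  match goal with |- Rabs (?s + ?x - ?y) <= _ =>
    replace (s + x - y) with ((s - y) + x) by ring end.
  eapply Rle_trans; [apply Rabs_triang | nra].
Qed.

(** Here [eps] is the relative error of the truncated expansion of the field.  The
    constant [C] depends neither on it nor on the size of [(u, v)], so both can be chosen
    small afterwards. *)
Lemma energy_derive :
  exists C, 0 <= C /\
  forall (u v : R -> R) (t du dv eps : R),
    is_derive u t du -> is_derive v t dv -> admissible t (u t) (v t) ->
    0 <= eps <= 1 ->
    Rabs (du - sum_n (fun k => tpow q k t * P_incr k t (u t) (v t)) (S p))
      <= eps * tpow q (S p) t * norm1 (u t) (v t) ->
    Rabs (dv - sum_n (fun k => tpow q k t * Q_incr k t (u t) (v t)) (S p))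
      <= eps * tpow q (S p) t * norm1 (u t) (v t) ->
    exists d, is_derive (fun s => energy s (u s) (v s)) t d /\
    Rabs (d - tpow q (S p) t * ((pa + qb) / 2 * (omega2 * u t ^ 2 + v t ^ 2)))
      <= C * (tpow q (S p) t * (eps + tpow q 1 t + norm1 (u t) (v t)) + tpow q (S q) t)
           * norm1 (u t) (v t) ^ 2.
Proof.
  destruct sum_P_incr_leading as [Cf [HCf Lf]].
  destruct sum_Q_incr_leading as [Cg [HCg Lg]].
  destruct sum_energy_term_derive as [Cr [HCr Lr]].
  destruct (incr_linear (P (S p)) (P_C11 _ (le_n _))) as [Ca [HCa La]].
  destruct (incr_linear (Q (S p)) (Q_C11 _ (le_n _))) as [Cb [HCb Lb]].
  destruct corrector_le as [Cs [HCs Ls]].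
  fold pa pb in La; fold qa qb in Lb.
  (* [s1] and [s2] are the coefficients of the corrector. *)
  set (s1 := (pa - qb) / 2); set (s2 := (qa + omega2 * pb) / 2).
  pose (A := Rabs pa + Rabs pb + Rabs qa + Rabs qb + Rabs omega2 + Rabs s1 + Rabs s2).
  pose (B := Cf + Cg + Ca + Cb + 1).
  destruct (dissipation_algebra A B) as [K [HK LK]].
  { unfold A; repeat apply Rplus_le_le_0_compat; apply Rabs_pos. }
  { unfold B; lra. }
  pose proof (pos_INR (S p)).
  exists (K + Cr + INR (S p) * Cs); split.
  { assert (0 <= INR (S p) * Cs) by (apply Rmult_le_pos; assumption); lra. }
  intros u v t du dv eps Du Dv Hadm Heps Edu Edv.
  destruct (Lr u v t du dv Du Dv Hadm) as [r [Hr Dr]].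
  specialize (Lf t _ _ Hadm); specialize (Lg t _ _ Hadm).
  specialize (La t _ _ Hadm); specialize (Lb t _ _ Hadm).
  fold (P_incr (S p) t (u t) (v t)) in La; fold (Q_incr (S p) t (u t) (v t)) in Lb.
  specialize (Ls (u t) (v t)).
  rewrite sum_Sn in Edu, Edv.
  change (@plus R_AbelianMonoid) with Rplus in Edu, Edv.
  set (f := sum_n (fun k => tpow q k t * P_incr k t (u t) (v t)) p) in *.
  set (g := sum_n (fun k => tpow q k t * Q_incr k t (u t) (v t)) p) in *.
  set (l := norm1 (u t) (v t)) in *.
  set (e := tpow q (S p) t) in *.
  set (delta := eps + tpow q 1 t + l).
  assert (Ht : 1 <= t) by apply Hadm.
  assert (He : 0 < e) by apply tpow_pos.
  assert (He1 : e <= tpow q 1 t) by (apply tpow_le; [exact q_pos | lia | exact Ht]).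
  pose proof (tpow_le_1 q 1 t q_pos Ht) as He2.
  assert (Hl : 0 <= l) by apply norm1_ge_0.
  assert (Hl2 : l <= 2) by (unfold l, norm1; destruct Hadm as [_ [? ?]]; lra).
  assert (Hd : e <= delta <= 4) by (unfold delta; lra).
  assert (Hdl : 0 <= (tpow q 1 t + l) * l <= delta * l)
    by (unfold delta; split; [apply Rmult_le_pos; lra | apply Rmult_le_compat_r; lra]).
  assert (Hel : 0 <= eps * l <= delta * l)
    by (unfold delta; split; [apply Rmult_le_pos; lra | apply Rmult_le_compat_r; lra]).
  set (u0 := u t) in *; set (v0 := v t) in *.
  (* What the derivative adds to the fields of index at most [p], divided by [e], is the
     linear part of the field of index [S p] up to an error of relative size [delta]. *)
  assert (rem : forall d s w C, 0 <= C <= B - 1 ->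
    Rabs (s - w) <= C * (tpow q 1 t + l) * l ->
    Rabs (d - e * s) <= eps * e * l ->
    Rabs (d / e - w) <= B * delta * l).
  { intros d s w C HC E1 E2.
    assert (E3 : Rabs (d / e - s) <= eps * l).
    { apply Rmult_le_reg_l with e; [exact He |].
      rewrite <- (Rabs_pos_eq e) at 1 by lra; rewrite <- Rabs_mult.
      replace (e * (d / e - s)) with (d - e * s) by (field; lra); lra. }
    replace (d / e - w) with ((d / e - s) + (s - w)) by ring.
    eapply Rle_trans; [apply Rabs_triang |].
    assert (C * (tpow q 1 t + l) * l <= (B - 1) * (delta * l))
      by (rewrite Rmult_assoc; apply Rmult_le_compat; lra).
    lra. }
  assert (Ba : Rabs ((du - f) / e - (pa * u0 + pb * v0)) <= B * delta * l).
  { apply (rem (du - f) (P_incr (S p) t u0 v0) (pa * u0 + pb * v0) Ca); [unfold B; lra | exact La |].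
    replace (du - f - e * P_incr (S p) t u0 v0) with (du - (f + e * P_incr (S p) t u0 v0)) by ring.
    exact Edu. }
  assert (Bb : Rabs ((dv - g) / e - (qa * u0 + qb * v0)) <= B * delta * l).
  { apply (rem (dv - g) (Q_incr (S p) t u0 v0) (qa * u0 + qb * v0) Cb); [unfold B; lra | exact Lb |].
    replace (dv - g - e * Q_incr (S p) t u0 v0) with (dv - (g + e * Q_incr (S p) t u0 v0)) by ring.
    exact Edv. }
  assert (Bf : Rabs (f - v0) <= B * delta * l).
  { eapply Rle_trans; [exact Lf |].
    rewrite !Rmult_assoc; apply Rmult_le_compat; try lra; unfold B; lra. }
  assert (Bg : Rabs (g - - omega2 * u0) <= B * delta * l).
  { eapply Rle_trans; [exact Lg |].
    rewrite !Rmult_assoc; apply Rmult_le_compat; try lra; unfold B; lra. }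
  set (al := (du - f) / e - (pa * u0 + pb * v0)) in *.
  set (be := (dv - g) / e - (qa * u0 + qb * v0)) in *.
  set (f1 := f - v0) in *; set (g1 := g - - omega2 * u0) in *.
  destruct (abs_le_norm1 u0 v0) as [Hu0 Hv0]; fold l in Hu0, Hv0.
  set (de := - (INR (S p) / INR q) * tpow q (S p + q) t).
  pose proof (tpow_derive_bound q (S p) t q_pos Ht) as Hde; fold de in Hde.
  exists (f * dv - g * du + r + (de * corrector u0 v0
    + e * (s1 * (du * v0 + u0 * dv) - s2 * (2 * u0 * du)))).
  split.
  { unfold energy.
    apply (is_derive_plus (fun s => sum_n (fun k => tpow q k s * energy_term k s (u s) (v s)) p)
      (fun s => tpow q (S p) s * corrector (u s) (v s))); [exact Dr |].
    apply (is_derive_mult (tpow q (S p)) (fun s => corrector (u s) (v s)));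
      [apply is_derive_tpow; [exact q_pos | lra] | | exact Rmult_comm].
    unfold corrector; fold s1 s2.
    assert (eu : Derive u t = du) by (apply is_derive_unique, Du).
    assert (ev : Derive v t = dv) by (apply is_derive_unique, Dv).
    auto_derive; [repeat split; eexists; eassumption |].
    change (fun x => u x) with u; change (fun x => v x) with v.
    rewrite eu, ev; fold u0 v0; ring. }
  assert (Edu' : du = v0 + f1 + e * (pa * u0 + pb * v0 + al))
    by (unfold f1, al; field; lra).
  assert (Edv' : dv = - omega2 * u0 + g1 + e * (qa * u0 + qb * v0 + be))
    by (unfold g1, be; field; lra).
  assert (hA : forall x, In x (pa :: pb :: qa :: qb :: omega2 :: s1 :: s2 :: nil) ->
                Rabs x <= A).
  { pose proof (Rabs_pos pa); pose proof (Rabs_pos pb); pose proof (Rabs_pos qa).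
    pose proof (Rabs_pos qb); pose proof (Rabs_pos omega2).
    pose proof (Rabs_pos s1); pose proof (Rabs_pos s2).
    intros x Hx; simpl in Hx; unfold A.
    repeat destruct Hx as [<- | Hx]; try lra; destruct Hx. }
  assert (LK' := LK pa pb qa qb omega2 s1 s2 u0 v0 f1 g1 al be e delta l).
  match type of LK' with context [Rabs ?z <= K * delta * _] => set (Z := z) in LK' end.
  assert (HZ : Rabs Z <= K * delta * l ^ 2).
  { apply LK'; try (apply hA; simpl; tauto); try assumption; [apply Rle_refl | lra]. }
  match goal with |- Rabs ?x <= _ =>
    replace x with (e * Z + (r + de * corrector u0 v0)) end.
  - assert (E1 : Rabs (e * Z) <= e * (K * delta * l ^ 2))
      by (apply abs_mult_le; [rewrite Rabs_pos_eq; lra | exact HZ]).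
    pose proof (abs_mult_le _ _ _ _ Hde Ls) as E2.
    pose proof (tpow_pos q (S q) t).
    assert (0 <= l ^ 2) by apply pow2_ge_0.
    assert (0 <= e * delta * l ^ 2)
      by (apply Rmult_le_pos; [apply Rmult_le_pos |]; lra).
    assert (0 <= tpow q (S q) t * l ^ 2) by (apply Rmult_le_pos; lra).
    assert (0 <= INR (S p) * Cs) by (apply Rmult_le_pos; assumption).
    eapply Rle_trans; [apply Rabs_triang |].
    pose proof (Rabs_triang r (de * corrector u0 v0)).
    fold delta.
    replace ((K + Cr + INR (S p) * Cs) * (e * delta + tpow q (S q) t) * l ^ 2)
      with (e * (K * delta * l ^ 2) + Cr * tpow q (S q) t * l ^ 2
            + INR (S p) * tpow q (S q) t * (Cs * l ^ 2)
            + ((Cr + INR (S p) * Cs) * (e * delta * l ^ 2)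
               + K * (tpow q (S q) t * l ^ 2))) by ring.
    assert (0 <= (Cr + INR (S p) * Cs) * (e * delta * l ^ 2))
      by (apply Rmult_le_pos; lra).
    assert (0 <= K * (tpow q (S q) t * l ^ 2)) by (apply Rmult_le_pos; lra).
    lra.
  - unfold Z; replace f with (v0 + f1) by (unfold f1; ring).
    replace g with (- omega2 * u0 + g1) by (unfold g1; ring).
    rewrite Edu', Edv'; unfold s1, s2; field.
Qed.

End Lyapunov_function.

(** * Global solutions of Lipschitz systems *)

(** The rate is explicit because it allows to pass to the limit in the integral equation
    of the Picard iteration. *)
Lemma geometric_limit (u : nat -> R) (c : R) :
  0 <= c ->
  (forall n, Rabs (u (S n) - u n) <= c * (1 / 2) ^ n) ->
  forall n, Rabs (u n - Lim_seq u) <= 2 * c * (1 / 2) ^ n.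
Proof.
  intros Hc Hu.
  assert (D : forall n k, Rabs (u (n + k)%nat - u n) <= 2 * c * (1 / 2) ^ n).
  { assert (D : forall n k,
      Rabs (u (n + k)%nat - u n) <= 2 * c * (1 / 2) ^ n * (1 - (1 / 2) ^ k)).
    { intros n k; induction k as [| k IH].
      - rewrite Nat.add_0_r, Rminus_diag, Rabs_R0; simpl; lra.
      - rewrite Nat.add_succ_r.
        replace (u (S (n + k)) - u n)
          with ((u (S (n + k)) - u (n + k)%nat) + (u (n + k)%nat - u n)) by ring.
        eapply Rle_trans; [apply Rabs_triang |].
        specialize (Hu (n + k)%nat); rewrite pow_add in Hu.
        simpl pow; nra. }
    intros n k; eapply Rle_trans; [apply D |].
    assert (0 < (1 / 2) ^ n) by (apply pow_lt; lra).
    assert (0 < (1 / 2) ^ k) by (apply pow_lt; lra).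
    assert (0 <= 2 * c * (1 / 2) ^ n) by (apply Rmult_le_pos; lra).
    nra. }
  assert (HL : ex_finite_lim_seq u).
  { apply ex_lim_seq_cauchy_corr; intros eps.
    destruct (pow_lt_1_zero (1 / 2)) with (y := eps / (4 * c + 1)) as [N HN].
    - rewrite Rabs_pos_eq; lra.
    - apply Rdiv_lt_0_compat; [apply cond_pos | lra].
    - exists N; intros n k Hn Hk.
      specialize (HN N (le_n N)).
      rewrite Rabs_pos_eq in HN by (apply pow_le; lra).
      pose proof (D N (n - N)%nat) as D1; pose proof (D N (k - N)%nat) as D2.
      replace (N + (n - N))%nat with n in D1 by lia.
      replace (N + (k - N))%nat with k in D2 by lia.
      replace (u n - u k) with ((u n - u N) + - (u k - u N)) by ring.
      eapply Rle_lt_trans; [apply Rabs_triang |]; rewrite Rabs_Ropp.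
      assert (E : (4 * c + 1) * (1 / 2) ^ N < eps).
      { apply Rmult_lt_reg_r with (/ (4 * c + 1)); [apply Rinv_0_lt_compat; lra |].
        replace ((4 * c + 1) * (1 / 2) ^ N * / (4 * c + 1)) with ((1 / 2) ^ N)
          by (field; lra). exact HN. }
      assert (0 < (1 / 2) ^ N) by (apply pow_lt; lra). nra. }
  intros n; apply Lim_seq_correct' in HL.
  assert (H := is_lim_seq_incr_n u n (Finite (real (Lim_seq u)))).
  apply (is_lim_seq_le (fun k => Rabs (u n - u (k + n)%nat))
           (fun _ => 2 * c * (1 / 2) ^ n)
           (Rabs (u n - Lim_seq u)) (2 * c * (1 / 2) ^ n)).
  - intros k; rewrite Rabs_minus_sym, Nat.add_comm; apply D.
  - apply (is_lim_seq_abs (fun k => u n - u (k + n)%nat) (Finite (u n - Lim_seq u))).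
    apply is_lim_seq_minus'; [apply is_lim_seq_const | now apply -> H].
  - apply is_lim_seq_const.
Qed.

Lemma pow_half_squeeze (x c : R) : (forall n, Rabs x <= c * (1 / 2) ^ n) -> x = 0.
Proof.
  intros H.
  assert (L : is_lim_seq (fun n => c * (1 / 2) ^ n) 0).
  { replace (Finite 0) with (Rbar_mult c 0) by (simpl; f_equal; ring).
    apply is_lim_seq_scal_l, is_lim_seq_geom; rewrite Rabs_pos_eq; lra. }
  assert (E := is_lim_seq_le _ _ (Rabs x) 0 H (is_lim_seq_const _) L); simpl in E.
  destruct (Req_dec x 0) as [| Hx]; [assumption |].
  apply Rabs_pos_lt in Hx; lra.
Qed.

Lemma lipschitz_continuous (x : R -> R) (B t : R) :
  (forall s r, Rabs (x s - x r) <= B * Rabs (s - r)) -> continuous x t.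
Proof.
  intros H; apply continuity_pt_filterlim.
  intros eps Heps; exists (eps / (Rabs B + 1)); split.
  { pose proof (Rabs_pos B); apply Rdiv_lt_0_compat; lra. }
  intros s [_ Hs]; simpl in *; unfold Rdist in *.
  eapply Rle_lt_trans; [apply H |].
  pose proof (Rle_abs B); pose proof (Rabs_pos (s - t)); pose proof (Rabs_pos B).
  apply Rle_lt_trans with ((Rabs B + 1) * Rabs (s - t)); [nra |].
  apply Rmult_lt_reg_r with (/ (Rabs B + 1)); [apply Rinv_0_lt_compat; lra |].
  replace ((Rabs B + 1) * Rabs (s - t) * / (Rabs B + 1)) with (Rabs (s - t))
    by (field; lra).
  exact Hs.
Qed.

Lemma continuous_along {U : UniformSpace} (f : R -> R -> R -> R) (x y z : U -> R) (t : U) :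
  joint_continuous f (x t) (y t) (z t) ->
  continuous x t -> continuous y t -> continuous z t ->
  continuous (fun s => f (x s) (y s) (z s)) t.
Proof.
  intros Hf Hx Hy Hz.
  apply (continuous_comp_2 (fun s => (x s, y s)) z
           (fun p s => f (fst p) (snd p) s)); [| exact Hz | exact Hf].
  apply (continuous_comp_2 x y (fun a b => (a, b))); [exact Hx | exact Hy |].
  apply (continuous_ext (fun p => p)); [intros []; reflexivity | apply continuous_id].
Qed.

Lemma Rmax_lipschitz (tau s r : R) : Rabs (Rmax s tau - Rmax r tau) <= 1 * Rabs (s - r).
Proof.
  unfold Rmax; destruct (Rle_dec s tau), (Rle_dec r tau);
    unfold Rabs; repeat destruct Rcase_abs; lra.
Qed.

Section Picard.

Variables (f g : R -> R -> R -> R) (L B tau a b : R).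
Hypothesis L_pos : 0 < L.
Hypothesis f_lip : forall x y x' y' t,
  Rabs (f x y t - f x' y' t) <= L * (Rabs (x - x') + Rabs (y - y')).
Hypothesis g_lip : forall x y x' y' t,
  Rabs (g x y t - g x' y' t) <= L * (Rabs (x - x') + Rabs (y - y')).
Hypothesis f_le : forall x y t, Rabs (f x y t) <= B.
Hypothesis g_le : forall x y t, Rabs (g x y t) <= B.
Hypothesis f_cont : forall x y t, joint_continuous f x y t.
Hypothesis g_cont : forall x y t, joint_continuous g x y t.

(** The curves are frozen at [tau] for earlier times: convergence is controlled only
    after [tau], but a two-sided derivative at [tau] needs a function on both sides. *)
Definition slope (F : R -> R -> R -> R) (x y : R -> R) (s : R) : R :=
  F (x (Rmax s tau)) (y (Rmax s tau)) s.

Definition picard (F : R -> R -> R -> R) (c : R) (x y : R -> R) (t : R) : R :=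
  c + RInt (slope F x y) tau t.

(** In the sup norm divided by this weight, on the whole half-line after [tau], a Picard
    step moves each component by at most a quarter of the total distance, so it halves
    that distance. *)
Definition weight (t : R) : R := exp (4 * L * (t - tau)).

Lemma weight_pos (t : R) : 0 < weight t.
Proof. apply exp_pos. Qed.

Lemma slope_continuous (F : R -> R -> R -> R) (x y : R -> R) (t : R) :
  (forall x y t, joint_continuous F x y t) ->
  (forall s, continuous x s) -> (forall s, continuous y s) ->
  continuous (slope F x y) t.
Proof.
  intros HF Hx Hy; unfold slope.
  assert (Hm : continuous (fun s => Rmax s tau) t)
    by (apply (lipschitz_continuous _ 1), Rmax_lipschitz).
  apply (continuous_along F (fun s => x (Rmax s tau)) (fun s => y (Rmax s tau)) (fun s => s)).
  - apply HF.
  - apply continuous_comp; [exact Hm | apply Hx].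
  - apply continuous_comp; [exact Hm | apply Hy].
  - apply continuous_id.
Qed.

Lemma picard_derive (F : R -> R -> R -> R) (c : R) (x y : R -> R) (t : R) :
  (forall x y t, joint_continuous F x y t) ->
  (forall s, continuous x s) -> (forall s, continuous y s) ->
  is_derive (picard F c x y) t (slope F x y t).
Proof.
  intros HF Hx Hy; unfold picard.
  rewrite <- (Rplus_0_l (slope F x y t)).
  apply (is_derive_plus (fun _ => c) (fun s => RInt (slope F x y) tau s));
    [apply (is_derive_const c) |].
  apply (is_derive_RInt (slope F x y) _ tau); [| now apply slope_continuous].
  apply filter_forall; intros s.
  apply (RInt_correct (V := R_CompleteNormedModule)),
          (ex_RInt_continuous (V := R_CompleteNormedModule)).
  intros z _; now apply slope_continuous.
Qed.

Lemma picard_continuous (F : R -> R -> R -> R) (c : R) (x y : R -> R) :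
  (forall x y t, joint_continuous F x y t) ->
  (forall s, continuous x s) -> (forall s, continuous y s) ->
  forall t, continuous (picard F c x y) t.
Proof.
  intros HF Hx Hy t; apply (ex_derive_continuous (K := R_AbsRing) (V := R_NormedModule)).
  eexists; now apply picard_derive.
Qed.

Lemma picard_lip (F : R -> R -> R -> R) (c : R) (x y : R -> R) (s t : R) :
  (forall x y t, joint_continuous F x y t) -> (forall x y t, Rabs (F x y t) <= B) ->
  (forall s, continuous x s) -> (forall s, continuous y s) ->
  Rabs (picard F c x y t - picard F c x y s) <= B * Rabs (t - s).
Proof.
  intros HF HB Hx Hy; apply (abs_increment_le _ (slope F x y)).
  - intros r _; now apply picard_derive.
  - intros r _; apply HB.
Qed.

Lemma picard_at_tau (F : R -> R -> R -> R) (c : R) (x y : R -> R) :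
  picard F c x y tau = c.
Proof. unfold picard; rewrite RInt_point; apply Rplus_0_r. Qed.

(** [L * weight] is a quarter of the derivative of [weight]. *)
Lemma picard_contraction (F : R -> R -> R -> R) (c d : R) (x y x' y' : R -> R) :
  (forall x y t, joint_continuous F x y t) ->
  (forall x y x' y' t, Rabs (F x y t - F x' y' t) <= L * (Rabs (x - x') + Rabs (y - y'))) ->
  (forall s, continuous x s) -> (forall s, continuous y s) ->
  (forall s, continuous x' s) -> (forall s, continuous y' s) ->
  0 <= d ->
  (forall t, tau <= t -> Rabs (x t - x' t) + Rabs (y t - y' t) <= d * weight t) ->
  forall t, tau <= t ->
    Rabs (picard F c x y t - picard F c x' y' t) <= d / 4 * weight t.
Proof.
  intros HF HL Hx Hy Hx' Hy' Hd Hw t Ht.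
  assert (ex : forall x y, (forall s, continuous x s) -> (forall s, continuous y s) ->
    is_RInt (slope F x y) tau t (RInt (slope F x y) tau t)).
  { intros z w Hz Hw'.
    apply (RInt_correct (V := R_CompleteNormedModule)),
          (ex_RInt_continuous (V := R_CompleteNormedModule)).
    intros r _; now apply slope_continuous. }
  assert (I1 := is_RInt_minus _ _ _ _ _ _ (ex x y Hx Hy) (ex x' y' Hx' Hy')).
  assert (I2 : is_RInt (fun s => L * (d * weight s)) tau t
                 (d / 4 * weight t - d / 4 * weight tau)).
  { apply (is_RInt_derive (fun s => d / 4 * weight s)).
    - intros s _; unfold weight, Rminus; auto_derive; [trivial | field].
    - intros s _; apply (ex_derive_continuous (K := R_AbsRing) (V := R_NormedModule)).
      unfold weight; auto_derive; trivial. }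
  replace (picard F c x y t - picard F c x' y' t)
    with (minus (RInt (slope F x y) tau t) (RInt (slope F x' y') tau t))
    by (unfold picard; cbv [minus plus opp]; simpl; ring).
  eapply Rle_trans.
  - apply (norm_RInt_le (V := R_NormedModule) _ _ _ _ _ _ Ht) with (2 := I1) (3 := I2).
    intros s [Hs _]; unfold slope; rewrite (Rmax_left s tau) by lra.
    eapply Rle_trans; [apply HL |].
    apply Rmult_le_compat_l; [lra | now apply Hw].
  - pose proof (weight_pos tau); nra.
Qed.

Fixpoint iterate (n : nat) : (R -> R) * (R -> R) :=
  match n with
  | O => (fun _ => a, fun _ => b)
  | S n => (picard f a (fst (iterate n)) (snd (iterate n)),
            picard g b (fst (iterate n)) (snd (iterate n)))
  end.

Let x_ n := fst (iterate n).
Let y_ n := snd (iterate n).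

Lemma B_nonneg : 0 <= B.
Proof. eapply Rle_trans; [apply Rabs_pos | apply (f_le 0 0 0)]. Qed.

Lemma iterate_continuous (n : nat) :
  (forall t, continuous (x_ n) t) /\ (forall t, continuous (y_ n) t).
Proof.
  induction n as [| n [Hx Hy]].
  - split; intros t; apply continuous_const.
  - split; apply picard_continuous; assumption.
Qed.

Lemma iterate_lip (n : nat) (s t : R) :
  Rabs (x_ n t - x_ n s) <= B * Rabs (t - s) /\
  Rabs (y_ n t - y_ n s) <= B * Rabs (t - s).
Proof.
  destruct n as [| n].
  - unfold x_, y_; simpl; rewrite !Rminus_diag, Rabs_R0.
    pose proof B_nonneg; pose proof (Rabs_pos (t - s)); split; nra.
  - destruct (iterate_continuous n); split; apply picard_lip; assumption.
Qed.

Lemma iterate_at_tau (n : nat) : x_ n tau = a /\ y_ n tau = b.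
Proof. destruct n; split; try reflexivity; apply picard_at_tau. Qed.

Lemma iterate_gap (n : nat) (t : R) :
  tau <= t ->
  Rabs (x_ (S n) t - x_ n t) + Rabs (y_ (S n) t - y_ n t)
    <= B / (2 * L) * (1 / 2) ^ n * weight t.
Proof.
  pose proof B_nonneg as HB.
  assert (HC : 0 <= B / (2 * L)) by (apply Rdiv_le_0_compat; lra).
  revert t; induction n as [| n IH]; intros t Ht.
  - destruct (iterate_lip 1 tau t) as [H1 H2].
    destruct (iterate_at_tau 1) as [E1 E2]; rewrite E1 in H1; rewrite E2 in H2.
    change (x_ 0 t) with a; change (y_ 0 t) with b.
    rewrite (Rabs_pos_eq (t - tau)) in H1, H2 by lra.
    assert (E : 4 * L * (t - tau) <= weight t)
      by (unfold weight; pose proof (exp_ineq1_le (4 * L * (t - tau))); lra).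
    simpl pow; rewrite Rmult_1_r.
    replace (B / (2 * L) * weight t)
      with (B / (2 * L) * (4 * L * (t - tau)) + B / (2 * L) * (weight t - 4 * L * (t - tau)))
      by ring.
    replace (B / (2 * L) * (4 * L * (t - tau))) with (2 * (B * (t - tau))) by (field; lra).
    nra.
  - destruct (iterate_continuous n) as [Cx Cy].
    destruct (iterate_continuous (S n)) as [Cx' Cy'].
    assert (Hpow : 0 <= (1 / 2) ^ n) by (apply pow_le; lra).
    assert (H1 := picard_contraction f a (B / (2 * L) * (1 / 2) ^ n)
      _ _ _ _ f_cont f_lip Cx' Cy' Cx Cy (Rmult_le_pos _ _ HC Hpow) IH t Ht).
    assert (H2 := picard_contraction g b (B / (2 * L) * (1 / 2) ^ n)
      _ _ _ _ g_cont g_lip Cx' Cy' Cx Cy (Rmult_le_pos _ _ HC Hpow) IH t Ht).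
    change (Rabs (picard f a (x_ (S n)) (y_ (S n)) t - picard f a (x_ n) (y_ n) t)
      + Rabs (picard g b (x_ (S n)) (y_ (S n)) t - picard g b (x_ n) (y_ n) t)
      <= B / (2 * L) * (1 / 2 * (1 / 2) ^ n) * weight t).
    lra.
Qed.

(** The iterates converge pointwise with a geometric rate and share the Lipschitz
    constant [B], so their limit is continuous and a fixed point of the iteration. *)
Lemma picard_solution :
  exists x y : R -> R, x tau = a /\ y tau = b /\
  forall t, tau <= t ->
    is_derive x t (f (x t) (y t) t) /\ is_derive y t (g (x t) (y t) t).
Proof.
  pose proof B_nonneg as HB.
  set (C := B / (2 * L)).
  assert (HC : 0 <= C) by (apply Rdiv_le_0_compat; lra).
  pose (X := fun t => real (Lim_seq (fun n => x_ n (Rmax t tau)))).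
  pose (Y := fun t => real (Lim_seq (fun n => y_ n (Rmax t tau)))).
  assert (conv : forall n t,
    Rabs (x_ n (Rmax t tau) - X t) <= 2 * (C * weight (Rmax t tau)) * (1 / 2) ^ n /\
    Rabs (y_ n (Rmax t tau) - Y t) <= 2 * (C * weight (Rmax t tau)) * (1 / 2) ^ n).
  { intros n t.
    assert (Hw : 0 <= C * weight (Rmax t tau))
      by (apply Rmult_le_pos; [exact HC | apply Rlt_le, weight_pos]).
    pose proof (fun k => iterate_gap k (Rmax t tau) (Rmax_r t tau)) as G.
    split; [apply (geometric_limit (fun k => x_ k (Rmax t tau)))
           | apply (geometric_limit (fun k => y_ k (Rmax t tau)))];
      try exact Hw; intros k; specialize (G k); fold C in G;
      pose proof (Rabs_pos (x_ (S k) (Rmax t tau) - x_ k (Rmax t tau)));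
      pose proof (Rabs_pos (y_ (S k) (Rmax t tau) - y_ k (Rmax t tau))); lra. }
  assert (lim_lip : forall (Z : R -> R) (z : nat -> R -> R),
    (forall n t s, Rabs (z n t - z n s) <= B * Rabs (t - s)) ->
    (forall n t, Rabs (z n (Rmax t tau) - Z t)
       <= 2 * (C * weight (Rmax t tau)) * (1 / 2) ^ n) ->
    forall t s, Rabs (Z t - Z s) <= B * Rabs (t - s)).
  { intros Z z Hlip Hz t s; apply Rnot_lt_le; intros Hlt.
    set (W := 2 * (C * weight (Rmax t tau)) + 2 * (C * weight (Rmax s tau))).
    assert (E : Rabs (Z t - Z s) - B * Rabs (t - s) = 0); [| lra].
    apply (pow_half_squeeze _ W); intros n; rewrite Rabs_pos_eq by lra.
    specialize (Hlip n (Rmax t tau) (Rmax s tau)).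
    pose proof (Hz n t) as Zt; pose proof (Hz n s) as Zs.
    pose proof (Rmax_lipschitz tau t s).
    pose proof (Rmult_le_compat_l B _ _ HB H).
    replace (Z t - Z s) with (- (z n (Rmax t tau) - Z t)
      + (z n (Rmax t tau) - z n (Rmax s tau)) + (z n (Rmax s tau) - Z s)) by ring.
    pose proof (Rabs_triang (- (z n (Rmax t tau) - Z t)
      + (z n (Rmax t tau) - z n (Rmax s tau))) (z n (Rmax s tau) - Z s)).
    pose proof (Rabs_triang (- (z n (Rmax t tau) - Z t))
      (z n (Rmax t tau) - z n (Rmax s tau))).
    rewrite Rabs_Ropp in *; unfold W; lra. }
  assert (CX : forall t, continuous X t).
  { intros t; apply (lipschitz_continuous _ B), (lim_lip X x_); [| intros; apply conv].
    intros n s r; apply iterate_lip. }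
  assert (CY : forall t, continuous Y t).
  { intros t; apply (lipschitz_continuous _ B), (lim_lip Y y_); [| intros; apply conv].
    intros n s r; apply iterate_lip. }
  assert (fixed : forall F c Z (z : nat -> R -> R),
    (forall x y t, joint_continuous F x y t) ->
    (forall x y x' y' t, Rabs (F x y t - F x' y' t) <= L * (Rabs (x - x') + Rabs (y - y'))) ->
    (forall n, z (S n) = picard F c (x_ n) (y_ n)) ->
    (forall n t, Rabs (z n (Rmax t tau) - Z t)
       <= 2 * (C * weight (Rmax t tau)) * (1 / 2) ^ n) ->
    forall t, tau <= t -> picard F c X Y t = Z t).
  { intros F c Z z Fc Fl HS Hz t Ht; apply Rminus_diag_uniq.
    apply (pow_half_squeeze _ (2 * C * weight t)); intros n.
    destruct (iterate_continuous n) as [Cx Cy].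
    assert (Hp : 0 <= (1 / 2) ^ n) by (apply pow_le; lra).
    assert (H1 : Rabs (picard F c X Y t - picard F c (x_ n) (y_ n) t)
                 <= (4 * C * (1 / 2) ^ n) / 4 * weight t).
    { apply picard_contraction; try assumption.
      - apply Rmult_le_pos; lra.
      - intros s Hs; destruct (conv n s) as [E1 E2].
        rewrite (Rmax_left s tau) in E1, E2 by lra.
        rewrite (Rabs_minus_sym (X s)), (Rabs_minus_sym (Y s)); lra. }
    pose proof (Hz (S n) t) as H2; rewrite (Rmax_left t tau), HS in H2 by lra.
    simpl pow in H2.
    replace (picard F c X Y t - Z t) with ((picard F c X Y t - picard F c (x_ n) (y_ n) t)
      + (picard F c (x_ n) (y_ n) t - Z t)) by ring.
    eapply Rle_trans; [apply Rabs_triang | lra]. }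
  exists (picard f a X Y), (picard g b X Y).
  split; [apply picard_at_tau |]; split; [apply picard_at_tau |].
  intros t Ht.
  rewrite (fixed f a X x_ f_cont f_lip (fun _ => eq_refl) (fun n t => proj1 (conv n t)) t Ht).
  rewrite (fixed g b Y y_ g_cont g_lip (fun _ => eq_refl) (fun n t => proj2 (conv n t)) t Ht).
  split.
  - assert (D := picard_derive f a X Y t f_cont CX CY).
    unfold slope in D; rewrite (Rmax_left t tau) in D by lra; exact D.
  - assert (D := picard_derive g b X Y t g_cont CX CY).
    unfold slope in D; rewrite (Rmax_left t tau) in D by lra; exact D.
Qed.

End Picard.

(** * Trajectories controlled by an energy *)

Lemma exp_le (x y : R) : x <= y -> exp x <= exp y.
Proof. intros [H | ->]; [now apply Rlt_le, exp_increasing | apply Rle_refl]. Qed.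

Lemma nonincreasing_of_derive (f : R -> R) (a b : R) :
  a <= b -> (forall s, a <= s <= b -> exists d, is_derive f s d /\ d <= 0) -> f b <= f a.
Proof.
  intros Hab H.
  destruct (MVT_gen f a b (Derive f)) as [c [Hc E]].
  - rewrite Rmin_left, Rmax_right by lra; intros s Hs.
    destruct (H s) as [d [Hd _]]; [lra |]; apply Derive_correct; now exists d.
  - rewrite Rmin_left, Rmax_right by lra; intros s Hs.
    destruct (H s) as [d [Hd _]]; [lra |]; apply derivable_continuous_pt.
    exists d; now apply is_derive_Reals.
  - rewrite Rmin_left, Rmax_right in Hc by lra.
    destruct (H c Hc) as [d [Hd Hle]].
    assert (Derive f c = d) by (now apply is_derive_unique). nra.
Qed.

Lemma nondecreasing_of_derive (f : R -> R) (a b : R) :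
  a <= b -> (forall s, a <= s <= b -> exists d, is_derive f s d /\ 0 <= d) -> f a <= f b.
Proof.
  intros Hab H.
  enough (- f b <= - f a) by lra.
  apply (nonincreasing_of_derive (fun s => - f s)); [exact Hab |].
  intros s Hs; destruct (H s Hs) as [d [Hd Hle]].
  exists (- d); split; [apply (is_derive_opp f), Hd | lra].
Qed.

Lemma continuous_lt_locally (g : R -> R) (t y : R) :
  continuous g t -> g t < y ->
  exists d, 0 < d /\ forall s, Rabs (s - t) < d -> g s < y.
Proof.
  intros Hc Hlt.
  destruct (proj1 (filterlim_locally g (g t)) Hc (mkposreal _ (proj2 (Rlt_0_minus _ _) Hlt)))
    as [d Hd].
  exists d; split; [apply cond_pos |]; intros s Hs.
  specialize (Hd s Hs); apply Rabs_lt_between in Hd; simpl in Hd.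
  unfold minus, plus, opp in Hd; simpl in Hd; lra.
Qed.

(** Consider the supremum of the times up to which the strict bound holds. *)
Lemma continuity_trap (g : R -> R) (a eta : R) :
  (forall t, a <= t -> continuous g t) -> g a < eta ->
  (forall t, a <= t -> (forall s, a <= s <= t -> g s <= eta) -> g t < eta) ->
  forall t, a <= t -> g t < eta.
Proof.
  intros Hc Ha Hstep t1 Ht1; apply NNPP; intros Hno.
  pose (E := fun s => a <= s <= t1 /\ forall r, a <= r <= s -> g r < eta).
  destruct (completeness E) as [m [Hub Hlub]].
  - exists t1; intros s [Hs _]; lra.
  - exists a; split; [lra |]; intros r Hr; now replace r with a by lra.
  - assert (Ham : a <= m).
    { apply Hub; split; [lra |]; intros r Hr; now replace r with a by lra. }
    assert (Hm1 : m <= t1) by (apply Hlub; intros s [Hs _]; lra).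
    assert (below : forall r, a <= r < m -> g r < eta).
    { intros r Hr; apply NNPP; intros Hr'.
      assert (m <= r); [| lra].
      apply Hlub; intros s [Hs Hs']; apply Rnot_lt_le; intros Hrs.
      apply Hr', Hs'; lra. }
    assert (Hgm : g m <= eta).
    { apply Rnot_lt_le; intros Hlt.
      destruct (Rle_lt_or_eq_dec a m Ham) as [Hlt' | <-]; [| lra].
      destruct (continuous_lt_locally (fun s => - g s) m (- eta)) as [d [Hd Hd']];
        [apply (continuous_opp g), Hc, Ham | lra |].
      pose proof (Rmax_l a (m - d / 2)); pose proof (Rmax_r a (m - d / 2)).
      assert (Rmax a (m - d / 2) < m) by (apply Rmax_lub_lt; lra).
      specialize (Hd' (Rmax a (m - d / 2))); specialize (below (Rmax a (m - d / 2))).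
      rewrite Rabs_left in Hd' by lra; lra. }
    assert (Hm : g m < eta).
    { apply Hstep; [exact Ham |]; intros s Hs.
      destruct (Rle_lt_or_eq_dec s m) as [Hlt | ->]; [lra | | exact Hgm].
      apply Rlt_le, below; lra. }
    destruct (Rle_lt_or_eq_dec m t1 Hm1) as [Hlt | <-]; [| contradiction].
    destruct (continuous_lt_locally g m eta (Hc m Ham) Hm) as [d [Hd Hd']].
    pose proof (Rmin_l t1 (m + d / 2)); pose proof (Rmin_r t1 (m + d / 2)).
    assert (m < Rmin t1 (m + d / 2)) by (apply Rmin_glb_lt; lra).
    assert (Rmin t1 (m + d / 2) <= m); [| lra].
    apply Hub; split; [lra |]; intros r Hr.
    destruct (Rlt_le_dec r m) as [Hrm | Hrm]; [apply below; lra |].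
    apply Hd'; rewrite Rabs_pos_eq; lra.
Qed.

Lemma norm1_continuous (u v : R -> R) (t : R) :
  continuous u t -> continuous v t -> continuous (fun s => norm1 (u s) (v s)) t.
Proof.
  intros Hu Hv; unfold norm1.
  apply (continuous_plus (fun s => Rabs (u s)) (fun s => Rabs (v s)));
    [apply (continuous_comp u Rabs) | apply (continuous_comp v Rabs)];
    try assumption; apply continuous_Rabs.
Qed.

(** The function [K exp (C q / c1 t^(-1/q))] does not increase, since the derivative of
    [q t^(-1/q)] is [- t^(-1-1/q)].  The estimate on [K] is available only inside the ball
    of radius [rho], so the argument runs inside [continuity_trap]. *)
Lemma lyapunov_confines (q : nat) (K : R -> R -> R -> R) (u v : R -> R)
    (T c1 c2 C rho eta : R) :
  (0 < q)%nat -> 1 <= T -> 0 < c1 <= c2 -> 0 <= C -> 0 < eta <= rho ->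
  (forall t, T <= t -> continuous u t /\ continuous v t) ->
  (forall t, T <= t -> norm1 (u t) (v t) <= rho ->
     c1 * norm1 (u t) (v t) ^ 2 <= K t (u t) (v t) <= c2 * norm1 (u t) (v t) ^ 2) ->
  (forall t, T <= t -> norm1 (u t) (v t) <= rho ->
     exists d, is_derive (fun s => K s (u s) (v s)) t d /\
       d <= C * tpow q (S q) t * norm1 (u t) (v t) ^ 2) ->
  c2 * norm1 (u T) (v T) ^ 2 * exp (C / c1 * INR q) < c1 * eta ^ 2 ->
  forall t, T <= t -> norm1 (u t) (v t) < eta.
Proof.
  intros Hq HT Hc HC Heta Hcont HK HdK HT0.
  assert (HQ : 1 <= INR q) by (apply (le_INR 1); lia).
  assert (HA : 0 <= C / c1) by (apply Rdiv_le_0_compat; lra).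
  assert (sq : forall l, 0 <= l -> l ^ 2 < eta ^ 2 -> l < eta).
  { intros l Hl H; apply Rnot_le_lt; intros Hle.
    assert (eta ^ 2 <= l ^ 2) by (apply pow_incr; lra); lra. }
  assert (exp1 : 1 <= exp (C / c1 * INR q)).
  { rewrite <- exp_0; apply exp_le; apply Rmult_le_pos; lra. }
  apply continuity_trap.
  - intros t Ht; apply norm1_continuous; now apply Hcont.
  - apply sq; [apply norm1_ge_0 |].
    assert (0 <= norm1 (u T) (v T) ^ 2) by apply pow2_ge_0.
    assert (c1 * norm1 (u T) (v T) ^ 2 <= c2 * norm1 (u T) (v T) ^ 2)
      by (apply Rmult_le_compat_r; lra).
    apply Rmult_lt_reg_l with c1; [lra |].
    eapply Rle_lt_trans; [| exact HT0].
    rewrite <- (Rmult_1_r (c1 * _)).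
    apply Rmult_le_compat; try lra. apply Rmult_le_pos; lra.
  - intros t Ht Hbd.
    pose (Z := fun s => K s (u s) (v s) * exp (C / c1 * INR q * tpow q 1 s)).
    assert (HZ : Z t <= Z T).
    { apply nonincreasing_of_derive; [exact Ht |]; intros s Hs.
      destruct (HK s) as [K1 K2]; [lra | apply Rle_trans with eta; [apply Hbd |]; lra |].
      destruct (HdK s) as [d [Hd Hle]];
        [lra | apply Rle_trans with eta; [apply Hbd |]; lra |].
      exists ((d - C / c1 * tpow q (S q) s * K s (u s) (v s))
              * exp (C / c1 * INR q * tpow q 1 s)); split.
      - evar_last.
        + apply (is_derive_mult (fun s => K s (u s) (v s))
            (fun s => exp (C / c1 * INR q * tpow q 1 s))); [exact Hd | | exact Rmult_comm].
          apply (is_derive_comp exp (fun s => C / c1 * INR q * tpow q 1 s));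
            [apply is_derive_exp |].
          apply (is_derive_scal (tpow q 1)), is_derive_tpow; [exact Hq | lra].
        + change (1 + q)%nat with (S q).
          cbv [plus mult scal]; simpl; cbv [mult]; simpl; field; lra.
      - assert (E : C * tpow q (S q) s * norm1 (u s) (v s) ^ 2
                    <= C / c1 * tpow q (S q) s * K s (u s) (v s)).
        { replace (C * tpow q (S q) s * norm1 (u s) (v s) ^ 2)
            with (C / c1 * tpow q (S q) s * (c1 * norm1 (u s) (v s) ^ 2)) by (field; lra).
          apply Rmult_le_compat_l; [| exact K1].
          apply Rmult_le_pos; [exact HA | apply Rlt_le, tpow_pos]. }
        pose proof (exp_pos (C / c1 * INR q * tpow q 1 s)); nra. }
    destruct (HK t Ht) as [Kt _]; [apply Rle_trans with eta; [apply Hbd |]; lra |].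
    destruct (HK T (Rle_refl T)) as [_ KT]; [apply Rle_trans with eta; [apply Hbd |]; lra |].
    apply sq; [apply norm1_ge_0 |].
    assert (B1 : K t (u t) (v t) <= Z t).
    { unfold Z; rewrite <- (Rmult_1_r (K t (u t) (v t))) at 1.
      apply Rmult_le_compat_l.
      - eapply Rle_trans; [| exact Kt].
        apply Rmult_le_pos; [lra | apply pow2_ge_0].
      - rewrite <- exp_0; apply exp_le.
        apply Rmult_le_pos; [apply Rmult_le_pos; lra | apply Rlt_le, tpow_pos]. }
    assert (B2 : Z T <= c2 * norm1 (u T) (v T) ^ 2 * exp (C / c1 * INR q)).
    { unfold Z; apply Rmult_le_compat.
      - destruct (HK T (Rle_refl T)) as [K0 _];
          [apply Rle_trans with eta; [apply Hbd |]; lra |].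
        eapply Rle_trans; [| exact K0].
        apply Rmult_le_pos; [lra | apply pow2_ge_0].
      - apply Rlt_le, exp_pos.
      - exact KT.
      - apply exp_le; rewrite <- (Rmult_1_r (C / c1 * INR q)) at 2.
        apply Rmult_le_compat_l; [apply Rmult_le_pos; lra |].
        apply tpow_le_1; [exact Hq | exact HT]. }
    apply Rmult_lt_reg_l with c1; lra.
Qed.

(** [K] does not decrease, so its derivative is at least a constant times [K(T) / t],
    and [K] grows at least like a multiple of [ln t] while it is bounded by [c2 rho^2]. *)
Lemma lyapunov_expels (K : R -> R -> R -> R) (u v : R -> R) (T c1 c2 g rho : R) :
  1 <= T -> 0 < c1 -> 0 < c2 -> 0 < g ->
  (forall t, T <= t -> norm1 (u t) (v t) <= rho) ->
  (forall t, T <= t ->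
     c1 * norm1 (u t) (v t) ^ 2 <= K t (u t) (v t) <= c2 * norm1 (u t) (v t) ^ 2) ->
  (forall t, T <= t -> exists d, is_derive (fun s => K s (u s) (v s)) t d /\
       g / t * norm1 (u t) (v t) ^ 2 <= d) ->
  0 < norm1 (u T) (v T) -> False.
Proof.
  intros HT H1 H2 Hg Hbd HK HdK H0.
  set (k := fun s => K s (u s) (v s)) in *.
  assert (Hk0 : 0 < k T).
  { destruct (HK T (Rle_refl T)) as [E _]; fold (k T) in E.
    assert (0 < norm1 (u T) (v T) ^ 2) by (apply pow_lt, H0). nra. }
  assert (mono : forall t, T <= t -> k T <= k t).
  { intros t Ht; apply nondecreasing_of_derive; [exact Ht |]; intros s Hs.
    destruct (HdK s) as [d [Hd Hle]]; [lra |]; exists d; split; [exact Hd |].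
    eapply Rle_trans; [| exact Hle].
    apply Rmult_le_pos; [apply Rdiv_le_0_compat; lra | apply pow2_ge_0]. }
  set (b := g * k T / c2).
  assert (Hb : 0 < b) by (apply Rdiv_lt_0_compat; [apply Rmult_lt_0_compat |]; lra).
  assert (grow : forall t, T <= t -> k T - b * ln T <= k t - b * ln t).
  { intros t Ht; apply (nondecreasing_of_derive (fun s => k s - b * ln s));
      [exact Ht |]; intros s Hs.
    destruct (HdK s) as [d [Hd Hle]]; [lra |].
    exists (d - b * / s); split.
    - apply (is_derive_minus k (fun s => b * ln s)); [exact Hd |].
      apply (is_derive_scal ln), is_derive_ln; lra.
    - destruct (HK s) as [_ E]; [lra |]; fold (k s) in E.
      specialize (mono s (proj1 Hs)).
      assert (0 < / s) by (apply Rinv_0_lt_compat; lra).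
      assert (b <= g * norm1 (u s) (v s) ^ 2).
      { unfold b; apply Rle_div_l; [lra |]. nra. }
      unfold Rdiv in Hle. nra. }
  assert (0 <= rho) by (eapply Rle_trans; [apply norm1_ge_0 | apply (Hbd T); lra]).
  (* At time [exp N] the lower bound on [k] exceeds its upper bound [c2 rho^2] by [k T + 1]. *)
  set (N := (c2 * rho ^ 2 + 1) / b + ln T).
  assert (HN : ln T <= N).
  { unfold N; assert (0 <= (c2 * rho ^ 2 + 1) / b); [| lra].
    apply Rdiv_le_0_compat; [| lra].
    pose proof (pow2_ge_0 rho). nra. }
  assert (HTN : T <= exp N).
  { rewrite <- (exp_ln T) by lra; now apply exp_le. }
  specialize (grow (exp N) HTN); rewrite ln_exp in grow.
  destruct (HK (exp N) HTN) as [_ E]; fold (k (exp N)) in E.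
  assert (norm1 (u (exp N)) (v (exp N)) ^ 2 <= rho ^ 2)
    by (apply pow_incr; split; [apply norm1_ge_0 | apply Hbd, HTN]).
  assert (b * N - b * ln T = c2 * rho ^ 2 + 1) by (unfold N; field; lra).
  nra.
Qed.

(** * Expansion of the deviation field *)

Lemma lip_on_boxes_ext (p r : R -> R -> R) :
  (forall x y, p x y = r x y) -> lip_on_boxes p -> lip_on_boxes r.
Proof.
  intros E H M; destruct (H M) as [C [HC L]]; exists C; split; [exact HC |].
  intros; rewrite <- !E; auto.
Qed.

(** Passes to the operators [dx] and [dy], so that the gradient need not be carried as
    separate data. *)
Lemma C11_canonical (phi p1 p2 : R -> R -> R) :
  C11 phi p1 p2 -> C11 phi (dx phi) (dy phi).
Proof.
  intros [[D1 D2] [H1 H2]].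
  assert (E1 : forall x y, p1 x y = dx phi x y)
    by (intros; symmetry; apply is_derive_unique, D1).
  assert (E2 : forall x y, p2 x y = dy phi x y)
    by (intros; symmetry; apply is_derive_unique, D2).
  split; [split; intros x y |].
  - rewrite <- E1; apply D1.
  - rewrite <- E2; apply D2.
  - split; eapply lip_on_boxes_ext; eauto.
Qed.

(** Inserts the unperturbed field at index [0], whose power of [t] is [1]. *)
Definition coef_seq (base : R -> R -> R) (c : nat -> R -> R -> R) (k : nat) :
  R -> R -> R := match k with O => base | S _ => c k end.

Lemma coef_seq_C11 (base : R -> R -> R) (c : nat -> R -> R -> R) (k : nat) :
  C11 base (dx base) (dy base) -> (forall k, (1 <= k)%nat -> smooth2 (c k)) ->
  C11 (coef_seq base c k) (dx (coef_seq base c k)) (dy (coef_seq base c k)).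
Proof.
  intros Hb Hc; destruct k as [| k]; [exact Hb | apply smooth2_C11, Hc; lia].
Qed.

Lemma sum_coef_seq (q N : nat) (base : R -> R -> R) (c : nat -> R -> R -> R)
    (a : (R -> R -> R) -> R) (t : R) :
  0 < t ->
  sum_n (fun k => tpow q k t * a (coef_seq base c k)) N
  = a base + sum_n_m (fun k => tpow q k t * a (c k)) 1 N.
Proof.
  intros Ht; induction N as [| N IH].
  - rewrite sum_O, sum_n_m_zero by lia; rewrite tpow_0 by exact Ht.
    cbv [zero]; simpl; ring.
  - rewrite sum_Sn, sum_n_Sm, IH by lia; cbv [plus]; simpl; ring.
Qed.

Lemma has_gradient_sum (phi p1 p2 : nat -> R -> R -> R) (N : nat) :
  (forall k, (1 <= k)%nat -> has_gradient (phi k) (p1 k) (p2 k)) ->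
  has_gradient (fun x y => sum_n_m (fun k => phi k x y) 1 N)
    (fun x y => sum_n_m (fun k => p1 k x y) 1 N)
    (fun x y => sum_n_m (fun k => p2 k x y) 1 N).
Proof.
  intros H; induction N as [| N [I1 I2]].
  - split; intros x y; rewrite sum_n_m_zero by lia;
      (eapply is_derive_ext;
        [intros s; symmetry; apply sum_n_m_zero; lia
        | apply (is_derive_const (V := R_NormedModule))]).
  - destruct (H (S N)) as [H1 H2]; [lia |].
    split; intros x y; rewrite sum_n_Sm by lia;
      (eapply is_derive_ext; [intros s; symmetry; apply sum_n_Sm; lia |]).
    + apply (is_derive_plus (V := R_NormedModule)); [apply I1 | apply H1].
    + apply (is_derive_plus (V := R_NormedModule)); [apply I2 | apply H2].
Qed.

Lemma has_gradient_scal (phi p1 p2 : R -> R -> R) (c : R) :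
  has_gradient phi p1 p2 ->
  has_gradient (fun x y => c * phi x y) (fun x y => c * p1 x y) (fun x y => c * p2 x y).
Proof.
  intros [H1 H2]; split; intros x y.
  - apply (is_derive_scal (fun s => phi s y)), H1.
  - apply (is_derive_scal (fun s => phi x s)), H2.
Qed.

Lemma smooth_pos_time_gradient (F : R -> R -> R -> R) (t : R) :
  smooth_pos_time F -> 0 < t ->
  has_gradient (fun x y => F x y t) (fun x y => d1 F x y t) (fun x y => d2 F x y t).
Proof.
  intros H Ht; destruct (H 1%nat) as [_ [D _]].
  split; intros x y; apply Derive_correct, (D x y t Ht).
Qed.

(** The truncation error of [F] has a gradient of order [eps * tpow q N t], because the
    expansion may be differentiated once. *)
Lemma power_law_increment (q N : nat) (F : R -> R -> R -> R) (Fk : nat -> R -> R -> R)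
    (M eps : R) :
  smooth_pos_time F -> (forall k, (1 <= k)%nat -> smooth2 (Fk k)) ->
  power_law q F Fk -> 0 < eps ->
  exists T, 1 <= T /\
  forall t x y u v, T <= t -> Rabs x <= M -> Rabs y <= M -> Rabs u <= 1 -> Rabs v <= 1 ->
    Rabs (incr (fun a b => F a b t) x y u v
          - sum_n_m (fun k => tpow q k t * incr (Fk k) x y u v) 1 N)
      <= eps * tpow q N t * norm1 u v.
Proof.
  intros HF HFk [_ [E1 E2]] Heps.
  destruct (E1 N (M + 1) eps Heps) as [T1 [_ L1]].
  destruct (E2 N (M + 1) eps Heps) as [T2 [_ L2]].
  exists (Rmax 1 (Rmax T1 T2 + 1)); split; [apply Rmax_l |].
  intros t x y u v Ht Hx Hy Hu Hv.
  pose proof (Rmax_l 1 (Rmax T1 T2 + 1)); pose proof (Rmax_r 1 (Rmax T1 T2 + 1)).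
  pose proof (Rmax_l T1 T2); pose proof (Rmax_r T1 T2).
  pose proof (has_gradient_minus _ _ _ _ _ _
    (smooth_pos_time_gradient F t HF ltac:(lra))
    (has_gradient_sum (fun k x y => tpow q k t * Fk k x y) _ _ N
      (fun k Hk => has_gradient_scal _ _ _ (tpow q k t)
         (smooth2_gradient _ (HFk k Hk))))) as Hg.
  replace (incr (fun a b => F a b t) x y u v
          - sum_n_m (fun k => tpow q k t * incr (Fk k) x y u v) 1 N)
    with ((F (x + u) (y + v) t - sum_n_m (fun k => tpow q k t * Fk k (x + u) (y + v)) 1 N)
          - (F x y t - sum_n_m (fun k => tpow q k t * Fk k x y) 1 N)).
  - replace (norm1 u v) with (Rabs (x + u - x) + Rabs (y + v - y))
      by (unfold norm1; do 3 f_equal; ring).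
    apply (abs_increment_2d_le _ _ _ _ _ _ _ _ Hg).
    pose proof (abs_plus_box _ _ _ Hx Hu); pose proof (abs_plus_box _ _ _ Hy Hv).
    intros s w Hs Hw.
    assert (Rabs s <= M + 1) by (eapply between_box; [| | exact Hs]; lra).
    assert (Rabs w <= M + 1) by (eapply between_box; [| | exact Hw]; lra).
    split; [apply L1 | apply L2]; lra.
  - assert (E : sum_n_m (fun k => tpow q k t * Fk k (x + u) (y + v)) 1 N
      = sum_n_m (fun k => tpow q k t * incr (Fk k) x y u v) 1 N
        + sum_n_m (fun k => tpow q k t * Fk k x y) 1 N).
    { rewrite <- (sum_n_m_plus (G := R_AbelianMonoid)); apply sum_n_m_ext.
      intros k; unfold incr; cbv [plus]; simpl; ring. }
    rewrite E; unfold incr; ring.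
Qed.

Lemma sum_incr_shift (q N : nat) (P : nat -> R -> R -> R) (M : R) :
  (0 < q)%nat -> (forall k, (k <= N)%nat -> C11 (P k) (dx (P k)) (dy (P k))) ->
  exists C, 0 <= C /\
  forall t x y x' y' u v, 1 <= t ->
    Rabs x <= M -> Rabs y <= M -> Rabs x' <= M -> Rabs y' <= M ->
    Rabs u <= 1 -> Rabs v <= 1 ->
    Rabs (sum_n (fun k => tpow q k t * incr (P k) x y u v) N
          - sum_n (fun k => tpow q k t * incr (P k) x' y' u v) N)
      <= C * (Rabs (x - x') + Rabs (y - y')) * norm1 u v.
Proof.
  intros Hq; induction N as [| N IH]; intros HP.
  - destruct (C11_increment_shift _ _ _ M (HP 0%nat (le_n _))) as [C [HC L]].
    exists C; split; [exact HC |]; intros t x y x' y' u v Ht Hx Hy Hx' Hy' Hu Hv.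
    rewrite !sum_O, tpow_0, !Rmult_1_l by lra; now apply L.
  - destruct IH as [C1 [HC1 L1]]; [intros k Hk; apply HP; lia |].
    destruct (C11_increment_shift _ _ _ M (HP (S N) (le_n _))) as [C2 [HC2 L2]].
    exists (C1 + C2); split; [lra |]; intros t x y x' y' u v Ht Hx Hy Hx' Hy' Hu Hv.
    rewrite !sum_Sn; change (@plus R_AbelianMonoid) with Rplus.
    specialize (L1 t x y x' y' u v Ht Hx Hy Hx' Hy' Hu Hv).
    specialize (L2 x y x' y' u v Hx Hy Hx' Hy' Hu Hv).
    fold (incr (P (S N)) x y u v) (incr (P (S N)) x' y' u v) (norm1 u v) in L2.
    pose proof (tpow_pos q (S N) t); pose proof (tpow_le_1 q (S N) t Hq Ht).
    assert (E : Rabs (tpow q (S N) t * (incr (P (S N)) x y u v - incr (P (S N)) x' y' u v))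
      <= 1 * (C2 * (Rabs (x - x') + Rabs (y - y')) * norm1 u v))
      by (apply abs_mult_le; [rewrite Rabs_pos_eq; lra | exact L2]).
    match goal with |- Rabs (?a + ?e * ?b - (?c + ?e * ?d)) <= _ =>
      replace (a + e * b - (c + e * d)) with ((a - c) + e * (b - d)) by ring end.
    eapply Rle_trans; [apply Rabs_triang | lra].
Qed.

Lemma expansion_close (q N : nat) (u : R -> R) (c0 eps : R) (c : nat -> R) :
  expansion q u c0 c -> 0 < eps ->
  exists T, 1 <= T /\ forall t, T <= t ->
    Rabs (u t - (c0 + sum_n_m (fun k => tpow q k t * c k) 1 N)) <= eps * tpow q N t.
Proof.
  intros H Heps; specialize (H N); apply is_lim_spec in H.
  destruct (H (mkposreal _ Heps)) as [T HT]; simpl in HT.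
  exists (Rmax 1 (T + 1)); split; [apply Rmax_l |]; intros t Ht.
  pose proof (Rmax_r 1 (T + 1)).
  specialize (HT t ltac:(lra)); rewrite Rminus_0_r in HT.
  pose proof (tpow_pos q N t).
  rewrite Rabs_div, (Rabs_pos_eq (tpow q N t)) in HT by lra.
  apply Rlt_div_l in HT; lra.
Qed.

(** The sum starts at [k = 1], so the derivative is of the order [t^(-1-1/q)], and not
    only [t^(-1)]. *)
Lemma tpow_poly (q N : nat) (c : nat -> R) :
  (0 < q)%nat ->
  exists (D : R -> R) (M : R), 0 <= M /\
  forall t, 1 <= t ->
    is_derive (fun s => sum_n_m (fun k => tpow q k s * c k) 1 N) t (D t) /\
    Rabs (D t) <= M * tpow q (S q) t /\
    Rabs (sum_n_m (fun k => tpow q k t * c k) 1 N) <= M * tpow q 1 t.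
Proof.
  intros Hq; induction N as [| N IH].
  - exists (fun _ => 0), 0; split; [lra |]; intros t Ht.
    split; [| rewrite sum_n_m_zero by lia; cbv [zero]; simpl; rewrite Rabs_R0; lra].
    eapply is_derive_ext; [intros s; symmetry; apply sum_n_m_zero; lia |].
    apply (is_derive_const (V := R_NormedModule)).
  - destruct IH as [D [M [HM IH]]].
    exists (fun t => D t + - (INR (S N) / INR q) * tpow q (S N + q) t * c (S N)),
           (M + (INR (S N) + 1) * Rabs (c (S N))).
    pose proof (pos_INR (S N)); pose proof (Rabs_pos (c (S N))).
    split; [nra |]; intros t Ht; destruct (IH t Ht) as [I1 [I2 I3]].
    pose proof (tpow_pos q 1 t); pose proof (tpow_pos q (S q) t).
    split; [| split].
    + eapply is_derive_ext; [intros s; symmetry; apply sum_n_Sm; lia |].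
      apply (is_derive_plus (V := R_NormedModule)); [exact I1 |].
      apply (is_derive_scal_l (V := R_NormedModule) (tpow q (S N)) t _ (c (S N))), is_derive_tpow; [exact Hq | lra].
    + pose proof (abs_mult_le _ (c (S N)) _ _
        (tpow_derive_bound q (S N) t Hq Ht) (Rle_refl _)).
      eapply Rle_trans; [apply Rabs_triang | nra].
    + rewrite sum_n_Sm by lia; change (@plus R_AbelianMonoid) with Rplus.
      assert (E : Rabs (tpow q (S N) t * c (S N)) <= tpow q 1 t * Rabs (c (S N))).
      { apply abs_mult_le; [| apply Rle_refl].
        rewrite Rabs_pos_eq by (apply Rlt_le, tpow_pos).
        apply tpow_le; [exact Hq | lia | exact Ht]. }
      assert (0 <= INR (S N) * Rabs (c (S N)) * tpow q 1 t)
        by (repeat apply Rmult_le_pos; lra).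
      eapply Rle_trans; [apply Rabs_triang |].
      replace ((M + (INR (S N) + 1) * Rabs (c (S N))) * tpow q 1 t)
        with (M * tpow q 1 t + tpow q 1 t * Rabs (c (S N))
              + INR (S N) * Rabs (c (S N)) * tpow q 1 t) by ring.
      lra.
Qed.

(** Two errors: truncating [F] at [(xs, ys)], and moving the base point of the
    increments from [(xs, ys)] to [(X, Y)].  Both are small relative to [tpow q N t]. *)
Lemma deviation_expansion (q N : nat) (base : R -> R -> R) (F : R -> R -> R -> R)
    (Fk : nat -> R -> R -> R) (xs ys X Y : R -> R) (M : R) :
  (0 < q)%nat ->
  smooth_pos_time F -> (forall k, (1 <= k)%nat -> smooth2 (Fk k)) ->
  power_law q F Fk -> C11 base (dx base) (dy base) ->
  (forall eps, 0 < eps -> exists T, 1 <= T /\ forall t, T <= t ->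
     Rabs (xs t - X t) <= eps * tpow q N t /\ Rabs (ys t - Y t) <= eps * tpow q N t) ->
  (exists T, forall t, T <= t -> Rabs (xs t) <= M /\ Rabs (ys t) <= M /\
                              Rabs (X t) <= M /\ Rabs (Y t) <= M) ->
  forall eps, 0 < eps -> exists T, 1 <= T /\ forall t u v, T <= t ->
    Rabs u <= 1 -> Rabs v <= 1 ->
    Rabs (incr (fun a b => base a b + F a b t) (xs t) (ys t) u v
          - sum_n (fun k => tpow q k t * incr (coef_seq base Fk k) (X t) (Y t) u v) N)
      <= eps * tpow q N t * norm1 u v.
Proof.
  intros Hq HF HFk HP Hbase Hclose [T0 Hbd] eps Heps.
  destruct (power_law_increment q N F Fk M (eps / 2) HF HFk HP) as [T1 [HT1 L1]]; [lra |].
  destruct (sum_incr_shift q N (coef_seq base Fk) M Hq) as [C [HC L2]].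
  { intros [| k] _; [exact Hbase | apply smooth2_C11, HFk; lia]. }
  destruct (Hclose (eps / (4 * (C + 1)))) as [T2 [HT2 L3]].
  { apply Rdiv_lt_0_compat; lra. }
  exists (Rmax T0 (Rmax T1 T2)).
  pose proof (Rmax_l T0 (Rmax T1 T2)); pose proof (Rmax_r T0 (Rmax T1 T2)).
  pose proof (Rmax_l T1 T2); pose proof (Rmax_r T1 T2).
  split; [lra |]; intros t u v Ht Hu Hv.
  destruct (Hbd t) as [B1 [B2 [B3 B4]]]; [lra |].
  specialize (L1 t (xs t) (ys t) u v ltac:(lra) B1 B2 Hu Hv).
  specialize (L2 t (xs t) (ys t) (X t) (Y t) u v ltac:(lra) B1 B2 B3 B4 Hu Hv).
  destruct (L3 t ltac:(lra)) as [L4 L5].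
  rewrite (sum_coef_seq q N base Fk (fun phi => incr phi (xs t) (ys t) u v)) in L2 by lra.
  set (S1 := sum_n_m (fun k => tpow q k t * incr (Fk k) (xs t) (ys t) u v) 1 N) in *.
  set (S2 := sum_n (fun k => tpow q k t * incr (coef_seq base Fk k) (X t) (Y t) u v) N) in *.
  replace (incr (fun a b => base a b + F a b t) (xs t) (ys t) u v - S2)
    with ((incr (fun a b => F a b t) (xs t) (ys t) u v - S1)
          + (incr base (xs t) (ys t) u v + S1 - S2)) by (unfold incr; ring).
  pose proof (tpow_pos q N t); pose proof (norm1_ge_0 u v).
  assert (E : C * (Rabs (xs t - X t) + Rabs (ys t - Y t)) * norm1 u v
              <= eps / 2 * tpow q N t * norm1 u v).
  { apply Rmult_le_compat_r; [assumption |].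
    apply Rle_trans with ((C + 1) * (2 * (eps / (4 * (C + 1)) * tpow q N t))).
    - pose proof (Rabs_pos (xs t - X t)); pose proof (Rabs_pos (ys t - Y t)).
      apply Rmult_le_compat; lra.
    - right; field; lra. }
  eapply Rle_trans; [apply Rabs_triang | lra].
Qed.

(** * Stability and instability from an energy *)

Definition clamp (s : R) : R := Rmax (-1) (Rmin s 1).

Lemma clamp_le_1 (s : R) : Rabs (clamp s) <= 1.
Proof.
  unfold clamp, Rmax, Rmin; apply Rabs_le_between;
    repeat destruct Rle_dec; lra.
Qed.

Lemma clamp_lip (s r : R) : Rabs (clamp s - clamp r) <= 1 * Rabs (s - r).
Proof.
  unfold clamp, Rmax, Rmin; repeat destruct Rle_dec;
    unfold Rabs; repeat destruct Rcase_abs; lra.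
Qed.

Lemma clamp_id (s : R) : Rabs s <= 1 -> clamp s = s.
Proof.
  intros H; apply Rabs_le_between in H.
  unfold clamp; rewrite Rmin_left, Rmax_right; lra.
Qed.

Lemma clamp_le (s : R) : Rabs (clamp s) <= Rabs s.
Proof.
  pose proof (clamp_lip s 0) as H.
  rewrite (clamp_id 0), !Rminus_0_r in H; [lra | rewrite Rabs_R0; lra].
Qed.

Definition deviation_field (f : R -> R -> R -> R) (xs ys : R -> R) (t u v : R) : R :=
  incr (fun a b => f a b t) (xs t) (ys t) u v.

(** Clamping the deviation to [[-1, 1]] keeps the argument of the fields in the box where
    they are Lipschitz, and freezing the time at [tau] for earlier times removes the
    region where they need not be continuous. *)
Lemma clamped_solution (f g : R -> R -> R -> R) (xs ys : R -> R) (tau M L : R) :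
  (forall x y t, tau <= t -> joint_continuous f x y t) ->
  (forall x y t, tau <= t -> joint_continuous g x y t) ->
  (forall t, tau <= t -> continuous xs t) -> (forall t, tau <= t -> continuous ys t) ->
  (forall t, tau <= t -> Rabs (xs t) <= M /\ Rabs (ys t) <= M) ->
  0 <= L ->
  (forall t x y x' y', tau <= t ->
     Rabs x <= M + 1 -> Rabs y <= M + 1 -> Rabs x' <= M + 1 -> Rabs y' <= M + 1 ->
     Rabs (f x y t - f x' y' t) <= L * (Rabs (x - x') + Rabs (y - y')) /\
     Rabs (g x y t - g x' y' t) <= L * (Rabs (x - x') + Rabs (y - y'))) ->
  forall a b, exists u v : R -> R, u tau = a /\ v tau = b /\
  forall t, tau <= t ->
    is_derive u t (deviation_field f xs ys t (clamp (u t)) (clamp (v t))) /\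
    is_derive v t (deviation_field g xs ys t (clamp (u t)) (clamp (v t))).
Proof.
  intros cf cg cx cy Hbd HL Hlip a b.
  pose (p := fun f u v t => deviation_field f xs ys (Rmax t tau) (clamp u) (clamp v)).
  assert (cp : forall f, (forall x y t, tau <= t -> joint_continuous f x y t) ->
    forall u v t, joint_continuous (p f) u v t).
  { clear f g cf cg Hlip; intros f cf u v t.
    set (z := (u, v, t) : R * R * R).
    assert (c1 : continuous (fun w : R * R * R => clamp (fst (fst w))) z).
    { apply (continuous_comp (fun w : R * R * R => fst (fst w)) clamp).
      - apply (continuous_comp fst fst); apply continuous_fst.
      - apply (lipschitz_continuous _ 1), clamp_lip. }
    assert (c2 : continuous (fun w : R * R * R => clamp (snd (fst w))) z).
    { apply (continuous_comp (fun w : R * R * R => snd (fst w)) clamp).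
      - apply (continuous_comp fst snd); [apply continuous_fst | apply continuous_snd].
      - apply (lipschitz_continuous _ 1), clamp_lip. }
    assert (c3 : continuous (fun w : R * R * R => Rmax (snd w) tau) z).
    { apply (continuous_comp snd (fun s => Rmax s tau)); [apply continuous_snd |].
      apply (lipschitz_continuous _ 1), Rmax_lipschitz. }
    assert (c4 : continuous (fun w : R * R * R => xs (Rmax (snd w) tau)) z)
      by (apply (continuous_comp (fun w : R * R * R => Rmax (snd w) tau) xs);
          [exact c3 | apply cx, Rmax_r]).
    assert (c5 : continuous (fun w : R * R * R => ys (Rmax (snd w) tau)) z)
      by (apply (continuous_comp (fun w : R * R * R => Rmax (snd w) tau) ys);
          [exact c3 | apply cy, Rmax_r]).
    unfold joint_continuous, p, deviation_field, incr.
    apply (continuous_minus (V := R_NormedModule)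
      (fun w : R * R * R => f (xs (Rmax (snd w) tau) + clamp (fst (fst w)))
         (ys (Rmax (snd w) tau) + clamp (snd (fst w))) (Rmax (snd w) tau))
      (fun w : R * R * R => f (xs (Rmax (snd w) tau)) (ys (Rmax (snd w) tau))
         (Rmax (snd w) tau))).
    - apply (continuous_along f
        (fun w : R * R * R => xs (Rmax (snd w) tau) + clamp (fst (fst w)))
        (fun w : R * R * R => ys (Rmax (snd w) tau) + clamp (snd (fst w)))
        (fun w : R * R * R => Rmax (snd w) tau)); [apply cf, Rmax_r | | | exact c3].
      + now apply (continuous_plus (V := R_NormedModule)).
      + now apply (continuous_plus (V := R_NormedModule)).
    - apply (continuous_along f (fun w : R * R * R => xs (Rmax (snd w) tau))
        (fun w : R * R * R => ys (Rmax (snd w) tau))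
        (fun w : R * R * R => Rmax (snd w) tau)); [apply cf, Rmax_r | | |]; assumption. }
  assert (box : forall u t, tau <= t -> Rabs (xs t + clamp u) <= M + 1 /\
                                        Rabs (ys t + clamp u) <= M + 1).
  { intros u t Ht; destruct (Hbd t Ht); split; apply abs_plus_box; auto using clamp_le_1. }
  assert (lp : forall f,
    (forall t x y x' y', tau <= t ->
     Rabs x <= M + 1 -> Rabs y <= M + 1 -> Rabs x' <= M + 1 -> Rabs y' <= M + 1 ->
     Rabs (f x y t - f x' y' t) <= L * (Rabs (x - x') + Rabs (y - y'))) ->
    (forall u v u' v' t, Rabs (p f u v t - p f u' v' t)
        <= (L + 1) * (Rabs (u - u') + Rabs (v - v'))) /\
    (forall u v t, Rabs (p f u v t) <= 2 * L)).
  { clear f g cf cg Hlip cp; intros f Hlip; split.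
    - intros u v u' v' t; set (s := Rmax t tau).
      assert (Hs : tau <= s) by apply Rmax_r.
      pose proof (Hlip s (xs s + clamp u) (ys s + clamp v) (xs s + clamp u')
        (ys s + clamp v') Hs (proj1 (box _ s Hs)) (proj2 (box _ s Hs))
        (proj1 (box _ s Hs)) (proj2 (box _ s Hs))) as E.
      unfold p, deviation_field, incr; fold s.
      replace (xs s + clamp u - (xs s + clamp u')) with (clamp u - clamp u') in E by ring.
      replace (ys s + clamp v - (ys s + clamp v')) with (clamp v - clamp v') in E by ring.
      match goal with |- Rabs (?a - ?c - (?b - ?c)) <= _ =>
        replace (a - c - (b - c)) with (a - b) by ring end.
      pose proof (clamp_lip u u'); pose proof (clamp_lip v v').
      pose proof (Rabs_pos (u - u')); pose proof (Rabs_pos (v - v')).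
      eapply Rle_trans; [exact E |]; nra.
    - intros u v t; set (s := Rmax t tau).
      assert (Hs : tau <= s) by apply Rmax_r.
      destruct (Hbd s Hs) as [B1 B2].
      pose proof (Hlip s (xs s + clamp u) (ys s + clamp v) (xs s) (ys s) Hs
        (proj1 (box _ s Hs)) (proj2 (box _ s Hs)) ltac:(lra) ltac:(lra)) as E.
      unfold p, deviation_field, incr; fold s.
      replace (xs s + clamp u - xs s) with (clamp u) in E by ring.
      replace (ys s + clamp v - ys s) with (clamp v) in E by ring.
      pose proof (clamp_le_1 u); pose proof (clamp_le_1 v).
      eapply Rle_trans; [exact E |]; nra. }
  destruct (lp f) as [lf bf]; [intros; now apply Hlip |].
  destruct (lp g) as [lg bg]; [intros; now apply Hlip |].
  destruct (picard_solution (p f) (p g) (L + 1) (2 * L) tau a b ltac:(lra)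
    lf lg bf bg (cp f cf) (cp g cg)) as [u [v [Hu [Hv D]]]].
  exists u, v; split; [exact Hu |]; split; [exact Hv |]; intros t Ht.
  specialize (D t Ht); unfold p in D; rewrite Rmax_left in D by lra; exact D.
Qed.

(** Applied to [u^2 + v^2], which unlike [norm1] is differentiable; the comparison of the
    two costs the factor [2]. *)
Lemma gronwall_norm1 (u v : R -> R) (tau L : R) :
  0 <= L ->
  (forall t, tau <= t -> exists du dv, is_derive u t du /\ is_derive v t dv /\
     Rabs du <= L * norm1 (u t) (v t) /\ Rabs dv <= L * norm1 (u t) (v t)) ->
  forall t, tau <= t ->
    norm1 (u t) (v t) ^ 2 <= 2 * norm1 (u tau) (v tau) ^ 2 * exp (4 * L * (t - tau)).
Proof.
  intros HL H t Ht.
  assert (sq : forall a b, a ^ 2 + b ^ 2 <= norm1 a b ^ 2 <= 2 * (a ^ 2 + b ^ 2)).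
  { intros a b; unfold norm1; rewrite <- (pow2_abs a), <- (pow2_abs b).
    pose proof (Rmult_le_pos _ _ (Rabs_pos a) (Rabs_pos b)).
    pose proof (pow2_ge_0 (Rabs a - Rabs b)); split; nra. }
  pose (Z := fun s => (u s ^ 2 + v s ^ 2) * exp (- (4 * L * (s - tau)))).
  assert (HZ : Z t <= Z tau).
  { apply nonincreasing_of_derive; [exact Ht |]; intros s [Hs _].
    destruct (H s Hs) as [du [dv [Du [Dv [Bu Bv]]]]].
    exists ((2 * (u s * du) + 2 * (v s * dv) - 4 * L * (u s ^ 2 + v s ^ 2))
            * exp (- (4 * L * (s - tau)))); split.
    - assert (eu : Derive u s = du) by (apply is_derive_unique, Du).
      assert (ev : Derive v s = dv) by (apply is_derive_unique, Dv).
      unfold Z, Rminus; auto_derive; [repeat split; eexists; eassumption |].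
      change (fun x => u x) with u; change (fun x => v x) with v.
      rewrite eu, ev; ring.
    - assert (E : Rabs (u s * du) + Rabs (v s * dv) <= L * norm1 (u s) (v s) ^ 2).
      { pose proof (abs_mult_le (u s) du _ _ (Rle_refl _) Bu).
        pose proof (abs_mult_le (v s) dv _ _ (Rle_refl _) Bv).
        replace (L * norm1 (u s) (v s) ^ 2)
          with (Rabs (u s) * (L * norm1 (u s) (v s)) + Rabs (v s) * (L * norm1 (u s) (v s)))
          by (unfold norm1; ring).
        lra. }
      pose proof (Rle_abs (u s * du)); pose proof (Rle_abs (v s * dv)).
      destruct (sq (u s) (v s)) as [_ S2].
      assert (L * norm1 (u s) (v s) ^ 2 <= L * (2 * (u s ^ 2 + v s ^ 2)))
        by (apply Rmult_le_compat_l; assumption).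
      pose proof (exp_pos (- (4 * L * (s - tau)))); nra. }
  unfold Z in HZ; rewrite Rminus_diag, Rmult_0_r, Ropp_0, exp_0, Rmult_1_r, exp_Ropp in HZ.
  pose proof (exp_pos (4 * L * (t - tau))) as He.
  apply Rle_div_l in HZ; [| exact He].
  destruct (sq (u t) (v t)) as [_ S1]; destruct (sq (u tau) (v tau)) as [S2 _].
  nra.
Qed.

Lemma dist2_le_norm1 (a b a' b' : R) : dist2 a b a' b' <= norm1 (a - a') (b - b').
Proof.
  unfold dist2; rewrite <- (sqrt_pow2 (norm1 (a - a') (b - b'))) by apply norm1_ge_0.
  apply sqrt_le_1_alt; unfold norm1.
  rewrite <- (pow2_abs (a - a')), <- (pow2_abs (b - b')).
  pose proof (Rabs_pos (a - a')); pose proof (Rabs_pos (b - b')); nra.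
Qed.

Lemma norm1_le_dist2 (a b a' b' : R) : norm1 (a - a') (b - b') <= 2 * dist2 a b a' b'.
Proof.
  unfold dist2, norm1.
  assert (E : forall z w, Rabs z <= sqrt (z ^ 2 + w ^ 2)).
  { intros z w; rewrite <- (sqrt_pow2 (Rabs z)) by apply Rabs_pos.
    apply sqrt_le_1_alt; rewrite pow2_abs; pose proof (pow2_ge_0 w); lra. }
  pose proof (E (a - a') (b - b')).
  pose proof (E (b - b') (a - a')) as E2; rewrite Rplus_comm in E2; lra.
Qed.

Definition energy_size (K : R -> R -> R -> R) (T rho c1 c2 : R) : Prop :=
  forall t u v, T <= t -> norm1 u v <= rho ->
    c1 * norm1 u v ^ 2 <= K t u v <= c2 * norm1 u v ^ 2.

(** The energy is available only from the time [T] on.  Up to that time Gronwall bounds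
    the growth of the deviation by a constant factor, and [delta] compensates it. *)
Lemma stable_of_lyapunov (f g : R -> R -> R -> R) (t0 : R) (xs ys : R -> R)
    (M L : R) (q : nat) (K : R -> R -> R -> R) (T rho c1 c2 C : R) :
  solution_from f g t0 xs ys ->
  (forall x y t, t0 <= t -> joint_continuous f x y t /\ joint_continuous g x y t) ->
  (forall t, t0 <= t -> Rabs (xs t) <= M /\ Rabs (ys t) <= M) ->
  0 <= L ->
  (forall t x y x' y', t0 <= t ->
     Rabs x <= M + 1 -> Rabs y <= M + 1 -> Rabs x' <= M + 1 -> Rabs y' <= M + 1 ->
     Rabs (f x y t - f x' y' t) <= L * (Rabs (x - x') + Rabs (y - y')) /\
     Rabs (g x y t - g x' y' t) <= L * (Rabs (x - x') + Rabs (y - y'))) ->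
  (0 < q)%nat -> 1 <= T -> 0 < rho <= 1 -> 0 < c1 <= c2 -> 0 <= C ->
  energy_size K T rho c1 c2 ->
  (forall (u v : R -> R) t, T <= t -> norm1 (u t) (v t) <= rho ->
     is_derive u t (deviation_field f xs ys t (u t) (v t)) ->
     is_derive v t (deviation_field g xs ys t (u t) (v t)) ->
     exists d, is_derive (fun s => K s (u s) (v s)) t d /\
       d <= C * tpow q (S q) t * norm1 (u t) (v t) ^ 2) ->
  stable f g t0 xs ys.
Proof.
  intros Hsol Hcont Hbd HL Hlip Hq HT Hrho Hc HC Hsize Hder eps tau Heps Htau.
  set (T2 := Rmax tau T).
  assert (HT2 : tau <= T2 /\ T <= T2) by (split; [apply Rmax_l | apply Rmax_r]).
  set (eta := Rmin eps rho).
  assert (Heta : 0 < eta <= rho /\ eta <= eps).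
  { unfold eta; split; [split |]; [apply Rmin_pos; lra | apply Rmin_r | apply Rmin_l]. }
  (* [G] is the Gronwall factor on [[tau, T2]] and [k] the factor lost afterwards. *)
  set (G := 2 * exp (4 * L * (T2 - tau))).
  set (k := c2 * exp (C / c1 * INR q) / c1).
  assert (HG : 0 < G) by (unfold G; pose proof (exp_pos (4 * L * (T2 - tau))); lra).
  assert (HA : 0 <= C / c1 * INR q)
    by (apply Rmult_le_pos; [apply Rdiv_le_0_compat; lra | apply pos_INR]).
  assert (Hk : 1 <= k).
  { unfold k; apply Rle_div_r; [lra |].
    assert (1 <= exp (C / c1 * INR q)) by (rewrite <- exp_0; now apply exp_le). nra. }
  set (dl := eta / sqrt (5 * G * k)).
  assert (HGk : 0 < 5 * G * k) by (apply Rmult_lt_0_compat; lra).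
  assert (Hs : 0 < sqrt (5 * G * k)) by (now apply sqrt_lt_R0).
  assert (Hdl : 0 < dl) by (apply Rdiv_lt_0_compat; lra).
  assert (Edl : 5 * G * k * dl ^ 2 = eta ^ 2).
  { unfold dl; rewrite <- (pow2_sqrt (5 * G * k)) at 1 by lra; field; lra. }
  exists dl; split; [exact Hdl |]; intros a b Hab.
  destruct (clamped_solution f g xs ys tau M L) with (a := a - xs tau) (b := b - ys tau)
    as [u [v [Hu [Hv D]]]]; try assumption.
  - intros x y t Ht; apply Hcont; lra.
  - intros x y t Ht; apply Hcont; lra.
  - intros t Ht; destruct (Hsol t ltac:(lra)) as [Dx _].
    apply (ex_derive_continuous (V := R_NormedModule)); eexists; exact Dx.
  - intros t Ht; destruct (Hsol t ltac:(lra)) as [_ Dy].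
    apply (ex_derive_continuous (V := R_NormedModule)); eexists; exact Dy.
  - intros t Ht; apply Hbd; lra.
  - intros t x y x' y' Ht; apply Hlip; lra.
  - assert (H0 : norm1 (u tau) (v tau) ^ 2 <= 4 * dl ^ 2).
    { rewrite Hu, Hv; pose proof (norm1_le_dist2 a b (xs tau) (ys tau)).
      pose proof (norm1_ge_0 (a - xs tau) (b - ys tau)).
      replace (4 * dl ^ 2) with ((2 * dl) ^ 2) by ring; apply pow_incr; lra. }
    assert (early : forall t, tau <= t <= T2 ->
              k * norm1 (u t) (v t) ^ 2 < eta ^ 2).
    { intros t Ht.
      assert (E : norm1 (u t) (v t) ^ 2
                  <= 2 * norm1 (u tau) (v tau) ^ 2 * exp (4 * L * (t - tau))).
      { apply gronwall_norm1; [exact HL | | lra].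
        intros s Hs'; destruct (D s Hs') as [Du Dv].
        exists (deviation_field f xs ys s (clamp (u s)) (clamp (v s))),
               (deviation_field g xs ys s (clamp (u s)) (clamp (v s))).
        split; [exact Du |]; split; [exact Dv |].
        destruct (Hbd s ltac:(lra)) as [B1 B2].
        destruct (Hlip s (xs s + clamp (u s)) (ys s + clamp (v s)) (xs s) (ys s)
          ltac:(lra) (abs_plus_box _ _ _ B1 (clamp_le_1 _))
          (abs_plus_box _ _ _ B2 (clamp_le_1 _)) ltac:(lra) ltac:(lra)) as [E1 E2].
        replace (xs s + clamp (u s) - xs s) with (clamp (u s)) in E1, E2 by ring.
        replace (ys s + clamp (v s) - ys s) with (clamp (v s)) in E1, E2 by ring.
        pose proof (clamp_le (u s)); pose proof (clamp_le (v s)).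
        assert (L * (Rabs (clamp (u s)) + Rabs (clamp (v s))) <= L * norm1 (u s) (v s))
          by (apply Rmult_le_compat_l; [exact HL | unfold norm1; lra]).
        unfold deviation_field, incr; lra. }
      assert (X : exp (4 * L * (t - tau)) <= exp (4 * L * (T2 - tau)))
        by (apply exp_le, Rmult_le_compat_l; lra).
      assert (E' : norm1 (u t) (v t) ^ 2 <= G * (4 * dl ^ 2)).
      { eapply Rle_trans; [exact E |].
        pose proof (exp_pos (4 * L * (t - tau))).
        pose proof (pow2_ge_0 (norm1 (u tau) (v tau))).
        unfold G; replace (2 * exp (4 * L * (T2 - tau)) * (4 * dl ^ 2))
          with (2 * (4 * dl ^ 2) * exp (4 * L * (T2 - tau))) by ring.
        apply Rmult_le_compat; lra. }
      assert (0 < G * k * dl ^ 2)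
        by (apply Rmult_lt_0_compat; [apply Rmult_lt_0_compat; lra | now apply pow_lt]).
      apply Rle_lt_trans with (k * (G * (4 * dl ^ 2)));
        [apply Rmult_le_compat_l; lra | lra]. }
    assert (late : forall t, T2 <= t -> norm1 (u t) (v t) < eta).
    { apply (lyapunov_confines q K u v T2 c1 c2 C rho eta); try assumption; try lra.
      - intros t Ht; destruct (D t ltac:(lra)) as [Du Dv]; split;
          apply (ex_derive_continuous (V := R_NormedModule)); eexists; eassumption.
      - intros t Ht Hl; apply Hsize; [lra | exact Hl].
      - intros t Ht Hl; destruct (D t ltac:(lra)) as [Du Dv].
        destruct (abs_le_norm1 (u t) (v t)).
        rewrite !clamp_id in Du, Dv by lra.
        apply Hder; [lra | exact Hl | exact Du | exact Dv].
      - specialize (early T2 ltac:(lra)).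
        replace (c2 * norm1 (u T2) (v T2) ^ 2 * exp (C / c1 * INR q))
          with (c1 * (k * norm1 (u T2) (v T2) ^ 2)) by (unfold k; field; lra).
        apply Rmult_lt_compat_l; lra. }
    assert (all : forall t, tau <= t -> norm1 (u t) (v t) < eta).
    { intros t Ht; destruct (Rle_lt_dec t T2) as [Ht2 | Ht2]; [| apply late; lra].
      specialize (early t (conj Ht Ht2)).
      apply Rnot_le_lt; intros Hle.
      assert (eta ^ 2 <= norm1 (u t) (v t) ^ 2) by (apply pow_incr; lra).
      pose proof (pow2_ge_0 (norm1 (u t) (v t))); nra. }
    exists (fun t => xs t + u t), (fun t => ys t + v t).
    split; [| split; [| split]].
    + intros t Ht; destruct (D t Ht) as [Du Dv].
      destruct (abs_le_norm1 (u t) (v t)); specialize (all t Ht).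
      rewrite !clamp_id in Du, Dv by lra.
      destruct (Hsol t ltac:(lra)) as [Dx Dy]; split.
      * evar_last; [apply (is_derive_plus xs u _ _ _ Dx Du) |].
        unfold deviation_field, incr; cbv [plus]; simpl; ring.
      * evar_last; [apply (is_derive_plus ys v _ _ _ Dy Dv) |].
        unfold deviation_field, incr; cbv [plus]; simpl; ring.
    + rewrite Hu; ring.
    + rewrite Hv; ring.
    + intros t Ht; eapply Rle_lt_trans; [apply dist2_le_norm1 |].
      replace (xs t + u t - xs t) with (u t) by ring.
      replace (ys t + v t - ys t) with (v t) by ring.
      specialize (all t Ht); lra.
Qed.

Lemma unstable_of_lyapunov (f g : R -> R -> R -> R) (t0 : R) (xs ys : R -> R)
    (K : R -> R -> R -> R) (T rho c1 c2 c : R) :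
  solution_from f g t0 xs ys ->
  1 <= T -> 0 < rho -> 0 < c1 -> 0 < c2 -> 0 < c ->
  energy_size K T rho c1 c2 ->
  (forall (u v : R -> R) t, T <= t -> norm1 (u t) (v t) <= rho ->
     is_derive u t (deviation_field f xs ys t (u t) (v t)) ->
     is_derive v t (deviation_field g xs ys t (u t) (v t)) ->
     exists d, is_derive (fun s => K s (u s) (v s)) t d /\
       c / t * norm1 (u t) (v t) ^ 2 <= d) ->
  unstable f g t0 xs ys.
Proof.
  intros Hsol HT Hrho H1 H2 Hc Hsize Hder Hst.
  set (tau := Rmax t0 T).
  assert (Htau : t0 <= tau /\ T <= tau) by (split; [apply Rmax_l | apply Rmax_r]).
  destruct (Hst (rho / 2) tau) as [dl [Hdl Hsol']]; [lra | lra |].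
  destruct (Hsol' (xs tau + dl / 2) (ys tau)) as [x [y [Dxy [Hx [Hy Hd]]]]].
  { unfold dist2.
    replace (xs tau + dl / 2 - xs tau) with (dl / 2) by ring.
    rewrite Rminus_diag; replace ((dl / 2) ^ 2 + 0 ^ 2) with ((dl / 2) ^ 2) by ring.
    rewrite sqrt_pow2; lra. }
  assert (bd : forall t, tau <= t -> norm1 (x t - xs t) (y t - ys t) <= rho).
  { intros t Ht; specialize (Hd t Ht).
    pose proof (norm1_le_dist2 (x t) (y t) (xs t) (ys t)); lra. }
  apply (lyapunov_expels K (fun t => x t - xs t) (fun t => y t - ys t) tau c1 c2 c rho);
    try assumption; try lra.
  - intros t Ht; apply Hsize; [lra | now apply bd].
  - intros t Ht; apply (Hder (fun t => x t - xs t) (fun t => y t - ys t));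
      [lra | now apply bd | |];
      destruct (Dxy t Ht) as [Dx Dy]; destruct (Hsol t ltac:(lra)) as [Ex Ey];
      unfold deviation_field, incr.
    + replace (xs t + (x t - xs t)) with (x t) by ring.
      replace (ys t + (y t - ys t)) with (y t) by ring.
      apply (is_derive_minus x xs _ _ _ Dx Ex).
    + replace (xs t + (x t - xs t)) with (x t) by ring.
      replace (ys t + (y t - ys t)) with (y t) by ring.
      apply (is_derive_minus y ys _ _ _ Dy Ey).
  - rewrite Hx, Hy; unfold norm1.
    replace (xs tau + dl / 2 - xs tau) with (dl / 2) by ring.
    rewrite Rminus_diag, Rabs_R0, Rabs_pos_eq; lra.
Qed.

(** * The unperturbed system and uniform bounds *)

(** For large times the order [0] of the differentiated expansions bounds the gradient by
    [1]; the remaining times form a compact interval. *)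
Lemma smooth_pos_time_lip (q : nat) (F : R -> R -> R -> R) (Fk : nat -> R -> R -> R)
    (M t0 : R) :
  smooth_pos_time F -> power_law q F Fk -> 0 < t0 ->
  exists L, 0 <= L /\
  forall t x y x' y', t0 <= t ->
    Rabs x <= M -> Rabs y <= M -> Rabs x' <= M -> Rabs y' <= M ->
    Rabs (F x y t - F x' y' t) <= L * (Rabs (x - x') + Rabs (y - y')).
Proof.
  intros HF [_ [E1 E2]] Ht0.
  assert (bnd : forall F' Fk', expansion_unif q F' Fk' ->
    (forall x y t, 0 < t -> joint_continuous F' x y t) ->
    exists B, 0 <= B /\ forall t x y, t0 <= t -> Rabs x <= M -> Rabs y <= M ->
      Rabs (F' x y t) <= B).
  { intros F' Fk' E Hc.
    destruct (E 0%nat M 1 Rlt_0_1) as [T [HT L]].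
    destruct (joint_continuous_bounded F' M t0 T) as [B HB].
    { intros x y t _ _ Ht; apply Hc; lra. }
    exists (Rabs B + 1); split; [pose proof (Rabs_pos B); lra |].
    intros t x y Ht Hx Hy; destruct (Rle_lt_dec t T) as [HtT | HtT].
    - specialize (HB x y t Hx Hy (conj Ht HtT)); pose proof (Rle_abs B); lra.
    - specialize (L t x y HtT Hx Hy).
      rewrite sum_n_m_zero, tpow_0 in L by (lia || lra).
      change (@zero R_AbelianMonoid) with 0 in L; rewrite Rminus_0_r in L.
      pose proof (Rabs_pos B); lra. }
  destruct (bnd _ _ E1) as [B1 [HB1 L1]].
  { intros x y t Ht; exact (proj1 (proj1 (proj2 (proj2 (HF 1%nat)))) x y t Ht). }
  destruct (bnd _ _ E2) as [B2 [HB2 L2]].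
  { intros x y t Ht; exact (proj1 (proj1 (proj2 (proj2 (proj2 (HF 1%nat))))) x y t Ht). }
  exists (B1 + B2); split; [lra |]; intros t x y x' y' Ht Hx Hy Hx' Hy'.
  apply (abs_increment_2d_le (fun x y => F x y t) _ _ _ _ _ _ _
    (smooth_pos_time_gradient F t HF ltac:(lra))).
  intros r w Hr Hw.
  assert (Br : Rabs r <= M) by (eapply between_box; [| | exact Hr]; lra).
  assert (Bw : Rabs w <= M) by (eapply between_box; [| | exact Hw]; lra).
  specialize (L1 t r w Ht Br Bw); specialize (L2 t r w Ht Br Bw); split; lra.
Qed.

Lemma expansion_bounded (q : nat) (u : R -> R) (c0 : R) (c : nat -> R) (t0 : R) :
  expansion q u c0 c -> (forall t, t0 <= t -> continuous u t) ->
  exists M, forall t, t0 <= t -> Rabs (u t) <= M.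
Proof.
  intros He Hc.
  destruct (expansion_close q 0 u c0 1 c He Rlt_0_1) as [T [HT L]].
  destruct (bounded_continuity u t0 T) as [B HB].
  { intros t [Ht _]; now apply Hc. }
  exists (Rabs B + Rabs c0 + 1); intros t Ht.
  pose proof (Rabs_pos B); pose proof (Rabs_pos c0); pose proof (Rle_abs B).
  destruct (Rle_lt_dec t T) as [HtT | HtT].
  - specialize (HB t (conj Ht HtT)); change (norm (u t)) with (Rabs (u t)) in HB; lra.
  - specialize (L t ltac:(lra)); rewrite sum_n_m_zero, tpow_0 in L by (lia || lra).
    change (@zero R_AbelianMonoid) with 0 in L; rewrite Rplus_0_r in L.
    replace (u t) with ((u t - c0) + c0) by ring.
    eapply Rle_trans; [apply Rabs_triang | lra].
Qed.

Section Potential.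

Variables (V : R -> R -> R) (w : R -> R) (lambda : R).
Hypothesis HH : smooth3 (Ham V).
Hypothesis HV : forall x lam : R, is_derive (fun u => V u lam) x ((x ^ 2 - lam) * w x).

Lemma d1_Ham (x y lam : R) : d1 (Ham V) x y lam = (x ^ 2 - lam) * w x.
Proof.
  apply is_derive_unique; unfold Ham.
  rewrite <- (Rplus_0_l ((x ^ 2 - lam) * w x)).
  apply (is_derive_plus (fun _ => y ^ 2 / 2) (fun u => V u lam));
    [apply (is_derive_const (V := R_NormedModule)) | apply HV].
Qed.

Lemma d2_Ham (x y lam : R) : d2 (Ham V) x y lam = y.
Proof.
  apply is_derive_unique; unfold Ham; auto_derive; [trivial | field].
Qed.

Definition force (x y : R) : R := - d1 (Ham V) x y lambda.

Lemma force_C11 : C11 force (dx force) (dy force).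
Proof.
  assert (S1 : smooth3 (d1 (Ham V))) by (now apply smooth3_d1).
  destruct (smooth3_slice_C11 _ lambda S1) as [[D1 D2] [L1 L2]].
  eapply C11_canonical; split; [split; intros x y |].
  - apply (is_derive_opp (fun s => d1 (Ham V) s y lambda)), D1.
  - apply (is_derive_opp (fun s => d1 (Ham V) x s lambda)), D2.
  - split; apply lip_on_boxes_opp; assumption.
Qed.

Lemma dy_force (x y : R) : dy force x y = 0.
Proof.
  apply is_derive_unique; apply (is_derive_ext (fun _ => - ((x ^ 2 - lambda) * w x))).
  - intros s; unfold force; now rewrite d1_Ham.
  - apply (is_derive_const (V := R_NormedModule)).
Qed.

Lemma velocity_C11 : C11 (fun _ y : R => y) (dx (fun _ y : R => y)) (dy (fun _ y : R => y)).
Proof.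
  apply (C11_canonical _ (fun _ _ => 0) (fun _ _ => 1)).
  assert (L : forall c, lip_on_boxes (fun _ _ => c)).
  { intros c M; exists 0; split; [lra |]; intros.
    rewrite Rminus_diag, Rabs_R0; lra. }
  split; [split; intros; auto_derive; trivial |]; split; apply L.
Qed.

Lemma dx_velocity (x y : R) : dx (fun _ y : R => y) x y = 0.
Proof. apply is_derive_unique; auto_derive; trivial. Qed.

Lemma dy_velocity (x y : R) : dy (fun _ y : R => y) x y = 1.
Proof. apply is_derive_unique; auto_derive; trivial. Qed.

Lemma Ham_gradient :
  has_gradient (fun x y => Ham V x y lambda) (fun x y => - force x y) (fun _ y => y).
Proof.
  split; intros x y; unfold force, Ham.
  - rewrite d1_Ham, Ropp_involutive, <- (Rplus_0_l ((x ^ 2 - lambda) * w x)).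
    apply (is_derive_plus (fun _ => y ^ 2 / 2) (fun u => V u lambda));
      [apply (is_derive_const (V := R_NormedModule)) | apply HV].
  - auto_derive; [trivial | field].
Qed.

(** At [lambda = -1] the factor [x ^ 2 - lambda] has no zero, so [w] is the
    quotient of two differentiable functions. *)
Lemma w_ex_derive (x : R) : ex_derive w x.
Proof.
  assert (S1 : smooth3 (d1 (Ham V))) by (now apply smooth3_d1).
  destruct (smooth3_slice_C11 _ (-1) S1) as [[D1 _] _].
  assert (E : forall s, d1 (Ham V) s 0 (-1) / (s ^ 2 + 1) = w s)
    by (intros s; rewrite d1_Ham; field; nra).
  apply (ex_derive_ext (fun s => d1 (Ham V) s 0 (-1) / (s ^ 2 + 1))).
  - exact E.
  - apply (ex_derive_div (fun s => d1 (Ham V) s 0 (-1)) (fun s => s ^ 2 + 1));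
      [eexists; apply D1 | auto_derive; trivial | nra].
Qed.

Lemma dx_force (y : R) :
  0 < lambda -> dx force (sqrt lambda) y = - (2 * sqrt lambda * w (sqrt lambda)).
Proof.
  intros Hl; apply is_derive_unique.
  apply (is_derive_ext (fun x => - ((x ^ 2 - lambda) * w x))).
  - intros s; unfold force; now rewrite d1_Ham.
  - destruct (w_ex_derive (sqrt lambda)) as [w' Hw'].
    evar_last.
    + apply (is_derive_opp (fun x => (x ^ 2 - lambda) * w x)).
      apply (is_derive_mult (fun x => x ^ 2 - lambda) w);
        [| exact Hw' | exact Rmult_comm].
      auto_derive; [trivial | reflexivity].
    + cbv [plus mult opp]; simpl; pose proof (sqrt_sqrt lambda); nra.
Qed.

End Potential.

(** * Stability of the given solution *)

Lemma quadratic_form_bounds (omega2 u v : R) :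
  0 < omega2 ->
  Rmin 1 omega2 / 2 * norm1 u v ^ 2 <= omega2 * u ^ 2 + v ^ 2
    <= (1 + omega2) * norm1 u v ^ 2.
Proof.
  intros Ho; unfold norm1; rewrite <- (pow2_abs u), <- (pow2_abs v).
  pose proof (Rmin_l 1 omega2); pose proof (Rmin_r 1 omega2).
  assert (0 < Rmin 1 omega2) by (apply Rmin_pos; lra).
  pose proof (Rabs_pos u); pose proof (Rabs_pos v).
  set (a := Rabs u) in *; set (b := Rabs v) in *; set (k := Rmin 1 omega2) in *.
  pose proof (Rmult_le_pos a b ltac:(assumption) ltac:(assumption)).
  pose proof (pow2_ge_0 (a - b)); pose proof (pow2_ge_0 a); pose proof (pow2_ge_0 b).
  assert (k * a ^ 2 <= omega2 * a ^ 2) by (apply Rmult_le_compat_r; lra).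
  assert (k * b ^ 2 <= 1 * b ^ 2) by (apply Rmult_le_compat_r; lra).
  assert (0 <= k * (a - b) ^ 2) by (apply Rmult_le_pos; lra).
  assert (0 <= omega2 * (a * b)) by (apply Rmult_le_pos; lra).
  assert (0 <= omega2 * b ^ 2) by (apply Rmult_le_pos; lra).
  split; nra.
Qed.

(** Chooses the radius [rho], which also serves as relative error of the field, and the
    time [T] so small and so late that the errors in [energy_leading] and
    [energy_derive] are absorbed by the main terms. *)
Lemma energy_estimates (q p : nat) (P Q H : nat -> R -> R -> R) (X Y dX dY : R -> R)
    (M sigma omega2 : R) (f g : R -> R -> R -> R) (xs ys : R -> R) :
  (0 < q)%nat ->
  (forall k, (k <= S p)%nat -> C11 (P k) (dx (P k)) (dy (P k))) ->
  (forall k, (k <= S p)%nat -> C11 (Q k) (dx (Q k)) (dy (Q k))) ->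
  (forall k, (k <= p)%nat -> forall x y, dx (P k) x y = - dy (Q k) x y) ->
  (forall k, (k <= p)%nat -> has_gradient (H k) (fun x y => - Q k x y) (P k)) ->
  (forall t, 1 <= t -> is_derive X t (dX t) /\ is_derive Y t (dY t)) ->
  (forall t, 1 <= t ->
     Rabs (dX t) <= M * tpow q (S q) t /\ Rabs (dY t) <= M * tpow q (S q) t) ->
  (forall t, 1 <= t -> Rabs (X t) <= M /\ Rabs (Y t) <= M) ->
  (forall t, 1 <= t ->
     Rabs (X t - sigma) <= M * tpow q 1 t /\ Rabs (Y t) <= M * tpow q 1 t) ->
  Rabs sigma <= M ->
  dx (P 0%nat) sigma 0 = 0 /\ dy (P 0%nat) sigma 0 = 1 ->
  dx (Q 0%nat) sigma 0 = - omega2 /\ dy (Q 0%nat) sigma 0 = 0 ->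
  0 < omega2 ->
  (forall eps, 0 < eps -> exists T, 1 <= T /\ forall t u v, T <= t ->
     Rabs u <= 1 -> Rabs v <= 1 ->
     Rabs (deviation_field f xs ys t u v
           - sum_n (fun k => tpow q k t * incr (P k) (X t) (Y t) u v) (S p))
       <= eps * tpow q (S p) t * norm1 u v) ->
  (forall eps, 0 < eps -> exists T, 1 <= T /\ forall t u v, T <= t ->
     Rabs u <= 1 -> Rabs v <= 1 ->
     Rabs (deviation_field g xs ys t u v
           - sum_n (fun k => tpow q k t * incr (Q k) (X t) (Y t) u v) (S p))
       <= eps * tpow q (S p) t * norm1 u v) ->
  let gam := dx (P (S p)) sigma 0 + dy (Q (S p)) sigma 0 in
  gam <> 0 ->
  exists K T rho c1 c2 C c,
    1 <= T /\ 0 < rho <= 1 /\ 0 < c1 <= c2 /\ 0 <= C /\ 0 < c /\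
    energy_size K T rho c1 c2 /\
    forall (u v : R -> R) t, T <= t -> norm1 (u t) (v t) <= rho ->
      is_derive u t (deviation_field f xs ys t (u t) (v t)) ->
      is_derive v t (deviation_field g xs ys t (u t) (v t)) ->
      exists d, is_derive (fun s => K s (u s) (v s)) t d /\
        (gam < 0 -> d <= C * tpow q (S q) t * norm1 (u t) (v t) ^ 2) /\
        (0 < gam ->
           (c * tpow q (S p) t - C * tpow q (S q) t) * norm1 (u t) (v t) ^ 2 <= d).
Proof.
  intros Hq HP HQ Hdiv HH HXY HdXY HB HL Hs Hc1 Hc2 Hom Ef Eg gam Hgam.
  destruct (energy_leading q p P Q H X Y M sigma omega2) as [C1 [HC1 L1]]; try assumption.
  destruct (energy_derive q p P Q H X Y dX dY M sigma omega2) as [C2 [HC2 L2]];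
    try assumption.
  set (k := Rmin 1 omega2); set (G := Rabs gam).
  assert (Hk : 0 < k) by (apply Rmin_pos; lra).
  assert (HG : 0 < G) by (now apply Rabs_pos_lt).
  (* The sum of the two small quantities in [L1] is at most [2 r1], and that of the three
     in [L2] at most [3 r2]; the main terms are [k / 4] and [G k / 4]. *)
  set (r1 := k / (16 * (C1 + 1))); set (r2 := G * k / (48 * (C2 + 1))).
  assert (Hr1 : 0 < r1) by (apply Rdiv_lt_0_compat; lra).
  assert (HGk : 0 < G * k) by (now apply Rmult_lt_0_compat).
  assert (Hr2 : 0 < r2) by (apply Rdiv_lt_0_compat; lra).
  set (rho := Rmin 1 (Rmin r1 r2)).
  assert (Hrho : 0 < rho <= 1 /\ rho <= r1 /\ rho <= r2).
  { unfold rho; pose proof (Rmin_l 1 (Rmin r1 r2)); pose proof (Rmin_r 1 (Rmin r1 r2)).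
    pose proof (Rmin_l r1 r2); pose proof (Rmin_r r1 r2).
    repeat split; try lra; repeat apply Rmin_pos; lra. }
  destruct (tpow_small q 1 rho Hq) as [T1 [HT1 S1]]; [lia | lra |].
  destruct (Ef rho) as [T2 [HT2 S2]]; [lra |].
  destruct (Eg rho) as [T3 [HT3 S3]]; [lra |].
  set (T := Rmax T1 (Rmax T2 T3)).
  assert (HT : T1 <= T /\ T2 <= T /\ T3 <= T).
  { unfold T; pose proof (Rmax_l T1 (Rmax T2 T3)); pose proof (Rmax_r T1 (Rmax T2 T3)).
    pose proof (Rmax_l T2 T3); pose proof (Rmax_r T2 T3); lra. }
  assert (adm : forall t u v, T <= t -> norm1 u v <= rho -> admissible t u v).
  { intros t u v Ht Hl; destruct (abs_le_norm1 u v); repeat split; lra. }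
  exists (energy q p P Q H X Y sigma omega2), T, rho, (k / 8), (1 + omega2 + k / 8),
    C2, (G * k / 8).
  split; [lra |]; split; [lra |]; split; [lra |]; split; [exact HC2 |]; split; [lra |].
  split.
  - intros t u v Ht Hl.
    specialize (L1 t u v (adm t u v Ht Hl)).
    destruct (quadratic_form_bounds omega2 u v Hom) as [F1 F2]; fold k in F1.
    specialize (S1 t ltac:(lra)).
    pose proof (norm1_ge_0 u v); pose proof (pow2_ge_0 (norm1 u v)).
    pose proof (tpow_pos q 1 t).
    assert (E : C1 * (tpow q 1 t + norm1 u v) * norm1 u v ^ 2 <= k / 8 * norm1 u v ^ 2).
    { apply Rmult_le_compat_r; [assumption |].
      apply Rle_trans with ((C1 + 1) * (2 * r1)); [apply Rmult_le_compat; lra |].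
      right; unfold r1; field; lra. }
    apply Rabs_le_between in L1; split; nra.
  - intros u v t Ht Hl Du Dv.
    set (l := norm1 (u t) (v t)) in *.
    pose proof (adm t (u t) (v t) Ht Hl) as Ha.
    assert (Hu : Rabs (u t) <= 1) by apply Ha; assert (Hv : Rabs (v t) <= 1) by apply Ha.
    destruct (L2 u v t _ _ rho Du Dv Ha ltac:(lra)
      (S2 t (u t) (v t) ltac:(lra) Hu Hv) (S3 t (u t) (v t) ltac:(lra) Hu Hv))
      as [d [Hd Bd]].
    exists d; split; [exact Hd |].
    specialize (S1 t ltac:(lra)).
    destruct (quadratic_form_bounds omega2 (u t) (v t) Hom) as [F1 F2]; fold k l in F1.
    fold l in Bd; fold gam in Bd.
    set (W := omega2 * u t ^ 2 + v t ^ 2) in *.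
    set (e := tpow q (S p) t) in *; set (a := tpow q (S q) t) in *.
    assert (He : 0 < e) by apply tpow_pos.
    assert (Hl0 : 0 <= l) by apply norm1_ge_0.
    pose proof (pow2_ge_0 l); pose proof (tpow_pos q 1 t).
    assert (E : C2 * (e * (rho + tpow q 1 t + l) + a) * l ^ 2
                <= (e * (G * k / 16) + C2 * a) * l ^ 2).
    { apply Rmult_le_compat_r; [assumption |].
      assert (C2 * (rho + tpow q 1 t + l) <= G * k / 16).
      { apply Rle_trans with ((C2 + 1) * (3 * r2)); [apply Rmult_le_compat; lra |].
        right; unfold r2; field; lra. }
      nra. }
    assert (F3 : e * (G / 2 * (k / 2 * l ^ 2)) <= e * (G / 2 * W)).
    { apply Rmult_le_compat_l; [lra |]; apply Rmult_le_compat_l; lra. }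
    assert (F4 : 0 <= e * (G * k * l ^ 2))
      by (apply Rmult_le_pos; [lra |]; apply Rmult_le_pos; lra).
    apply Rabs_le_between in Bd.
    split; intros Hg.
    + assert (EG : gam = - G) by (unfold G; rewrite Rabs_left; lra).
      rewrite EG in Bd; lra.
    + assert (EG : gam = G) by (unfold G; rewrite Rabs_pos_eq; lra).
      rewrite EG in Bd; lra.
Qed.

Lemma joint_continuous_plus_frozen (a F : R -> R -> R -> R) (lam x y t : R) :
  (forall x y s, joint_continuous a x y s) -> joint_continuous F x y t ->
  joint_continuous (fun x y t => a x y lam + F x y t) x y t.
Proof.
  intros Ha HF.
  apply (continuous_plus (V := R_NormedModule)
    (fun p : R * R * R => a (fst (fst p)) (snd (fst p)) lam)); [| exact HF].
  apply (continuous_along a (fun p : R * R * R => fst (fst p))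
    (fun p : R * R * R => snd (fst p)) (fun _ => lam)); [apply Ha | | |].
  - apply (continuous_comp fst fst); apply continuous_fst.
  - apply (continuous_comp fst snd); [apply continuous_fst | apply continuous_snd].
  - apply continuous_const.
Qed.

Theorem theorem7
  (V : R -> R -> R) (w : R -> R) (d0 : R)
  (F G : R -> R -> R -> R) (q : nat) (Fk Gk : nat -> R -> R -> R)
  (HH : smooth3 (Ham V))
  (HF : smooth_pos_time F) (HG : smooth_pos_time G)
  (HV : forall x lam : R, is_derive (fun u => V u lam) x ((x ^ 2 - lam) * w x))
  (Hd0 : 0 < d0)
  (Hw : forall x lam : R,
      (0 <= lam /\ Rabs x < sqrt lam + d0) \/ (lam < 0 /\ Rabs x < d0) ->
      0 < w x)
  (HF0 : vanishes_at_infinity F) (HG0 : vanishes_at_infinity G)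
  (Hq : (0 < q)%nat)
  (HFk : forall k : nat, (1 <= k)%nat -> smooth2 (Fk k))
  (HGk : forall k : nat, (1 <= k)%nat -> smooth2 (Gk k))
  (HFexp : power_law q F Fk) (HGexp : power_law q G Gk)
  (lambda : R) (Hlambda : 0 < lambda)
  (n h : nat) (Hn : (1 <= n <= q)%nat)
  (HFn : forall i : nat, (1 <= i < n)%nat -> forall x y : R, Fk i x y = 0)
  (HGn : forall i : nat, (1 <= i < n)%nat -> forall x y : R, Gk i x y = 0)
  (Hdiv : forall k : nat, (1 <= k < n + h)%nat ->
      forall x y : R, dx (Fk k) x y = - dy (Gk k) x y)
  (t0 : R) (Ht0 : 0 < t0) (xs ys : R -> R)
  (Hsol : solution_from (rhs_x V lambda F) (rhs_y V lambda G) t0 xs ys)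
  (xk yk : nat -> R)
  (Hxs : expansion q xs (sqrt lambda) xk) (Hys : expansion q ys 0 yk) :
  (gamma_coef Fk Gk (n + h) lambda < 0 ->
     stable (rhs_x V lambda F) (rhs_y V lambda G) t0 xs ys) /\
  (* The bound n + h <= q is needed here: for w = 1, q = n = h = 1, F = 0 and
     G = t^(-2) y one has gamma_2 = 1 > 0, but the equilibrium is stable. *)
  ((n + h <= q)%nat -> 0 < gamma_coef Fk Gk (n + h) lambda ->
     unstable (rhs_x V lambda F) (rhs_y V lambda G) t0 xs ys).
Proof.
  destruct (n + h)%nat as [| p] eqn:Hm; [lia |].
  set (f := rhs_x V lambda F); set (g := rhs_y V lambda G).
  set (vel := fun _ y : R => y); set (frc := force V lambda).
  pose proof velocity_C11 as velC; fold vel in velC.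
  pose proof (force_C11 V lambda HH) as frcC; fold frc in frcC.
  assert (Ef : forall x y t, vel x y + F x y t = f x y t)
    by (intros; unfold f, rhs_x; now rewrite d2_Ham).
  assert (Eg : forall x y t, frc x y + G x y t = g x y t) by reflexivity.
  set (P := coef_seq vel Fk); set (Q := coef_seq frc Gk).
  assert (CP : forall k, C11 (P k) (dx (P k)) (dy (P k)))
    by (intros k; now apply coef_seq_C11).
  assert (CQ : forall k, C11 (Q k) (dx (Q k)) (dy (Q k)))
    by (intros k; now apply coef_seq_C11).
  assert (Hdiv' : forall k, (k <= p)%nat -> forall x y, dx (P k) x y = - dy (Q k) x y).
  { intros [| k] Hk x y.
    - change (dx vel x y = - dy frc x y).
      unfold vel, frc; rewrite dx_velocity, (dy_force V w lambda HV); ring.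
    - apply Hdiv; lia. }
  assert (exH : forall k, exists H, (k <= p)%nat ->
    has_gradient H (fun x y => - Q k x y) (P k)).
  { intros k; destruct (Nat.le_gt_cases k p) as [Hk | Hk]; [| exists (fun _ _ => 0); lia].
    destruct k as [| k].
    - exists (fun x y => Ham V x y lambda); intros _; apply (Ham_gradient V w lambda HV).
    - destruct (stream_function (Fk (S k)) (Gk (S k))) as [H HgH];
        [apply HFk; lia | apply HGk; lia | apply Hdiv; lia |].
      now exists H. }
  set (H := fun k => proj1_sig (constructive_indefinite_description _ (exH k))).
  assert (HgH : forall k, (k <= p)%nat -> has_gradient (H k) (fun x y => - Q k x y) (P k))
    by (intros k; exact (proj2_sig (constructive_indefinite_description _ (exH k)))).
  assert (cxs : forall t, t0 <= t -> continuous xs t)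
    by (intros t Ht; destruct (Hsol t Ht) as [Dx _];
        apply (ex_derive_continuous (V := R_NormedModule)); eexists; exact Dx).
  assert (cys : forall t, t0 <= t -> continuous ys t)
    by (intros t Ht; destruct (Hsol t Ht) as [_ Dy];
        apply (ex_derive_continuous (V := R_NormedModule)); eexists; exact Dy).
  destruct (expansion_bounded q xs _ xk t0 Hxs cxs) as [M1 BM1].
  destruct (expansion_bounded q ys _ yk t0 Hys cys) as [M2 BM2].
  destruct (tpow_poly q (S p) xk Hq) as [dX [M3 [HM3 PX]]].
  destruct (tpow_poly q (S p) yk Hq) as [dY [M4 [HM4 PY]]].
  set (sigma := sqrt lambda) in *.
  set (X := fun t => sigma + sum_n_m (fun k => tpow q k t * xk k) 1 (S p)).
  set (Y := fun t => 0 + sum_n_m (fun k => tpow q k t * yk k) 1 (S p)).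
  assert (Hsig : 0 < sigma) by (now apply sqrt_lt_R0).
  set (M := Rabs M1 + Rabs M2 + M3 + M4 + sigma).
  pose proof (Rabs_pos M1); pose proof (Rabs_pos M2).
  pose proof (Rle_abs M1); pose proof (Rle_abs M2).
  assert (BX : forall t, 1 <= t -> Rabs (X t - sigma) <= M3 * tpow q 1 t).
  { intros t Ht; destruct (PX t Ht) as [_ [_ E]]; unfold X.
    rewrite Rplus_minus_l; exact E. }
  assert (BY : forall t, 1 <= t -> Rabs (Y t) <= M4 * tpow q 1 t).
  { intros t Ht; destruct (PY t Ht) as [_ [_ E]]; unfold Y; rewrite Rplus_0_l; exact E. }
  assert (Bbase : forall t, 1 <= t -> Rabs (X t) <= M /\ Rabs (Y t) <= M).
  { intros t Ht; specialize (BX t Ht); specialize (BY t Ht).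
    pose proof (tpow_le_1 q 1 t Hq Ht); pose proof (tpow_pos q 1 t).
    assert (M3 * tpow q 1 t <= M3)
      by (rewrite <- (Rmult_1_r M3) at 2; apply Rmult_le_compat_l; lra).
    assert (M4 * tpow q 1 t <= M4)
      by (rewrite <- (Rmult_1_r M4) at 2; apply Rmult_le_compat_l; lra).
    split; [| unfold M; lra].
    replace (X t) with ((X t - sigma) + sigma) by ring.
    eapply Rle_trans; [apply Rabs_triang |]; rewrite (Rabs_pos_eq sigma) by lra.
    unfold M; lra. }
  assert (close : forall eps, 0 < eps -> exists T, 1 <= T /\ forall t, T <= t ->
     Rabs (xs t - X t) <= eps * tpow q (S p) t /\ Rabs (ys t - Y t) <= eps * tpow q (S p) t).
  { intros eps Heps.
    destruct (expansion_close q (S p) xs _ eps xk Hxs Heps) as [T1 [HT1 L1]].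
    destruct (expansion_close q (S p) ys _ eps yk Hys Heps) as [T2 [HT2 L2]].
    exists (Rmax T1 T2); pose proof (Rmax_l T1 T2); pose proof (Rmax_r T1 T2).
    split; [lra |]; intros t Ht; split; [apply L1 | apply L2]; lra. }
  assert (Bsol : forall t, t0 <= t -> Rabs (xs t) <= M /\ Rabs (ys t) <= M)
    by (intros t Ht; specialize (BM1 t Ht); specialize (BM2 t Ht); unfold M; lra).
  assert (bounded : exists T, forall t, T <= t ->
    Rabs (xs t) <= M /\ Rabs (ys t) <= M /\ Rabs (X t) <= M /\ Rabs (Y t) <= M).
  { exists (Rmax 1 t0); intros t Ht; pose proof (Rmax_l 1 t0); pose proof (Rmax_r 1 t0).
    destruct (Bsol t ltac:(lra)); destruct (Bbase t ltac:(lra)); auto. }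
  assert (devf := deviation_expansion q (S p) vel F Fk xs ys X Y M
    Hq HF HFk HFexp velC close bounded).
  assert (devg := deviation_expansion q (S p) frc G Gk xs ys X Y M
    Hq HG HGk HGexp frcC close bounded).
  assert (Hw0 : 0 < 2 * sigma * w sigma).
  { apply Rmult_lt_0_compat; [lra |]; apply (Hw sigma lambda); left; split; [lra |].
    fold sigma; rewrite Rabs_pos_eq; lra. }
  assert (DXY : forall t, 1 <= t -> is_derive X t (dX t) /\ is_derive Y t (dY t)).
  { intros t Ht; destruct (PX t Ht) as [DX _]; destruct (PY t Ht) as [DY _].
    unfold X, Y; split; [rewrite <- (Rplus_0_l (dX t)) | rewrite <- (Rplus_0_l (dY t))].
    - apply (is_derive_plus (V := R_NormedModule) (fun _ => sigma));
        [apply (is_derive_const (V := R_NormedModule)) | exact DX].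
    - apply (is_derive_plus (V := R_NormedModule) (fun _ => 0));
        [apply (is_derive_const (V := R_NormedModule)) | exact DY]. }
  assert (BdXY : forall t, 1 <= t ->
    Rabs (dX t) <= M * tpow q (S q) t /\ Rabs (dY t) <= M * tpow q (S q) t).
  { intros t Ht; destruct (PX t Ht) as [_ [DX _]]; destruct (PY t Ht) as [_ [DY _]].
    pose proof (tpow_pos q (S q) t).
    split; (eapply Rle_trans; [eassumption |]);
      apply Rmult_le_compat_r; unfold M; lra. }
  assert (LXY : forall t, 1 <= t ->
    Rabs (X t - sigma) <= M * tpow q 1 t /\ Rabs (Y t) <= M * tpow q 1 t).
  { intros t Ht; pose proof (tpow_pos q 1 t); specialize (BX t Ht); specialize (BY t Ht).
    split; (eapply Rle_trans; [eassumption |]);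
      apply Rmult_le_compat_r; unfold M; lra. }
  assert (Msig : Rabs sigma <= M) by (rewrite Rabs_pos_eq; unfold M; lra).
  assert (cenP : dx (P 0%nat) sigma 0 = 0 /\ dy (P 0%nat) sigma 0 = 1)
    by (split; [apply dx_velocity | apply dy_velocity]).
  assert (cenQ : dx (Q 0%nat) sigma 0 = - (2 * sigma * w sigma) /\ dy (Q 0%nat) sigma 0 = 0)
    by (split; [now apply dx_force | now apply (dy_force V w)]).
  assert (devP : forall eps, 0 < eps -> exists T, 1 <= T /\ forall t u v, T <= t ->
     Rabs u <= 1 -> Rabs v <= 1 ->
     Rabs (deviation_field f xs ys t u v
           - sum_n (fun k => tpow q k t * incr (P k) (X t) (Y t) u v) (S p))
       <= eps * tpow q (S p) t * norm1 u v).
  { intros eps Heps; destruct (devf eps Heps) as [T [HT L]].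
    exists T; split; [exact HT |]; intros t u v Ht Hu Hv.
    specialize (L t u v Ht Hu Hv); unfold incr at 1 in L; rewrite !Ef in L; exact L. }
  assert (devQ : forall eps, 0 < eps -> exists T, 1 <= T /\ forall t u v, T <= t ->
     Rabs u <= 1 -> Rabs v <= 1 ->
     Rabs (deviation_field g xs ys t u v
           - sum_n (fun k => tpow q k t * incr (Q k) (X t) (Y t) u v) (S p))
       <= eps * tpow q (S p) t * norm1 u v) by exact devg.
  assert (est := energy_estimates q p P Q H X Y dX dY M sigma (2 * sigma * w sigma) f g xs ys
    Hq (fun k _ => CP k) (fun k _ => CQ k) Hdiv' HgH DXY BdXY Bbase LXY Msig cenP cenQ Hw0
    devP devQ).
  cbv zeta in est.
  change (dx (P (S p)) sigma 0 + dy (Q (S p)) sigma 0)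
    with (gamma_coef Fk Gk (S p) lambda) in est.
  set (gam := gamma_coef Fk Gk (S p) lambda) in *.
  clear devf devg devP devQ.
  split.
  - intros Hgam.
    destruct est as [K [T [rho [c1 [c2 [C [c [HT [Hrho [Hc12 [HC [Hc [Hsize Hder]]]]]]]]]]]]];
      [lra |].
    destruct (smooth_pos_time_lip q F Fk (M + 1) t0 HF HFexp Ht0) as [L1 [HL1 E1]].
    destruct (smooth_pos_time_lip q G Gk (M + 1) t0 HG HGexp Ht0) as [L2 [HL2 E2]].
    destruct (C11_lip _ _ _ frcC (M + 1)) as [L3 [HL3 E3]].
    apply (stable_of_lyapunov f g t0 xs ys M (1 + L1 + L2 + L3) q K T rho c1 c2 C);
      try assumption.
    + intros x y t Ht; split.
      * apply (joint_continuous_plus_frozen (d2 (Ham V))).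
        -- intros; now apply smooth3_joint_continuous, smooth3_d2.
        -- apply (HF 0%nat); lra.
      * apply (joint_continuous_plus_frozen (fun x y s => - d1 (Ham V) x y s)).
        -- intros x' y' s; apply (continuous_opp (V := R_NormedModule)
             (fun p : R * R * R => d1 (Ham V) (fst (fst p)) (snd (fst p)) (snd p))).
           now apply smooth3_joint_continuous, smooth3_d1.
        -- apply (HG 0%nat); lra.
    + lra.
    + intros t x y x' y' Ht Hx Hy Hx' Hy'.
      specialize (E1 t x y x' y' Ht Hx Hy Hx' Hy').
      specialize (E2 t x y x' y' Ht Hx Hy Hx' Hy').
      specialize (E3 x y x' y' Hx Hy Hx' Hy').
      rewrite <- !Ef, <- !Eg; unfold vel.
      pose proof (Rabs_pos (x - x')); pose proof (Rabs_pos (y - y')).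
      set (D := Rabs (x - x') + Rabs (y - y')) in *.
      assert (0 <= D) by (unfold D; lra); assert (Rabs (y - y') <= D) by (unfold D; lra).
      split.
      * replace (y + F x y t - (y' + F x' y' t))
          with ((y - y') + (F x y t - F x' y' t)) by ring.
        eapply Rle_trans; [apply Rabs_triang | nra].
      * replace (frc x y + G x y t - (frc x' y' + G x' y' t))
          with ((frc x y - frc x' y') + (G x y t - G x' y' t)) by ring.
        eapply Rle_trans; [apply Rabs_triang | nra].
    + intros u v t Ht Hl Du Dv.
      destruct (Hder u v t Ht Hl Du Dv) as [d [Hd [Hd' _]]].
      exists d; split; [exact Hd | now apply Hd'].
  - intros Hmq Hgam.
    destruct est as [K [T [rho [c1 [c2 [C [c [HT [Hrho [Hc12 [HC [Hc [Hsize Hder]]]]]]]]]]]]];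
      [lra |].
    destruct (tpow_small q 1 (c / (2 * (C + 1))) Hq) as [T' [HT' small]];
      [lia | apply Rdiv_lt_0_compat; lra |].
    pose proof (Rmax_l T T'); pose proof (Rmax_r T T').
    apply (unstable_of_lyapunov f g t0 xs ys K (Rmax T T') rho c1 c2 (c / 2));
      try assumption; try lra.
    + intros t u v Ht; apply Hsize; lra.
    + intros u v t Ht Hl Du Dv.
      destruct (Hder u v t ltac:(lra) Hl Du Dv) as [d [Hd [_ Hd']]].
      exists d; split; [exact Hd |].
      eapply Rle_trans; [| now apply Hd'].
      apply Rmult_le_compat_r; [apply pow2_ge_0 |].
      assert (Ht1 : 1 <= t) by lra.
      (* Both facts rest on [n + h <= q]. *)
      assert (Z1 : tpow q (S q) t <= tpow q 1 t * tpow q (S p) t).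
      { rewrite <- tpow_add; apply tpow_le; [exact Hq | lia | exact Ht1]. }
      assert (Z2 : / t <= tpow q (S p) t).
      { rewrite <- (tpow_q q t Hq) by lra; now apply tpow_le. }
      specialize (small t ltac:(lra)).
      pose proof (tpow_pos q (S p) t); pose proof (tpow_pos q (S q) t).
      assert (Z3 : C * tpow q 1 t <= c / 2).
      { apply Rle_trans with ((C + 1) * (c / (2 * (C + 1)))).
        - apply Rmult_le_compat; [lra | apply Rlt_le, tpow_pos | lra | exact small].
        - right; field; lra. }
      assert (Z4 : C * tpow q (S q) t <= c / 2 * tpow q (S p) t).
      { apply Rle_trans with (C * (tpow q 1 t * tpow q (S p) t));
          [now apply Rmult_le_compat_l |].
        rewrite <- Rmult_assoc; apply Rmult_le_compat_r; lra. }
      assert (Z5 : c / 2 * / t <= c / 2 * tpow q (S p) t)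
        by (apply Rmult_le_compat_l; lra).
      unfold Rdiv at 1; lra.
Qed.
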